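(* Let $(W,S)$ be a finite Coxeter system (with a symmetrisable Cartan matrix and its reflection representation), ordered by the right weak Bruhat order. (1) Two reduced words $\mathbf w_0,\mathbf w'_0$ for the longest element $w_0$ satisfy $\operatorname{heap}(\mathbf w_0)=\operatorname{heap}(\mathbf w'_0)$ if and only if they are related by a sequence of commutation moves. (2) For every polygon $P$ in $W$ there is a rank-two root subsystem $\Psi$ of $\Phi$ such that for each maximal chain $C$ of $P$ the set of labels $\lambda(\operatorname{Cov}(C))$ equals $\Psi^+$; moreover $P$ is a square iff $\Psi$ is commutative. (3) For every reduced word $\mathbf w_0$ of $w_0$, the edge labelling $\lambda^{\mathbf w_0}\colon\operatorname{Cov}(W)\to\operatorname{heap}(\mathbf w_0)$ is polygonal, forcing-consistent and polygon-complete. (4) For every reduced word $\mathbf w_0$, $\mathcal{MC}_{\lambda^{\mathbf w_0}}(W)$ is a partial order. (5) For a reduced word $\mathbf w_0$ and a lattice congruence $\theta$ on $W$ with quotient $q\colon W\to W/\theta$, the induced map $\widetilde q\colon\mathcal{MC}_{\lambda^{\mathbf w_0}}(W)\to\mathcal{MC}_{\lambda^{\mathbf w_0}_\theta}(W/\theta)$ is a contraction of preordered sets.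
   Context: Cartan matrix $A=(a_{ss'})$: $a_{ss}=2$, $a_{ss'}\le0$ with $a_{ss'}a_{s's}=4\cos^2(\pi/m(s,s'))$, $a_{ss'}=0\iff a_{s's}=0$, symmetrisable via $\delta\colon S\to\mathbb R_{>0}$. $V$ has basis $\alpha_s$, symmetric form $K$ with $K(\delta(s)^{-1}\alpha_s,\alpha_{s'})=a_{ss'}$, action $s(\alpha_{s'})=\alpha_{s'}-a_{ss'}\alpha_s$. Roots $\Phi=\{w(\alpha_s)\}$, positive roots $\Phi^+$, $\operatorname{inv}(w)=\Phi^+\cap w(\Phi^-)$; right weak order: $v\le w\iff\operatorname{inv}(v)\subseteq\operatorname{inv}(w)$ (a lattice). $\lambda\colon\operatorname{Cov}(W)\to\Phi^+$ sends $v\lessdot w$ to the unique root in $\operatorname{inv}(w)\setminus\operatorname{inv}(v)$. A rank-two root subsystem is a subset $\Psi\subseteq\Phi$ with 2-dimensional span, stable under reflections $r_\beta$ ($\beta\in\Psi$, $r_\beta(\beta)=-\beta$), maximal among such; $\Psi^+=\Psi\cap\Phi^+$; it is commutative if $\Psi=\{\pm\alpha,\pm\beta\}$ with $K(\alpha,\beta)=0$, non-commutative otherwise. A reduced word $\mathbf w_0$ of $w_0$ corresponds to a maximal chain with root sequence $(\beta_1,\dots,\beta_N)$; $\operatorname{heap}(\mathbf w_0)$ is the smallest partial order on $\Phi^+$ with $\beta_i\le\beta_j$ whenever $i<j$ and $\beta_i,\beta_j$ lie in a common non-commutative rank-two subsystem. $\lambda^{\mathbf w_0}$ is $\lambda$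 regarded as valued in this poset. Commutation move: $\mathbf ust\mathbf v\leftrightarrow\mathbf uts\mathbf v$ with $m(s,t)=2$. General notions: a polygon is an interval with exactly two maximal chains meeting only at the endpoints; a square is a four-element polygon. Ascending/descending chains have strictly increasing/decreasing labels. Covering relations are forcing-equivalent if every lattice congruence contracts both or neither; forcing-consistent: forcing-equivalent coverings have equal labels; polygonal: every non-square polygon has one ascending and one descending maximal chain. Square-equivalence of maximal chains is generated by swaps across squares; $\mathcal{MC}_\lambda(L)$ is the set of classes with the smallest preorder containing $[C]\preccurlyeq[C']$ whenever $C,C'$ agree outside a non-square polygon with $C$ through its ascending chain and $C'$ through the other (an increasing polygon move); polygon-complete: every increasing polygon move gives a covering relation of this preorder. Quotient labelling $\lambda_\theta([x],[y])$: the common label of coverings $x'\lessdot y'$ with $x'\in[x],y'\in[y]$. Contraction of preordered sets: surjective order-preserving map such that preimages of equivalence classes $\{y':y\preccurlyeq y'\preccurlyeq y\}$ are connected and every covering relation of the target lifts to a covering relation of the source.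
   Formalization: The symmetrising function δ is also required to agree on conjugate simple reflections; otherwise (e.g. A2 with a₁₂=−2, a₂₁=−1/2) inv(w)∖inv(v) need not contain a unique root and λ is undefined. Lifts of coverings of preordered sets are up to equivalence. *)

(* Defs.v *)
From mathcomp Require Import all_boot all_order all_algebra all_fingroup.
From mathcomp Require Import mxrepresentation.
From mathcomp Require Import boolp classical_sets reals trigo.
From Stdlib Require Export Relation_Definitions Relation_Operators.

Set Implicit Arguments.
Unset Strict Implicit.
Unset Printing Implicit Defensive.

Import Order.TTheory GRing.Theory Num.Theory.
Local Open Scope ring_scope.
Local Open Scope classical_set_scope.

(** * Preordered sets *)

Section Preorder.
Variables (X : Type) (le : relation X).

Definition pre_equiv : relation X := fun x y => le x y /\ le y x.
Definition pre_lt : relation X := fun x y => le x y /\ ~ le y x.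

Definition pre_covers : relation X :=
  fun x y => pre_lt x y /\ forall z, ~ (pre_lt x z /\ pre_lt z y).

(* Any two elements of [A] are joined by a zigzag of comparabilities in [A]. *)
Definition pre_connected (A : set X) : Prop :=
  forall x y, A x -> A y ->
    clos_refl_sym_trans X (fun a b => [/\ A a, A b & le a b]) x y.

End Preorder.

(* A covering relation of a preordered set is one between equivalence classes,
   so liftings are taken up to equivalence; when [leY] is antisymmetric, this
   is [f x = y] and [f x' = y']. *)
Definition contraction (X Y : Type) (leX : relation X) (leY : relation Y)
    (f : X -> Y) : Prop :=
  [/\ forall y, exists x, f x = y,
      forall x x', leX x x' -> leY (f x) (f x'),
      forall y, pre_connected leX (f @^-1` [set y' | pre_equiv leY y y'])
    & forall y y', pre_covers leY y y' -> exists x x',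
        [/\ pre_covers leX x x', pre_equiv leY y (f x)
          & pre_equiv leY y' (f x')]].

(** * Finite posets, chains and polygons *)

Section Poset.
Variables (T : finType) (le : rel T).

Definition covers : rel T := fun x y =>
  [&& le x y, x != y & [forall z, le x z && le z y ==> (z == x) || (z == y)]].

(* A maximal chain of the interval [x, y], as the sequence
   x = x_0, x_1, ..., x_k = y of its elements, endpoints included. *)
Definition interval_chain (x y : T) (c : seq T) : bool :=
  if c is z :: c' then [&& z == x, path covers z c' & last z c' == y]
  else false.

Definition max_chain (c : seq T) : Prop :=
  exists x y, [/\ forall z, le x z, forall z, le z y & interval_chain x y c].

(* The interval [x, y] is a polygon with maximal chains [c1] and [c2]. *)
Definition polygon (x y : T) (c1 c2 : seq T) : Prop :=
  [/\ interval_chain x y c1, interval_chain x y c2, c1 <> c2,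
      forall c, interval_chain x y c -> c = c1 \/ c = c2
    & forall z, z \in c1 -> z \in c2 -> z = x \/ z = y].

(* To be used for [x] and [y] the endpoints of a polygon. *)
Definition square (x y : T) : bool := #|[pred z | le x z && le z y]| == 4%N.

(* [c'] is obtained from [c] by replacing its segment [c1] by [c2]. *)
Definition replaces (c1 c2 c c' : seq T) : Prop :=
  exists a b, c = a ++ c1 ++ b /\ c' = a ++ c2 ++ b.

Definition square_move : relation (seq T) := fun c c' =>
  exists x y c1 c2, [/\ polygon x y c1 c2, square x y & replaces c1 c2 c c'].

Definition square_equiv : relation (seq T) :=
  clos_refl_sym_trans (seq T) square_move.

Definition MC : Type :=
  {X : set (seq T) | exists2 c, max_chain c & X = square_equiv c}.

(** * Lattice congruences *)

Definition is_join (x y j : T) : Prop :=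
  [/\ le x j, le y j & forall z, le x z -> le y z -> le j z].

Definition is_meet (x y m : T) : Prop :=
  [/\ le m x, le m y & forall z, le z x -> le z y -> le z m].

(* To be used when [le] is a lattice order; joins and meets are relational, so
   that the lattice property need not be proved before stating this. *)
Definition lattice_congruence (th : rel T) : Prop :=
  [/\ equivalence_rel th,
      forall x x' y y' j j', th x x' -> th y y' ->
        is_join x y j -> is_join x' y' j' -> th j j'
    & forall x x' y y' m m', th x x' -> th y y' ->
        is_meet x y m -> is_meet x' y' m' -> th m m'].

Definition forcing_equiv (x y x' y' : T) : Prop :=
  forall th, lattice_congruence th -> (th x y <-> th x' y').

End Poset.

(** * Edge labellings *)

Section Labelling.
Variables (T : finType) (le : rel T).
(* Only the values [lam x y] for [x] covered by [y] are meaningful. *)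
Variables (P : choiceType) (leP : rel P) (lam : T -> T -> P).

Definition labels (c : seq T) : seq P :=
  if c is x :: c' then pairmap lam x c' else [::].

Definition label_lt : rel P := fun a b => (a != b) && leP a b.
Definition ascending (c : seq T) : bool := sorted label_lt (labels c).
Definition descending (c : seq T) : bool :=
  sorted (fun a b => label_lt b a) (labels c).

Definition forcing_consistent : Prop :=
  forall x y x' y', covers le x y -> covers le x' y' ->
    forcing_equiv le x y x' y' -> lam x y = lam x' y'.

Definition polygonal : Prop :=
  forall x y c1 c2, polygon le x y c1 c2 -> ~~ square le x y ->
    (ascending c1 /\ descending c2) \/ (ascending c2 /\ descending c1).

Definition increasing_move (c c' : seq T) : Prop :=
  exists x y c1 c2, [/\ polygon le x y c1 c2, ~~ square le x y, ascending c1
                      & replaces c1 c2 c c'].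

Definition MC_move : relation (MC le) := fun X Y =>
  exists c c', [/\ sval X c, sval Y c' & increasing_move c c'].

Definition MC_le : relation (MC le) := clos_refl_trans (MC le) MC_move.

Definition polygon_complete : Prop :=
  forall X Y, MC_move X Y -> pre_covers MC_le X Y.

End Labelling.

(** * Quotients *)

Section Quotient.
Variables (T : finType) (le : rel T) (th : rel T).

Definition quot : finType :=
  {X : {set T} | X \in equivalence_partition th [set: T]%SET}.

Lemma quot_class_subproof (x : T) :
  [set y in [set: T]%SET | th x y]%SET
    \in equivalence_partition th [set: T]%SET.
Proof. exact/imset_f/finset.in_setT. Qed.

Definition quot_map (x : T) : quot :=
  exist (fun X : {set T} => X \in equivalence_partition th [set: T]%SET)
    [set y in [set: T] | th x y]%SET (quot_class_subproof x).

Definition quot_le : rel quot := fun X Y =>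
  [exists x in val X, exists y in val Y, le x y].

(* The common label of the coverings between [X] and [Y]; [p0] is a dummy
   value, taken when there are none. *)
Definition quot_label (P : choiceType) (p0 : P) (lam : T -> T -> P)
    (X Y : quot) : P :=
  xget p0 [set l | exists x y,
    [/\ x \in val X, y \in val Y, covers le x y & l = lam x y]].

(* The image of a chain, without repetitions. *)
Definition quot_chain (c : seq T) : seq quot := undup (map quot_map c).

End Quotient.

Arguments quot_le {T} le th _ _.
Arguments quot_label {T} le th {P} p0 lam _ _.

(** * Finite Coxeter systems *)

Section Coxeter.
Variables (gT : finGroupType) (n : nat) (s : 'I_n -> gT).

(* m(s_i, s_j) is the order of s_i s_j, and the relations
   (s_i s_j)^m(s_i, s_j) = 1 present the group. *)
Definition coxeter_m (i j : 'I_n) : nat := #[(s i * s j)%g]%g.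

Definition coxeter_system : Prop :=
  [/\ injective s,
      forall i, #[s i]%g = 2%N,
      <<[set s i | i : 'I_n]%SET>>%g = [set: gT]%SET
    & forall (H : groupType) (f : 'I_n -> H),
        (forall i j, ((f i * f j) ^+ coxeter_m i j)%g = 1%g) ->
        exists phi : {multiplicative gT -> H}, forall i, phi (s i) = f i].

Definition word_prod (u : seq 'I_n) : gT := (\prod_(i <- u) s i)%g.

Definition reduced_word (w : gT) (u : seq 'I_n) : Prop :=
  word_prod u = w /\ forall v, word_prod v = w -> (size u <= size v)%N.

Definition longest (w : gT) : Prop :=
  forall u v w', reduced_word w u -> reduced_word w' v -> (size v <= size u)%N.

Definition commutation_move : relation (seq 'I_n) := fun u v =>
  exists a b i j, [/\ u = a ++ [:: i; j] ++ b, v = a ++ [:: j; i] ++ b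
                    & coxeter_m i j = 2%N].

Definition word_chain (u : seq 'I_n) : seq gT :=
  1%g :: scanl (fun w i => (w * s i)%g) 1%g u.

Definition reflection (r : gT) : Prop := exists w i, r = (w * s i * w^-1)%g.

(** * Cartan matrices and root systems *)

Variables (R : realType) (A : 'M[R]_n) (delta : 'I_n -> R).

Definition cartan_matrix : Prop :=
  [/\ forall i, A i i = 2,
      forall i j, i != j -> A i j <= 0,
      forall i j, A i j * A j i = 4 * cos (pi / (coxeter_m i j)%:R) ^+ 2
    & forall i j, A i j = 0 <-> A j i = 0].

(* The last condition makes the root system reduced, so that covering relations
   of the weak order have unique labels. Without it, a_12 = -2, a_21 = -1/2 for
   m = 3 would be allowed, with alpha_2 and alpha_2 / 2 both roots. *)
Definition symmetriser : Prop :=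
  [/\ forall i, 0 < delta i,
      forall i j, delta i * A i j = delta j * A j i
    & forall i j w, s j = (s i ^ w)%g -> delta i = delta j].

Definition simple_root (i : 'I_n) : 'cV[R]_n := delta_mx i 0.

(* K(delta_i^-1 alpha_i, alpha_j) = a_ij. *)
Definition bil_form (u v : 'cV[R]_n) : R :=
  (u^T *m (\matrix_(i, j) (delta i * A i j)) *m v) 0 0.

(* The group acts on column vectors on the left. *)
Variable rho : mx_representation R [set: gT]%SET n.

Definition reflection_representation : Prop :=
  forall i j, rho (s i) *m simple_root j = simple_root j - A i j *: simple_root i.

Definition root_system : set 'cV[R]_n :=
  [set b | exists w i, b = rho w *m simple_root i].
Definition pos_roots : set 'cV[R]_n :=
  [set b | root_system b /\ forall i, 0 <= b i 0].
Definition neg_roots : set 'cV[R]_n :=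
  [set b | root_system b /\ forall i, b i 0 <= 0].

Definition inversions (w : gT) : set 'cV[R]_n :=
  pos_roots `&` (mulmx (rho w)) @` neg_roots.

Definition weak_le : rel gT := fun v w => `[< inversions v `<=` inversions w >].

(* The unique element of this difference when [w] covers [v]. *)
Definition root_label (v w : gT) : 'cV[R]_n :=
  xget 0 (inversions w `\` inversions v).

Definition two_dim_span (Psi : set 'cV[R]_n) : Prop :=
  exists U : {vspace 'cV[R]_n},
    [/\ \dim U = 2%N, forall b, Psi b -> b \in U
      & forall U' : {vspace 'cV[R]_n},
          (forall b, Psi b -> b \in U') -> (U <= U')%VS].

(* The reflection [r] with [r b = - b] is the reflection r_b. *)
Definition reflection_stable (Psi : set 'cV[R]_n) : Prop :=
  forall b c r, Psi b -> Psi c -> reflection r -> rho r *m b = - b ->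
    Psi (rho r *m c).

Definition pre_rank_two (Psi : set 'cV[R]_n) : Prop :=
  [/\ Psi `<=` root_system, two_dim_span Psi & reflection_stable Psi].

Definition rank_two_subsystem (Psi : set 'cV[R]_n) : Prop :=
  pre_rank_two Psi /\
  forall Psi', pre_rank_two Psi' -> Psi `<=` Psi' -> Psi' = Psi.

Definition commutative_subsystem (Psi : set 'cV[R]_n) : Prop :=
  exists a b, Psi = [set a; - a; b; - b] /\ bil_form a b = 0.

Definition root_sequence (u : seq 'I_n) : seq 'cV[R]_n :=
  labels root_label (word_chain u).

(* The relations b_i <= b_j generating the heap. *)
Definition heap_gen (u : seq 'I_n) (b c : 'cV[R]_n) : Prop :=
  exists i j, [/\ (i < j < size (root_sequence u))%N,
    b = nth 0 (root_sequence u) i, c = nth 0 (root_sequence u) j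
    & exists Psi, [/\ rank_two_subsystem Psi, ~ commutative_subsystem Psi,
                      Psi b & Psi c]].

Definition partial_order_on (B : set 'cV[R]_n) (r : relation 'cV[R]_n) : Prop :=
  [/\ forall b, B b -> r b b,
      forall b c, B b -> B c -> r b c -> r c b -> b = c
    & forall b c d, B b -> B c -> B d -> r b c -> r c d -> r b d].

(* The smallest partial order on the positive roots containing [heap_gen u]. *)
Definition heap (u : seq 'I_n) : rel 'cV[R]_n := fun b c =>
  `[< [/\ pos_roots b, pos_roots c
        & forall r, partial_order_on pos_roots r ->
            (forall b' c', heap_gen u b' c' -> r b' c') -> r b c] >].

End Coxeter.

(* Main.v *)
(** A polygon of the weak order is an interval [x, x w_st], where w_st is the
    longest element of the dihedral subgroup generated by s and t. The labels
    of its two maximal chains are the positive roots in the span of x alpha_s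
    and x alpha_t, listed in the two opposite angular orders. Inversion sets
    are closed and coclosed under nonnegative combinations, so a reduced word
    of w_0 lists the positive roots of a rank-two subsystem in one of these two
    orders. Counting the non-commutative subsystems which a maximal chain lists
    in the order opposite to that of w_0 gives a rank function on MC(W):
    squares preserve it and increasing polygon moves raise it by one, which
    gives antisymmetry and polygon-completeness.

    For forcing-consistency, the normalized height of roots is larger at the
    interior labels of a polygon than at its two extreme labels. Hence the
    edges labelled by a root b or by a root higher than b are closed under the
    forcing rules of polygons and generate a lattice congruence, which
    separates b from the other roots that are not higher.

    The quotient statement holds for every finite lattice in which each pair of
    upper covers of an element spans a polygon: a congruence collapses a
    polygon or maps it to a polygon, polygons of the quotient lift, and any two
    lifts of a maximal chain are related by polygon moves within the fibre. *)
Require Import Defs.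
From mathcomp Require Import all_boot all_order all_algebra all_fingroup.
From mathcomp Require Import mxrepresentation.
From mathcomp Require Import boolp classical_sets reals trigo.
From mathcomp Require Import zify ring lra.
From Stdlib Require Import Operators_Properties.

Set Implicit Arguments.
Unset Strict Implicit.
Unset Printing Implicit Defensive.

(** * Finite lattices and polygons *)

(** The lattice property of the weak order is not an input: joins, meets and the quotient theory are
    derived from a least element and from [up_polygonal]. The latter is accessible because dihedral
    intervals are explicit. After rescaling the simple roots, the k-th root along such an interval
    is a positive multiple of the vector with coordinates sin((k+1)t)/sin t and sin(kt)/sin t, where
    t = pi/m, whatever the Cartan matrix. Positivity, angular order, cone relations and growth of
    height then become identities for sines. Rescaling forgets lengths, so roots are compared up to
    positive factors and identified by [root_reduced]; this is where the symmetriser has to be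
    constant on conjugate simple reflections. Forcing is only needed from a bottom edge of a polygon
    to the opposite side, since w -> w w_0 reverses the order and preserves labels. For heaps,
    equality yields commutation moves by sorting: neighbouring roots of one word that the other word
    lists in reverse cannot lie in a common non-commutative subsystem, so they may be exchanged. *)

Definition order_rel (T : Type) (le : rel T) : Prop :=
  [/\ reflexive le, antisymmetric le & transitive le].

Section FinitePoset.
Variables (T : finType) (le : rel T).
Hypothesis le_order : order_rel le.

Let lexx : reflexive le. Proof. by case: le_order. Qed.
Let le_anti : antisymmetric le. Proof. by case: le_order. Qed.
Let le_trans : transitive le. Proof. by case: le_order. Qed.

Lemma covers_le x y : covers le x y -> le x y.
Proof. by case/and3P. Qed.

Lemma covers_neq x y : covers le x y -> x != y.
Proof. by case/and3P. Qed.

Lemma covers_between x y z :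
  covers le x y -> le x z -> le z y -> z = x \/ z = y.
Proof.
case/and3P=> _ _ /forallP /(_ z) + xz zy; rewrite xz zy /=.
by case/orP=> /eqP; [left | right].
Qed.

Lemma coversP x y : le x y -> x != y ->
  (forall z, le x z -> le z y -> z = x \/ z = y) -> covers le x y.
Proof.
move=> xy nxy H; apply/and3P; split=> //; apply/forallP=> z; apply/implyP.
by case/andP=> xz zy; case: (H z xz zy) => ->; rewrite eqxx ?orbT.
Qed.

Lemma covers_le_eq x a b : covers le x a -> covers le x b -> le a b -> a = b.
Proof.
move=> xa xb ab; case: (covers_between xb (covers_le xa) ab) => // ax.
by move: (covers_neq xa); rewrite ax eqxx.
Qed.

(** Well-founded by the size of the principal filter. Inductions start at the top because a polygon
    with bottom [x] reduces a claim at [x] to elements strictly above [x]. *)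
Lemma le_up_ind (P : T -> Prop) :
  (forall x, (forall y, le x y -> x != y -> P y) -> P x) -> forall x, P x.
Proof.
move=> IH x; have [k] := ubnP #|[pred z | le x z]|.
elim: k x => // k IHk x kx; apply: IH => y xy nxy; apply: IHk.
apply: leq_trans (_ : #|[pred z | le x z]| <= k)%N => //.
apply: proper_card; apply/properP; split.
  by apply/fintype.subsetP=> z; rewrite !inE; exact: le_trans.
exists x; rewrite !inE ?lexx //; apply/negP=> yx.
by move/eqP: nxy; apply; apply: le_anti; rewrite xy.
Qed.

Lemma exists_atom x y : le x y -> x != y -> exists2 a, covers le x a & le a y.
Proof.
move=> xy nxy; have Py : [&& le x y, x != y & le y y] by rewrite xy nxy lexx.
case: (arg_minnP (P := fun z => [&& le x z, x != z & le z y])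
  (fun z => #|[pred u | le u z]|) Py) => a /and3P[xa nxa ay] amin.
exists a => //; apply: coversP => // z xz za.
case: (eqVneq z x) => [|nzx]; first by left.
right; apply/eqP; apply: contraT => nza.
have := amin z; rewrite xz eq_sym nzx (le_trans za ay) => /(_ isT).
rewrite leqNgt => /negP; case; apply: proper_card; apply/properP; split.
  by apply/fintype.subsetP=> u; rewrite !inE => uz; exact: le_trans za.
exists a; rewrite !inE ?lexx //; apply/negP=> az.
by move/eqP: nza; apply; apply: le_anti; rewrite za.
Qed.

Lemma exists_chain x y : le x y ->
  exists2 c, path (covers le) x c & last x c = y.
Proof.
elim/le_up_ind: x => x IH xy; case: (eqVneq x y) => [<-|nxy].
  by exists [::].
have [a xa ay] := exists_atom xy nxy.
have [c pc lc] := IH a (covers_le xa) (covers_neq xa) ay.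
by exists (a :: c) => //=; rewrite xa.
Qed.

Lemma chain_le x c : path (covers le) x c -> path le x c.
Proof. by apply: sub_path => ? ?; exact: covers_le. Qed.

Lemma chain_le_mem x c z : path (covers le) x c -> z \in x :: c -> le x z.
Proof.
move=> /chain_le; rewrite (path_sortedE le_trans) => /andP[/allP H _].
by rewrite inE => /predU1P[->|/H].
Qed.

Lemma chain_mem_last x c z :
  path (covers le) x c -> z \in x :: c -> le z (last x c).
Proof.
elim: c x z => [|y c IH] x z /=; first by move=> _; rewrite inE => /eqP->.
move=> /andP[xy pc]; rewrite inE => /predU1P[->|zc]; last exact: IH.
by apply: le_trans (covers_le xy) _; apply: IH => //; rewrite inE eqxx.
Qed.

Lemma chain_le_last x c : path (covers le) x c -> le x (last x c).
Proof. by move=> pc; apply: chain_mem_last pc _; rewrite inE eqxx. Qed.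

Lemma chain_uniq x c : path (covers le) x c -> uniq (x :: c).
Proof.
elim: c x => //= y c IH x /andP[xy pc]; rewrite IH // andbT; apply/negP => xc.
move: (covers_neq xy); rewrite (le_anti (x := x) (y := y)) ?eqxx //.
by rewrite covers_le //=; apply: chain_le_mem pc xc.
Qed.

Lemma interval_chainP x y c : interval_chain le x y c ->
  exists c', [/\ c = x :: c', path (covers le) x c' & last x c' = y].
Proof. by case: c => //= z c /and3P[/eqP-> pc /eqP lc]; exists c. Qed.

Lemma interval_chain_cons x y c :
  interval_chain le x y (x :: c) = path (covers le) x c && (last x c == y).
Proof. by rewrite /= eqxx. Qed.

Lemma interval_chain_mem x y c z :
  interval_chain le x y c -> z \in c -> le x z && le z y.
Proof.
case/interval_chainP=> c' [-> pc <-] zc.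
by rewrite (chain_le_mem pc zc) (chain_mem_last pc zc).
Qed.

Lemma interval_chain_uniq x y c : interval_chain le x y c -> uniq c.
Proof. by case/interval_chainP=> c' [-> pc _]; exact: chain_uniq. Qed.

Lemma mem_some_chain x y z : le x z -> le z y ->
  exists2 c, interval_chain le x y c & z \in c.
Proof.
move=> /exists_chain[c1 p1 l1] /exists_chain[c2 p2 l2].
exists (x :: c1 ++ c2).
  by rewrite interval_chain_cons cat_path p1 l1 p2 last_cat l1 l2 eqxx.
by rewrite -l1 -cat_cons mem_cat mem_last.
Qed.

Lemma chain_of_covers x y c :
  covers le x y -> path (covers le) x c -> last x c = y -> c = [:: y].
Proof.
case: c => [|z c] xy /=; first by move=> _ e; move: (covers_neq xy); rewrite e eqxx.
case/andP=> xz pc lc; have zy : z = y.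
  by apply: covers_le_eq xz xy _; rewrite -lc; exact: chain_le_last.
subst z; case: c pc lc => // u c pc lc; move: (chain_uniq pc).
by rewrite cons_uniq => /andP[/negP[]]; rewrite -lc /= mem_last.
Qed.

Section Polygons.
Variables (x y : T) (c1 c2 : seq T).
Hypothesis pol : polygon le x y c1 c2.

Lemma polygon_sym : polygon le x y c2 c1.
Proof.
case: pol => h1 h2 ne uq me; split=> //; first by move=> e; apply: ne.
- by move=> c /uq[]; [right | left].
- by move=> z z2 z1; exact: me.
Qed.

(** If both chains had the same second element, it would be a common element other than [x], hence
    [y]; both chains would then consist of [x] and [y] alone. *)
Lemma polygon_shape : exists a b d1 d2,
  [/\ c1 = x :: a :: d1, c2 = x :: b :: d2, a != b,
      covers le x a & covers le x b].
Proof.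
case: pol => h1 h2 ne uq me.
case/interval_chainP: (h1) => [[|a d1] [e1 p1 l1]];
case/interval_chainP: (h2) => [[|b d2] [e2 p2 l2]].
- by case: ne; rewrite e1 e2.
- move: (chain_uniq p2); rewrite cons_uniq => /andP[/negP[]].
  by rewrite (l1 : x = y) -l2 /= mem_last.
- move: (chain_uniq p1); rewrite cons_uniq => /andP[/negP[]].
  by rewrite (l2 : x = y) -l1 /= mem_last.
move: p1 p2 => /= /andP[xa p1] /andP[xb p2].
exists a, b, d1, d2; split=> //; apply/eqP=> eab; subst b.
have [] : a = x \/ a = y.
- by apply: me; rewrite ?e1 ?e2 !inE eqxx orbT.
- by move=> ax; move: (covers_neq xa); rewrite ax eqxx.
move=> ay; subst a; have nil d : path (covers le) y d -> last y d = y -> d = [::].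
  case: d => // u d pd ld; move: (chain_uniq pd).
  by rewrite cons_uniq => /andP[/negP[]]; rewrite -ld /= mem_last.
have n1 := nil _ p1 l1; have n2 := nil _ p2 l2.
by apply: ne; rewrite e1 e2 n1 n2.
Qed.

Lemma polygon_le : le x y.
Proof.
by case: pol => /interval_chainP[c [_ pc <-]] *; exact: chain_le_last.
Qed.

Lemma polygon_mem z : (le x z && le z y) = (z \in c1) || (z \in c2).
Proof.
case: pol => h1 h2 ne uq me; apply/idP/idP.
  by case/andP=> xz zy; have [c /uq[]-> ->] := mem_some_chain xz zy; rewrite ?orbT.
by case/orP=> [/(interval_chain_mem h1)|/(interval_chain_mem h2)].
Qed.

Lemma polygon_ends : [/\ x \in c1, y \in c1, x \in c2 & y \in c2].
Proof.
case: pol => /interval_chainP[d1 [-> _ <-]] /interval_chainP[d2 [-> _ l2]] _ _ _.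
by rewrite !mem_head mem_last -l2 mem_last.
Qed.

(** A comparability between inner elements of different sides would produce a third maximal chain of
    the interval. *)
Lemma polygon_le_cross u v :
  u \in c1 -> v \in c2 -> le u v -> u = x \/ v = y.
Proof.
move=> u1 v2 uv; case: (pol) => h1 h2 ne uq me.
have /andP[xu uy] := interval_chain_mem h1 u1.
have /andP[xv vy] := interval_chain_mem h2 v2.
have [d1 p1 l1] := exists_chain xu.
have [d2 p2 l2] := exists_chain uv.
have [d3 p3 l3] := exists_chain vy.
have cc : interval_chain le x y (x :: d1 ++ d2 ++ d3).
  by rewrite interval_chain_cons !cat_path p1 l1 p2 l2 p3 !last_cat l1 l2 l3 eqxx.
have uc : u \in x :: d1 ++ d2 ++ d3 by rewrite -cat_cons mem_cat -l1 mem_last.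
have vc : v \in x :: d1 ++ d2 ++ d3.
  rewrite catA -cat_cons mem_cat; apply/orP; left.
  by rewrite -l2 -l1 -last_cat mem_last.
have [e|e] := uq _ cc; rewrite e in uc vc.
- case: (me v) => //; last by right.
  by move=> vx; left; apply: le_anti; rewrite xu -vx uv.
- case: (me u) => //; first by left.
  by move=> uy'; right; apply: le_anti; rewrite vy -uy' uv.
Qed.

(** Inclusion-exclusion: the two chains cover the interval and share exactly the endpoints, which
    accounts for the 2. *)
Lemma polygon_card :
  (#|[pred z | le x z && le z y]| + 2 = size c1 + size c2)%N.
Proof.
case: (pol) => h1 h2 ne uq me.
have u1 := interval_chain_uniq h1; have u2 := interval_chain_uniq h2.
have -> : #|[pred z | le x z && le z y]| = #|[predU mem c1 & mem c2]|.
  by apply: eq_card => z; rewrite !inE polygon_mem.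
have xney : x != y.
  have [a [b [d1 [d2 [e1 _ _ xa _]]]]] := polygon_shape.
  apply/eqP=> xy; move: (covers_neq xa); rewrite (le_anti (x := x) (y := a)) ?eqxx //.
  rewrite covers_le //= [X in le _ X]xy.
  have a1 : a \in c1 by rewrite e1 !inE eqxx orbT.
  by have /andP[] := interval_chain_mem h1 a1.
rewrite -(card_uniqP u1) -(card_uniqP u2) -cardUI; congr (_ + _)%N.
rewrite -[LHS](_ : size [:: x; y] = 2) //.
rewrite -(card_uniqP (_ : uniq [:: x; y])) /= ?inE ?xney //.
apply: eq_card => z; rewrite !inE; have [x1 y1 x2 y2] := polygon_ends.
apply/idP/idP=> [/orP[]/eqP->|/andP[z1 z2]]; rewrite ?x1 ?x2 ?y1 ?y2 //.
by case: (me z z1 z2) => ->; rewrite eqxx ?orbT.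
Qed.

Lemma polygon_size : (2 < size c1)%N.
Proof.
have [a [b [d1 [d2 [e1 e2 ab xa xb]]]]] := polygon_shape.
rewrite e1; case: d1 e1 => // e1.
case: pol => h1 h2 ne uq me; case/interval_chainP: h1 => d [+ _].
rewrite e1 => -[<-] /= ay; move/eqP: ab; case; apply/esym.
apply: covers_le_eq xb xa _; rewrite ay.
have b2 : b \in c2 by rewrite e2 !inE eqxx orbT.
by have /andP[] := interval_chain_mem h2 b2.
Qed.

End Polygons.

Lemma squareP x y c1 c2 : polygon le x y c1 c2 ->
  square le x y <-> size c1 = 3%N /\ size c2 = 3%N.
Proof.
move=> pol; have := polygon_card pol; have := polygon_size pol.
have := polygon_size (polygon_sym pol); rewrite /square.
by move=> s2 s1 e; split=> [/eqP|] h; [|apply/eqP]; lia.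
Qed.

(** The join lies in the interval, hence on one of the sides, and is above an atom of the other
    side; [polygon_le_cross] leaves only the top. *)
Lemma polygon_join x y a b d1 d2 j : polygon le x y (x :: a :: d1) (x :: b :: d2) ->
  is_join le a b j -> j = y.
Proof.
move=> pol [aj bj jmin].
have [h1 h2 ne uq me] := pol.
have a1 : a \in x :: a :: d1 by rewrite !inE eqxx orbT.
have b2 : b \in x :: b :: d2 by rewrite !inE eqxx orbT.
have /andP[xa ay] := interval_chain_mem h1 a1.
have /andP[xb by_] := interval_chain_mem h2 b2.
have jy := jmin _ ay by_.
have ax : a <> x.
  by move=> e; move: (interval_chain_uniq h1); rewrite /= e !inE eqxx.
have bx : b <> x.
  by move=> e; move: (interval_chain_uniq h2); rewrite /= e !inE eqxx.
have := polygon_mem pol j; rewrite (le_trans xa aj) jy => /esym/orP[j1|j2].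
- by case: (polygon_le_cross (polygon_sym pol) b2 j1 bj) => // /bx.
- by case: (polygon_le_cross pol a1 j2 aj) => // /ax.
Qed.

End FinitePoset.

(** The local condition from which the order theory below is built. The join is part of it because
    no lattice structure is available yet; [join_above] then yields all joins. *)
Definition up_polygonal (T : finType) (le : rel T) : Prop :=
  forall x a b, covers le x a -> covers le x b -> a != b ->
    exists y d1 d2, polygon le x y (x :: a :: d1) (x :: b :: d2) /\
                    is_join le a b y.

(** * Joins and meets from polygons on pairs of upper covers *)

Section JoinMeet.
Variables (T : finType) (le : rel T) (bot top : T).
Hypotheses (le_order : order_rel le) (bot_le : forall x, le bot x)
  (up_poly : up_polygonal le).

Let lexx : reflexive le. Proof. by case: le_order. Qed.
Let le_anti : antisymmetric le. Proof. by case: le_order. Qed.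
Let le_trans : transitive le. Proof. by case: le_order. Qed.

(* The lemma of Bjorner, Edelman and Ziegler: joins of pairs of atoms of upper
   intervals suffice. *)
Lemma join_above z a b : le z a -> le z b -> exists j, is_join le a b j.
Proof.
elim/(le_up_ind le_order): z a b => z IH a b za zb.
case: (eqVneq z a) => [<-|nza]; first by exists b; split.
case: (eqVneq z b) => [<-|nzb]; first by exists a; split.
have [a1 za1 a1a] := exists_atom le_order za nza.
have [b1 zb1 b1b] := exists_atom le_order zb nzb.
have [m [a1m b1m mmin]] : exists m, is_join le a1 b1 m.
  case: (eqVneq a1 b1) => [<-|nab]; first by exists a1; split.
  by have [m [_ [_ [_ jm]]]] := up_poly za1 zb1 nab; exists m.
have [p [ap mp pmin]] := IH a1 (covers_le za1) (covers_neq za1) a m a1a a1m.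
have [q [bq pq qmin]] :=
  IH b1 (covers_le zb1) (covers_neq zb1) b p b1b (le_trans b1m mp).
exists q; split=> // [|u au bu]; first exact: le_trans pq.
by apply: qmin => //; apply: pmin => //; apply: mmin;
   [apply: le_trans au | apply: le_trans bu].
Qed.

(** The default [x] is never taken, by [jnP]. *)
Definition jn x y := odflt x [pick j | `[< is_join le x y j >]].

Lemma jnP x y : is_join le x y (jn x y).
Proof.
rewrite /jn; case: pickP => [j /asboolP //|H].
by have [j /asboolP] := join_above (bot_le x) (bot_le y); rewrite H.
Qed.

Lemma le_jnl x y : le x (jn x y). Proof. by case: (jnP x y). Qed.
Lemma le_jnr x y : le y (jn x y). Proof. by case: (jnP x y). Qed.
Lemma jn_le x y z : le x z -> le y z -> le (jn x y) z.
Proof. by case: (jnP x y) => _ _; apply. Qed.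

Lemma is_join_eq x y j : is_join le x y j -> j = jn x y.
Proof.
by case=> xj yj jmin; apply: le_anti; rewrite jmin ?le_jnl ?le_jnr ?jn_le.
Qed.

Lemma jnC x y : jn x y = jn y x.
Proof. by apply: le_anti; rewrite !jn_le ?le_jnl ?le_jnr. Qed.

Lemma jn_idPl x y : le y x -> jn x y = x.
Proof. by move=> yx; apply: le_anti; rewrite le_jnl jn_le. Qed.

Lemma jn_idPr x y : le x y -> jn x y = y.
Proof. by move=> xy; rewrite jnC jn_idPl. Qed.

Definition joins (s : seq T) := foldr jn bot s.

Lemma le_joins s z : z \in s -> le z (joins s).
Proof.
elim: s => //= y s IH; rewrite inE => /predU1P[->|/IH zs]; first exact: le_jnl.
by apply: (le_trans zs); exact: le_jnr.
Qed.

Lemma joins_le s u : (forall z, z \in s -> le z u) -> le (joins s) u.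
Proof.
elim: s => [|y s IH] H //=; apply: jn_le; first by apply: H; rewrite mem_head.
by apply: IH => z zs; apply: H; rewrite inE zs orbT.
Qed.

(** In a finite join-semilattice with a least element, the join of the common lower bounds is the
    meet. *)
Definition mt x y := joins [seq z <- enum T | le z x && le z y].

Lemma mtP x y : is_meet le x y (mt x y).
Proof.
rewrite /mt; split.
- by apply: joins_le => z; rewrite mem_filter => /andP[/andP[]].
- by apply: joins_le => z; rewrite mem_filter => /andP[/andP[]].
- by move=> z zx zy; apply: le_joins; rewrite mem_filter zx zy mem_enum.
Qed.

Lemma mt_lel x y : le (mt x y) x. Proof. by case: (mtP x y). Qed.
Lemma mt_ler x y : le (mt x y) y. Proof. by case: (mtP x y). Qed.
Lemma le_mt x y z : le z x -> le z y -> le z (mt x y).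
Proof. by case: (mtP x y) => _ _; apply. Qed.

Lemma mtC x y : mt x y = mt y x.
Proof. by apply: le_anti; rewrite !le_mt ?mt_lel ?mt_ler. Qed.

Lemma mt_idPl x y : le x y -> mt x y = x.
Proof. by move=> xy; apply: le_anti; rewrite mt_lel le_mt. Qed.

Lemma mt_idPr x y : le y x -> mt x y = y.
Proof. by move=> yx; rewrite mtC mt_idPl. Qed.

(** The meet lies on one of the two sides and is below an element of the other, so
    [polygon_le_cross] forces it down to [x]. *)
Lemma polygon_mt x y c1 c2 u v : polygon le x y c1 c2 ->
  u \in c1 -> v \in c2 -> u != y -> v != y -> mt u v = x.
Proof.
move=> pol u1 v2 uy vy; have [h1 h2 ne uq me] := pol.
have /andP[xu _] := interval_chain_mem le_order h1 u1.
have /andP[xv vy'] := interval_chain_mem le_order h2 v2.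
have xm : le x (mt u v) by apply: le_mt.
have := polygon_mem le_order pol (mt u v).
rewrite xm (le_trans (mt_ler _ _) vy') => /esym/orP[m1|m2].
- case: (polygon_le_cross le_order pol m1 v2 (mt_ler _ _)) => // e.
  by move: vy; rewrite e eqxx.
- case: (polygon_le_cross le_order (polygon_sym pol) m2 u1 (mt_lel _ _)) => // e.
  by move: uy; rewrite e eqxx.
Qed.

Lemma up_polygon x a b : covers le x a -> covers le x b -> a != b ->
  exists d1 d2, polygon le x (jn a b) (x :: a :: d1) (x :: b :: d2).
Proof.
move=> xa xb nab; have [y [d1 [d2 [pol j]]]] := up_poly xa xb nab.
by exists d1, d2; rewrite -(is_join_eq j).
Qed.

End JoinMeet.

(** * Square classes of maximal chains, and gradings of them *)

Section MaximalChains.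
Variables (T : finType) (le : rel T).

Lemma replaces_max_chain x y c1 c2 c c' :
  interval_chain le x y c1 -> interval_chain le x y c2 ->
  replaces c1 c2 c c' -> max_chain le c -> max_chain le c'.
Proof.
case/interval_chainP=> d1 [-> p1 l1] /interval_chainP[d2 [-> p2 l2]].
case=> a [b [-> ->]] [u [v [ub vt h]]]; exists u, v; split=> //.
case: a h => [|z a]; rewrite /= !(cat_path, last_cat) /= ?(cat_path, last_cat);
  by rewrite p1 l1 p2 l2.
Qed.

Lemma square_equiv_max_chain c c' :
  square_equiv le c c' -> (max_chain le c <-> max_chain le c').
Proof.
elim=> {c c'} [c c' [x [y [c1 [c2 [[h1 h2 _ _ _] _ [a [b [e e']]]]]]]]|c|
        c c' _ [h1 h2]|c d e _ [h1 h2] _ [h3 h4]]; [|by []|by split|by split; auto].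
by split; [apply: replaces_max_chain h1 h2 _ | apply: replaces_max_chain h2 h1 _];
   exists a, b.
Qed.

Lemma MC_inj (X Y : MC le) c : sval X c -> sval Y c -> X = Y.
Proof.
case: X Y => [X hX] [Y hY] /= Xc Yc; apply: eq_exist => /=.
case: hX hY => [d dm eX] [e em eY]; move: Xc Yc; rewrite eX eY => dc ec.
apply/funext=> z; apply/propext; split=> h.
- by apply: rst_trans ec _; apply: rst_trans h; exact: rst_sym.
- by apply: rst_trans dc _; apply: rst_trans h; exact: rst_sym.
Qed.

Lemma MC_max_chain (X : MC le) c : sval X c -> max_chain le c.
Proof.
by case: X => X [d dm eX] /=; rewrite eX => /square_equiv_max_chain <-.
Qed.

Lemma MC_square_equiv (X : MC le) c c' :
  sval X c -> sval X c' -> square_equiv le c c'.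
Proof.
case: X => X [d dm eX] /=; rewrite eX => dc dc'.
by apply: rst_trans dc'; exact: rst_sym.
Qed.

Lemma MC_closed (X : MC le) c c' :
  sval X c -> square_equiv le c c' -> sval X c'.
Proof. by case: X => X [d dm eX] /=; rewrite eX => h; exact: rst_trans. Qed.

Lemma MC_inhabited (X : MC le) : exists c, sval X c.
Proof. by case: X => X [d dm eX]; exists d; rewrite /= eX; exact: rst_refl. Qed.

Definition mc_class c (h : max_chain le c) : MC le :=
  exist _ (square_equiv le c) (ex_intro2 _ _ c h erefl).

Lemma mc_classE c (h : max_chain le c) : sval (mc_class h) c.
Proof. exact: rst_refl. Qed.

Section Rank.
Variables (P : choiceType) (leP : rel P) (lam : T -> T -> P).
Variable rk : seq T -> nat.
Hypothesis rk_square : forall c c', max_chain le c ->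
  square_move le c c' -> rk c = rk c'.
Hypothesis rk_move : forall c c', max_chain le c ->
  increasing_move le leP lam c c' -> rk c' = (rk c).+1.

Let rk_equiv c c' : max_chain le c -> square_equiv le c c' -> rk c = rk c'.
Proof.
move=> + h; elim: h => {c c'} [c c' h m|//|c c' h IH m|c d e h1 IH1 h2 IH2 m].
- exact: rk_square.
- by rewrite IH //; apply/(square_equiv_max_chain h).
- by rewrite IH1 // IH2 //; apply/(square_equiv_max_chain h1).
Qed.

Let move_rk (X Y : MC le) c d : MC_move leP lam X Y ->
  sval X c -> sval Y d -> rk d = (rk c).+1.
Proof.
case=> c' [d' [Xc Yd m]] Xc' Yd'.
rewrite (rk_equiv (MC_max_chain Xc') (MC_square_equiv Xc' Xc)).
rewrite (rk_equiv (MC_max_chain Yd') (MC_square_equiv Yd' Yd)).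
exact: rk_move (MC_max_chain Xc) m.
Qed.

Let le_rk (X Y : MC le) : MC_le leP lam X Y ->
  X = Y \/ forall c d, sval X c -> sval Y d -> (rk c < rk d)%N.
Proof.
elim=> {X Y} [X Y m|X|X Y Z _ [->//|h1] _ [<-|h2]]; [|by left|by right|].
  by right=> c d Xc Yd; rewrite (move_rk m Xc Yd).
right=> c e Xc Ze; have [d Yd] := MC_inhabited Y.
exact: ltn_trans (h1 c d Xc Yd) (h2 d e Yd Ze).
Qed.

Lemma graded_MC_order : Relation_Definitions.order (MC le) (MC_le leP lam).
Proof.
split.
- by move=> X; exact: rt_refl.
- by move=> X Y Z; exact: rt_trans.
- move=> X Y /le_rk[//|h1] /le_rk[//|h2].
  have [c Xc] := MC_inhabited X; have [d Yd] := MC_inhabited Y.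
  by have := ltn_trans (h1 _ _ Xc Yd) (h2 _ _ Yd Xc); rewrite ltnn.
Qed.

(** A move raises the rank by exactly one and every proper comparability raises it strictly, so no
    class fits in between. *)
Lemma graded_polygon_complete : polygon_complete le leP lam.
Proof.
move=> X Y m; have [c Xc] := MC_inhabited X; have [d Yd] := MC_inhabited Y.
have e := move_rk m Xc Yd; split.
  split; first exact: rt_step.
  case/le_rk => [eYX|/(_ _ _ Yd Xc)]; last by lia.
  by subst Y; have := move_rk m Xc Xc; lia.
move=> Z [[/le_rk XZ nZX] [/le_rk ZY nYZ]]; have [z Zz] := MC_inhabited Z.
case: XZ => [eXZ|/(_ _ _ Xc Zz) ?]; first by apply: nZX; rewrite eXZ; exact: rt_refl.
case: ZY => [eZY|/(_ _ _ Zz Yd) ?]; first by apply: nYZ; rewrite eZY; exact: rt_refl.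
lia.
Qed.

End Rank.
End MaximalChains.

(** * Quotients by lattice congruences *)

Section Congruence.
Variables (T : finType) (le : rel T) (bot : T).
Hypotheses (le_order : order_rel le) (bot_le : forall x, le bot x)
  (up_poly : up_polygonal le).
Variable th : rel T.
Hypothesis th_cong : lattice_congruence le th.

Let lexx : reflexive le. Proof. by case: le_order. Qed.
Let le_anti : antisymmetric le. Proof. by case: le_order. Qed.
Let le_trans : transitive le. Proof. by case: le_order. Qed.

Local Notation jn := (jn le).
Local Notation mt := (mt le bot).
Local Notation q := (quot_map th).
Local Notation leQ := (quot_le le th).
Local Notation qc := (quot_chain th).

Let jnPx x y : is_join le x y (jn x y) := jnP le_order bot_le up_poly x y.
Let lejl x y : le x (jn x y) := le_jnl le_order bot_le up_poly x y.
Let lejr x y : le y (jn x y) := le_jnr le_order bot_le up_poly x y.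
Let jnle x y z : le x z -> le y z -> le (jn x y) z :=
  @jn_le _ _ _ le_order bot_le up_poly x y z.
Let jnl x y : le y x -> jn x y = x := @jn_idPl _ _ _ le_order bot_le up_poly x y.
Let jnr x y : le x y -> jn x y = y := @jn_idPr _ _ _ le_order bot_le up_poly x y.
Let mtPx x y : is_meet le x y (mt x y) := mtP le_order bot_le up_poly x y.
Let mtre x y : le (mt x y) y := mt_ler le_order bot_le up_poly x y.
Let lemt x y z : le z x -> le z y -> le z (mt x y) :=
  @le_mt _ _ _ le_order bot_le up_poly x y z.
Let mtl x y : le x y -> mt x y = x := @mt_idPl _ _ _ le_order bot_le up_poly x y.
Let mtr x y : le y x -> mt x y = y := @mt_idPr _ _ _ le_order bot_le up_poly x y.

Lemma th_refl x : th x x.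
Proof. by case: th_cong => /(_ x x x)[]. Qed.

Lemma th_sym x y : th x y = th y x.
Proof.
case: th_cong => H _ _; apply/idP/idP => h.
- by case: (H x y x) => _ /(_ h) <-; exact: th_refl.
- by case: (H y x y) => _ /(_ h) <-; exact: th_refl.
Qed.

Lemma th_trans y x z : th x y -> th y z -> th x z.
Proof. by case: th_cong => H _ _ h; case: (H x y z) => _ /(_ h) ->. Qed.

Lemma th_jn x x' y y' : th x x' -> th y y' -> th (jn x y) (jn x' y').
Proof. by move=> h1 h2; case: th_cong => _ H _; apply: H h1 h2 _ _. Qed.

Lemma th_mt x x' y y' : th x x' -> th y y' -> th (mt x y) (mt x' y').
Proof. by move=> h1 h2; case: th_cong => _ _ H; exact: H h1 h2 (mtPx _ _) (mtPx _ _). Qed.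

(** Meeting both sides of [th x z] with [y] gives [th x y]: congruence classes are convex. *)
Lemma th_convex x y z : le x y -> le y z -> th x z -> th x y.
Proof.
by move=> xy yz xz; have := th_mt xz (th_refl y); rewrite (mtl xy) (mtr yz).
Qed.

Lemma mem_quot_map x y : (y \in val (q x)) = th x y.
Proof. by rewrite inE /= finset.in_setT. Qed.

Lemma quot_map_eq x y : (q x == q y) = th x y.
Proof.
apply/eqP/idP => [e|h]; first by rewrite -mem_quot_map e mem_quot_map th_refl.
apply: val_inj; apply/setP => z; rewrite !mem_quot_map; apply/idP/idP => h'.
- by apply: th_trans h'; rewrite th_sym.
- exact: th_trans h'.
Qed.

Lemma quot_mapP (X : quot th) : exists x, X = q x.
Proof.
case: X => X XP; case/imsetP: (XP) => x _ e; exists x; apply: val_inj => /=.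
by rewrite e; apply/setP => y; rewrite !inE.
Qed.

(** Replaces the search for comparable representatives by an equation between classes, x \/ y ~ y,
    so that the order axioms of the quotient become computations with joins. *)
Lemma quot_leP x y : leQ (q x) (q y) = th y (jn x y).
Proof.
apply/idP/idP.
- case/existsP=> x' /andP[+ /existsP[y' /andP[]]]; rewrite !mem_quot_map => xx' yy' l.
  rewrite th_sym; apply: (th_trans (th_jn xx' yy')).
  by rewrite jnr // th_sym.
- move=> h; apply/existsP; exists x; rewrite mem_quot_map th_refl /=.
  by apply/existsP; exists (jn x y); rewrite mem_quot_map h lejl.
Qed.

Lemma quot_le_map x y : le x y -> leQ (q x) (q y).
Proof. by move=> xy; rewrite quot_leP jnr // th_refl. Qed.

Lemma quot_le_order : order_rel leQ.
Proof.
split.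
- by move=> X; have [x ->] := quot_mapP X; exact: quot_le_map.
- move=> X Y; have [x ->] := quot_mapP X; have [y ->] := quot_mapP Y.
  rewrite !quot_leP => /andP[h1 h2]; apply/eqP; rewrite quot_map_eq.
  apply: th_trans h2 _; rewrite th_sym (jnC le_order bot_le up_poly) //.
- move=> Y X Z; have [x ->] := quot_mapP X; have [y ->] := quot_mapP Y.
  have [z ->] := quot_mapP Z; rewrite !quot_leP => h1 h2.
  have h3 : th z (jn (jn x y) (jn y z)).
    apply: th_trans h2 _; rewrite -{1}(jnr (lejl y z)).
    by apply: th_jn => //; exact: th_refl.
  apply: th_convex (lejr _ _) _ h3; apply: jnle.
  + exact: le_trans (lejl _ _) (lejl _ _).
  + exact: le_trans (lejr _ _) (lejr _ _).
Qed.

Lemma quot_le_bot X : leQ (q bot) X.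
Proof. by have [x ->] := quot_mapP X; exact: quot_le_map. Qed.

(** Any representative z of [Z] can be pushed into the interval, as (x \/ z) /\ y, without leaving
    its class. *)
Lemma quot_interval x y Z : le x y -> leQ (q x) Z -> leQ Z (q y) ->
  exists z, [/\ Z = q z, le x z & le z y].
Proof.
move=> xy; have [z ->] := quot_mapP Z; rewrite !quot_leP => h1 h2.
exists (mt (jn x z) y); split; last exact: mtre.
- apply/eqP; rewrite quot_map_eq.
  apply: (th_trans (y := mt z y)); last by apply: th_mt => //; exact: th_refl.
  by rewrite -{1}(mtl (lejl z y)); apply: th_mt; [exact: th_refl | rewrite th_sym].
- exact: lemt.
Qed.

Lemma quot_covers x y : covers le x y -> ~~ th x y -> covers leQ (q x) (q y).
Proof.
move=> xy nxy; apply: coversP; [|by rewrite quot_map_eq|].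
  by apply: quot_le_map; exact: covers_le xy.
move=> Z xZ Zy; have [z [-> xz zy]] := quot_interval (covers_le xy) xZ Zy.
by case: (covers_between xy xz zy) => ->; [left | right].
Qed.

Lemma quot_is_join a b : is_join leQ (q a) (q b) (q (jn a b)).
Proof.
split; [exact: quot_le_map | exact: quot_le_map | move=> Z].
have [z ->] := quot_mapP Z; rewrite !quot_leP => h1 h2.
have h3 : th z (jn (jn a z) (jn b z)).
  by rewrite -{1}(jnl (lexx z)); exact: th_jn.
apply: th_convex (lejr _ _) _ h3; apply: jnle; last exact: le_trans (lejr _ _) (lejl _ _).
by apply: jnle; [exact: le_trans (lejl _ _) (lejl _ _) | exact: le_trans (lejl _ _) (lejr _ _)].
Qed.

(** By convexity a class met by a chain is met in consecutive elements, so [undup] removes exactly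
    the repetitions caused by contracted coverings. *)
Lemma quot_chain_cons x y c : path (covers le) x (y :: c) ->
  qc [:: x, y & c] = if th x y then qc (y :: c) else q x :: qc (y :: c).
Proof.
move=> /andP[xy pc]; rewrite {1}/quot_chain map_cons [undup _]/=.
suff -> : (q x \in map q (y :: c)) = th x y by [].
apply/idP/idP => [/mapP[z zc /eqP]|h]; last first.
  by move: h; rewrite -quot_map_eq => /eqP->; rewrite map_cons mem_head.
rewrite quot_map_eq; apply: th_convex (covers_le xy) _.
exact: chain_le_mem pc zc.
Qed.

Lemma quot_chain1 x : qc [:: x] = [:: q x].
Proof. by []. Qed.

Lemma quot_chain_path x c : path (covers le) x c -> exists C,
  [/\ qc (x :: c) = q x :: C, path (covers leQ) (q x) C
    & last (q x) C = q (last x c)].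
Proof.
elim: c x => [|y c IH] x pc; first by exists [::].
have [xy pc'] := andP pc; have [C [e pC lC]] := IH y pc'.
rewrite quot_chain_cons // e; case: ifPn => [|nxy]; last first.
  by exists (q y :: C); split=> //=; rewrite quot_covers.
by rewrite -quot_map_eq => /eqP exy; exists C; rewrite exy.
Qed.

Lemma quot_chain_cat x c d : path (covers le) x (c ++ d) ->
  qc (x :: c ++ d) = qc (x :: c) ++ behead (qc (last x c :: d)).
Proof.
elim: c x => [|y c IH] x pc.
  by rewrite quot_chain1 /=; have [C [-> _ _]] := quot_chain_path pc.
have [xy pc'] := andP pc; have pxc : path (covers le) x (y :: c).
  by move: pc; rewrite cat_path => /andP[].
rewrite cat_cons quot_chain_cons // [in RHS]quot_chain_cons // IH //=.
by case: ifP.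
Qed.

Lemma quot_chain_const x c :
  path (covers le) x c -> th x (last x c) -> qc (x :: c) = [:: q x].
Proof.
elim: c x => [|y c IH] x //= pc h; have [xy pc'] := andP pc.
have hxy : th x y by apply: th_convex h; [exact: covers_le | exact: chain_le_last].
rewrite quot_chain_cons // hxy IH //; last by apply: th_trans h; rewrite th_sym.
by move: hxy; rewrite -quot_map_eq => /eqP->.
Qed.

Lemma quot_chain_two x c : path (covers le) x c ->
  (forall z, z \in x :: c -> th x z \/ th (last x c) z) ->
  qc (x :: c) = if th x (last x c) then [:: q x] else [:: q x; q (last x c)].
Proof.
move=> pc H; case: ifPn => [|nx]; first exact: quot_chain_const.
elim: c x pc H nx => [|y c IH] x pc H nx; first by rewrite th_refl in nx.
have [xy pc'] := andP pc; rewrite quot_chain_cons //; case: ifPn => hxy.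
  rewrite IH //.
  - by move: hxy; rewrite -quot_map_eq => /eqP->.
  - move=> z zc; case: (H z); [by rewrite inE zc orbT | | by right].
    by move=> h; left; apply: th_trans h; rewrite th_sym.
  - by apply: contra nx; exact: th_trans.
have hy : th y (last y c).
  case: (H y); rewrite ?inE ?eqxx ?orbT //; first by rewrite (negPf hxy).
  by rewrite th_sym.
rewrite quot_chain_const //.
by move: hy; rewrite -quot_map_eq => /eqP ->.
Qed.

(** Each class of [P] is lifted into the remaining interval below [y], and the gap is filled by an
    arbitrary chain. The filling adds no class, since its image is a chain between two elements of
    which one covers the other. *)
Lemma lift_chain x P y : le x y -> path (covers leQ) (q x) P ->
  last (q x) P = q y ->
  exists c, [/\ path (covers le) x c, last x c = y & qc (x :: c) = q x :: P].
Proof.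
elim: P x => [|Z P IH] x xy pP lP.
  have [c pc lc] := exists_chain le_order xy; exists c; split=> //.
  by apply: quot_chain_const => //; rewrite lc -quot_map_eq -lP.
have [xZ pZ] := andP pP.
have Zy : leQ Z (q y) by rewrite -lP; exact: (chain_le_last quot_le_order).
have [z [eZ xz zy]] := quot_interval xy (covers_le xZ) Zy; subst Z.
have [c1 p1 l1] := exists_chain le_order xz.
have [c2 [p2 l2 e2]] := IH z zy pZ lP.
have [C [eC pC lC]] := quot_chain_path p1; rewrite l1 in lC.
have e1 := chain_of_covers quot_le_order xZ pC lC.
exists (c1 ++ c2); split.
- by rewrite cat_path p1 l1.
- by rewrite last_cat l1.
- by rewrite quot_chain_cat ?cat_path ?p1 ?l1 // e2 eC e1.
Qed.

(** The greatest element of the class of [x]. Coverings above it always leave the class, and all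
    upper covers of the class lift to coverings of this one element; hence two upper covers in the
    quotient come from a polygon. *)
Definition up_class x := \big[jn/x]_(z <- enum T | th x z) z.

Lemma th_up x : th x (up_class x).
Proof.
rewrite /up_class; elim/big_ind: _ => //; first exact: th_refl.
by move=> y z xy xz; rewrite -{1}(jnl (lexx x)); exact: th_jn.
Qed.

Lemma le_up x z : th x z -> le z (up_class x).
Proof.
rewrite /up_class -big_filter => xz.
have : z \in [seq u <- enum T | th x u] by rewrite mem_filter xz mem_enum.
elim: [seq u <- _ | _] => // u s IH; rewrite inE big_cons => /predU1P[->//|/IH h].
exact: le_trans h (lejr _ _).
Qed.

Lemma quot_map_up x : q (up_class x) = q x.
Proof. by apply/eqP; rewrite quot_map_eq th_sym th_up. Qed.

Lemma up_covers x a : covers le (up_class x) a -> ~~ th (up_class x) a.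
Proof.
move=> h; apply/negP=> h'; move: (covers_neq h).
suff <- : up_class x = a by rewrite eqxx.
apply: le_anti; rewrite (covers_le h) /=; apply: le_up.
by apply: th_trans h'; exact: th_up.
Qed.

Lemma lift_covers x A : covers leQ (q x) A ->
  exists2 a, covers le (up_class x) a & q a = A.
Proof.
move=> xA; have [a0 eA] := quot_mapP A; set u := up_class x.
have ux : q u = q x := quot_map_up x.
have h : leQ (q u) (q a0) by rewrite ux -eA covers_le.
have pA : path (covers leQ) (q u) [:: A] by rewrite /= ux xA.
have lA : last (q u) [:: A] = q (jn u a0).
  by rewrite /= eA; apply/eqP; rewrite quot_map_eq -quot_leP.
have [[|a c] [pc lc]] := lift_chain (lejl _ _) pA lA; first by [].
have [ua pc'] := andP pc; have [C [e _ _]] := quot_chain_path pc'.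
rewrite quot_chain_cons // (negPf (up_covers ua)) e => -[].
by exists a.
Qed.

Section PolygonImage.
Variables (x y a b : T) (d1 d2 : seq T).
Hypothesis pol : polygon le x y (x :: a :: d1) (x :: b :: d2).

Let ends : [/\ covers le x a, covers le x b, a != y & b != y].
Proof.
case: pol => h1 h2 ne uq me; have s1 := polygon_size le_order pol.
have s2 := polygon_size le_order (polygon_sym pol).
have aux u d : interval_chain le x y [:: x, u & d] ->
    (2 < size [:: x, u & d])%N -> covers le x u /\ u != y.
  rewrite interval_chain_cons => /andP[/andP[xu pd] /eqP /= ld] sz; split=> //.
  apply/eqP=> uy; subst u; case: d pd ld sz => // v d pd ld _.
  move: (chain_uniq le_order (pd : path _ y (v :: d))).
  by rewrite cons_uniq => /andP[/negP[]]; rewrite -ld /= mem_last.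
by have [] := aux _ _ h1 s1; have [] := aux _ _ h2 s2.
Qed.

Let pol_mt u v : u \in x :: a :: d1 -> v \in x :: b :: d2 ->
  u != y -> v != y -> mt u v = x.
Proof. exact: (polygon_mt le_order bot_le up_poly pol). Qed.

Let ma : a \in x :: a :: d1. Proof. by rewrite !inE eqxx orbT. Qed.
Let mb : b \in x :: b :: d2. Proof. by rewrite !inE eqxx orbT. Qed.

Lemma polygon_is_join : y = jn a b.
Proof.
apply/esym; apply: (polygon_join le_order pol); exact: jnPx.
Qed.

(** Joining x ~ a with [b] gives b ~ y. Meeting this with an element u of the first side other than
    [y] gives x ~ u; on the second side everything from [b] upwards is congruent to [y] by
    convexity. So both sides have the same image. *)
Lemma polygon_collapse : th x a ->
  qc (x :: a :: d1) = (if th x y then [:: q x] else [:: q x; q y]) /\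
  qc (x :: b :: d2) = (if th x y then [:: q x] else [:: q x; q y]).
Proof.
have [xa xb ay by_] := ends; case: pol => h1 h2 _ _ _ hxa.
have hby : th b y.
  rewrite polygon_is_join -{1}(jnr (covers_le xb)).
  by apply: th_jn => //; exact: th_refl.
have /andP[p1 /eqP l1] : path (covers le) x (a :: d1) && (last x (a :: d1) == y).
  by rewrite -interval_chain_cons.
have /andP[p2 /eqP l2] : path (covers le) x (b :: d2) && (last x (b :: d2) == y).
  by rewrite -interval_chain_cons.
split.
- rewrite quot_chain_two // l1 // => u u1.
  case: (eqVneq u y) => [->|uy]; [right; exact: th_refl | left].
  have /andP[xu uy'] := interval_chain_mem le_order h1 u1.
  rewrite -(pol_mt u1 mb uy by_) -{2}(mtl uy').
  by apply: th_mt => //; exact: th_refl.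
- rewrite quot_chain_two // l2 // => u; rewrite inE => /predU1P[->|u2].
    by left; exact: th_refl.
  right; rewrite th_sym; have [_ p2'] := andP p2.
  have bu := chain_le_mem le_order p2' u2.
  have uy := chain_mem_last le_order p2' u2; rewrite (l2 : last b d2 = y) in uy.
  by rewrite th_sym; apply: th_trans (th_convex bu uy hby); rewrite th_sym.
Qed.

(** If u ~ v for inner elements of different sides, then u ~ u /\ v = x, so the images of the sides
    meet only at the ends. They are all the maximal chains of the image interval because a chain of
    the quotient lifts to a chain from [x] to [y]. *)
Lemma polygon_preserved : ~~ th x a -> ~~ th x b ->
  polygon leQ (q x) (q y) (qc (x :: a :: d1)) (qc (x :: b :: d2)).
Proof.
have [xa xb ay by_] := ends; case: (pol) => h1 h2 ne uq me nxa nxb.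
have img c : interval_chain le x y c -> interval_chain leQ (q x) (q y) (qc c).
  case/interval_chainP=> c' [-> pc <-].
  by have [C [-> pC lC]] := quot_chain_path pc; rewrite interval_chain_cons pC lC /=.
have cross u v : u \in x :: a :: d1 -> v \in x :: b :: d2 -> th u v ->
    th x u \/ th y u.
  move=> u1 v2 uv; case: (eqVneq u y) => [->|uy]; first by right; exact: th_refl.
  case: (eqVneq v y) => [vy|vy]; first by right; rewrite -vy th_sym.
  left; rewrite -(pol_mt u1 v2 uy vy) -[X in th _ X](mtl (lexx u)).
  by apply: th_mt; rewrite ?th_refl // th_sym.
split; [exact: img | exact: img | | |].
- move=> e; have : q a \in qc (x :: b :: d2) by rewrite -e mem_undup map_f.
  rewrite mem_undup => /mapP[v v2 /eqP]; rewrite quot_map_eq => av.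
  case: (cross _ _ ma v2 av) => [|ya]; first by apply/negP.
  case/negP: nxb; rewrite -(pol_mt ma mb ay by_).
  have /andP[_ bly] := interval_chain_mem le_order h2 mb.
  by rewrite -{2}(mtr bly); apply: th_mt; rewrite ?th_refl // th_sym.
- move=> C /interval_chainP[P [-> pP lP]].
  have xy := polygon_le le_order pol.
  have [c [pc lc <-]] := lift_chain xy pP lP.
  have /uq[->|->] : interval_chain le x y (x :: c).
    by rewrite interval_chain_cons pc lc /=.
  + by left.
  + by right.
- have memqc Z c : Z \in qc c -> exists2 z, z \in c & Z = q z.
    by move=> Zc; apply/mapP; rewrite -mem_undup.
  move=> Z /memqc[u u1 ->] /memqc[v v2 /eqP].
  rewrite quot_map_eq => /(cross _ _ u1 v2)[h|h]; [left | right].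
  + by apply/eqP; rewrite quot_map_eq th_sym.
  + by apply/eqP; rewrite quot_map_eq th_sym.
Qed.

End PolygonImage.

Lemma polygon_image x y c1 c2 : polygon le x y c1 c2 ->
  qc c1 = qc c2 \/ polygon leQ (q x) (q y) (qc c1) (qc c2).
Proof.
move=> pol; have [a [b [d1 [d2 [e1 e2 _ _ _]]]]] := polygon_shape le_order pol.
subst c1 c2; case: (boolP (th x a)) => ha.
  by left; have [-> ->] := polygon_collapse pol ha.
case: (boolP (th x b)) => hb.
  by left; have [-> ->] := polygon_collapse (polygon_sym pol) hb.
by right; exact: polygon_preserved.
Qed.

(** The contexts [A] and [B] do not depend on the segment [d]; therefore a replacement of segments
    maps to a replacement of segments. *)
Lemma quot_chain_replaces x y a b : exists A B, forall d,
  path (covers le) x d -> last x d = y -> sorted (covers le) (a ++ (x :: d) ++ b) ->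
  qc (a ++ (x :: d) ++ b) = A ++ qc (x :: d) ++ B.
Proof.
elim: a => [|u a [A [B H]]].
  exists [::], (behead (qc (y :: b))) => d pd ld /= s.
  by rewrite quot_chain_cat // ld.
set v := head x a; exists (if th u v then A else q u :: A), B => d pd ld s.
have e : exists r, a ++ (x :: d) ++ b = v :: r.
  by rewrite /v; case: (a) => [|w a'] /=; [exists (d ++ b) | exists (a' ++ x :: d ++ b)].
case: e => r e; have := H d pd ld; rewrite cat_cons e /= in s *.
rewrite quot_chain_cons // => ->; last by case/andP: s.
by case: ifP; rewrite ?catA.
Qed.

Lemma max_chain_quot_chain c : max_chain le c -> max_chain leQ (qc c).
Proof.
case=> u [v [ub vt /interval_chainP[c' [-> pc lc]]]]; exists (q u), (q v); split.
- by move=> Z; have [z ->] := quot_mapP Z; exact: quot_le_map.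
- by move=> Z; have [z ->] := quot_mapP Z; exact: quot_le_map.
- by have [C [-> pC lC]] := quot_chain_path pc; rewrite interval_chain_cons pC lC lc /=.
Qed.

(** Images are at most as long as the original chains, and a side of a polygon has at least three
    elements. *)
Lemma square_image x y c1 c2 : polygon le x y c1 c2 -> square le x y ->
  polygon leQ (q x) (q y) (qc c1) (qc c2) -> square leQ (q x) (q y).
Proof.
move=> pol /(squareP le_order pol)[s1 s2] polQ; apply/(squareP quot_le_order polQ).
have t1 := polygon_size quot_le_order polQ.
have t2 := polygon_size quot_le_order (polygon_sym polQ).
have l c : (size (qc c) <= size c)%N by rewrite (leq_trans (size_undup _)) ?size_map.
by have l1 := l c1; have l2 := l c2; lia.
Qed.

Lemma max_chain_sorted (U : finType) (r : rel U) c : max_chain r c -> sorted (covers r) c.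
Proof. by case=> u [v [_ _ /interval_chainP[c' [-> pc _]]]]. Qed.

Lemma replaces_quot_chain x y c1 c2 c c' : polygon le x y c1 c2 ->
  max_chain le c -> replaces c1 c2 c c' -> replaces (qc c1) (qc c2) (qc c) (qc c').
Proof.
case=> h1 h2 _ _ _ m r; have m' := replaces_max_chain h1 h2 r m.
case: r => a [b [e e']]; subst c c'.
case/interval_chainP: h1 m => d1 [-> p1 l1] /max_chain_sorted m.
case/interval_chainP: h2 m' => d2 [-> p2 l2] /max_chain_sorted m'.
have [A [B H]] := quot_chain_replaces x y a b; exists A, B.
by split; exact: H.
Qed.

Lemma square_equiv_quot_chain c c' : max_chain le c ->
  square_equiv le c c' -> square_equiv leQ (qc c) (qc c').
Proof.
move=> + h; elim: h => {c c'} [c c' [x [y [c1 [c2 [pol sq r]]]]] m|c m|c c' h IH m|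
  c d e h1 IH1 h2 IH2 m].
- have rQ := replaces_quot_chain pol m r.
  case: (polygon_image pol) => [e|polQ].
    case: rQ => A [B [-> ->]]; rewrite e; exact: rst_refl.
  apply: rst_step; exists (q x), (q y), (qc c1), (qc c2); split=> //.
  exact: square_image pol sq polQ.
- exact: rst_refl.
- by apply: rst_sym; apply: IH; apply/(square_equiv_max_chain h).
- apply: rst_trans (IH1 m) (IH2 _); exact/(square_equiv_max_chain h1).
Qed.

End Congruence.

(** * Quotient labellings and the induced map on classes of maximal chains *)

Section QuotientContraction.
Variables (T : finType) (le : rel T) (bot top : T).
Hypotheses (le_order : order_rel le) (bot_le : forall x, le bot x)
  (le_top : forall x, le x top) (up_poly : up_polygonal le).
Variable th : rel T.
Hypothesis th_cong : lattice_congruence le th.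
Variables (P : choiceType) (leP : rel P) (p0 : P) (lam : T -> T -> P).
Hypotheses (leP_trans : transitive leP) (leP_anti : antisymmetric leP).
Hypotheses (lam_polygonal : polygonal le leP lam)
  (lam_forcing : forcing_consistent le lam)
  (lam_complete : polygon_complete le leP lam).

Let le_anti : antisymmetric le. Proof. by case: le_order. Qed.

Local Notation jn := (jn le).
Local Notation mt := (mt le bot).
Local Notation q := (quot_map th).
Local Notation leQ := (quot_le le th).
Local Notation qc := (quot_chain th).
Local Notation lamQ := (quot_label le th p0 lam).

Let leQ_order : order_rel leQ := quot_le_order le_order bot_le up_poly th_cong.
Let thr := th_refl th_cong.
Let ths := th_sym th_cong.
Let tht := th_trans th_cong.

(* Both coverings are perspective to the one between the bottom of the upper
   class and its meet with the lower class. *)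
Lemma parallel_forcing_equiv x y x' y' : covers le x y -> covers le x' y' ->
  th x x' -> th y y' -> ~~ th x y -> forcing_equiv le x y x' y'.
Proof.
move=> xy xy' xx yy nxy.
have mtP := mtP le_order bot_le up_poly; have jnP := jnP le_order bot_le up_poly.
pose j := \big[mt/y]_(z <- enum T | th y z) z.
have yj : th y j.
  rewrite /j; elim/big_ind: _ => // u v yu yv.
  have := th_mt le_order bot_le up_poly th_cong yu yv.
  by rewrite (mt_idPl le_order bot_le up_poly) //; case: le_order.
have jle z : th y z -> le j z.
  rewrite /j -big_filter => yz.
  have : z \in [seq u <- enum T | th y u] by rewrite mem_filter yz mem_enum.
  elim: [seq u <- _ | _] => // u s IH; rewrite inE big_cons => /predU1P[->|/IH h].
  - by case: (mtP u (\big[mt/y]_(v <- s) v)).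
  - by case: le_order => _ _ tr; apply: tr h; case: (mtP u (\big[mt/y]_(v <- s) v)).
pose k := mt (up_class le th x) j.
have [kx kj _] := mtP (up_class le th x) j; rewrite -/k in kx kj.
have xup : th x (up_class le th x) by exact: th_up.
have ky : le k y by case: le_order => _ _ tr; apply: tr kj (jle _ (thr y)).
have xk : th x k.
  have h := th_mt le_order bot_le up_poly th_cong (etrans (ths _ _) xup) (etrans (ths _ _) yj).
  apply: (tht (y := mt x y)).
    by rewrite (mt_idPl le_order bot_le up_poly) ?thr // covers_le.
  by rewrite ths; exact: h.
have persp u v : covers le u v -> th x u -> th y v -> mt u j = k /\ jn u j = v.
  move=> uv xu yv; have nuv : ~~ th u v.
    by apply: contra nxy => h; apply: (tht xu); apply: (tht h); rewrite ths.
  have jv := jle _ yv.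
  have [ujl ujr ujm] := jnP u j; split.
  - apply: le_anti; have [m1 m2 m3] := mtP u j.
    have [_ _ m4] := mtP (up_class le th x) j; rewrite m4 //=; last first.
      by case: le_order => _ _ tr; apply: tr m1 _; exact: le_up.
    apply: m3 => //.
    have [l1 l2 l3] := jnP u k.
    have lv : le (jn u k) v.
      by apply: l3; [exact: covers_le | case: le_order => _ _ tr; apply: tr kj jv].
    case: (covers_between uv l1 lv) => [<-//|e].
    have uk : th u k by apply: tht xk; rewrite ths.
    have := th_jn le_order bot_le up_poly th_cong (thr u) uk.
    by rewrite e (jn_idPl le_order bot_le up_poly) ?(negPf nuv) //; case: le_order.
  - have lv : le (jn u j) v by apply: ujm; rewrite // covers_le.
    case: (covers_between uv ujl lv) => // e.
    have jv' : th j v by apply: tht yv; rewrite ths.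
    have := th_jn le_order bot_le up_poly th_cong (thr u) jv'.
    by rewrite e (jn_idPr le_order bot_le up_poly) ?(negPf nuv) // covers_le.
have [m1 j1] := persp x y xy (thr _) (thr _).
have [m2 j2] := persp x' y' xy' xx yy.
move=> th2 c2; have r2 := th_refl c2.
have J := th_jn le_order bot_le up_poly c2; have M := th_mt le_order bot_le up_poly c2.
(* Meeting with [j] carries a congruence of u and v to one of [k] and [j], and joining with u
   carries it back; this works for every congruence [th2]. *)
have aux u v : mt u j = k -> jn u j = v -> le j v -> th2 u v <-> th2 k j.
  move=> e1 e2 jv; split=> h.
  - have := M _ _ _ _ h (r2 j); rewrite e1 (mt_idPr le_order bot_le up_poly) //.
  - have ku : le k u by rewrite -e1; case: (mtP u j).
    have := J _ _ _ _ (r2 u) h.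
    by rewrite e2 (jn_idPl le_order bot_le up_poly).
by rewrite (aux x y) ?(aux x' y') //; exact: jle.
Qed.

(** Coverings between the same two classes are forcing-equivalent, so forcing-consistency makes the
    set of candidate labels a singleton. *)
Lemma quot_labelE x y : covers le x y -> ~~ th x y -> lamQ (q x) (q y) = lam x y.
Proof.
move=> xy nxy; rewrite /quot_label; apply: xget_subset1.
  by exists x, y; rewrite !mem_quot_map !thr.
have H l : (exists u v, [/\ u \in val (q x), v \in val (q y), covers le u v
   & l = lam u v]) -> l = lam x y.
  move=> [u [v []]]; rewrite !mem_quot_map => xu yv uv ->.
  by apply/esym/lam_forcing => //; exact: parallel_forcing_equiv.
by move=> l l' /H -> /H ->.
Qed.

Lemma label_lt_trans : transitive (label_lt leP).
Proof.
move=> b a c /andP[nab ab] /andP[nbc bc]; rewrite /label_lt (leP_trans ab bc) andbT.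
by apply: contra nab => /eqP eac; apply/eqP/leP_anti; rewrite ab eac bc.
Qed.

(** Contracted coverings lose their labels and the others keep them. As [label_lt] is transitive,
    ascending and descending chains keep their type in the quotient. *)
Lemma labels_quot_chain x c : path (covers le) x c ->
  subseq (labels lamQ (qc (x :: c))) (labels lam (x :: c)).
Proof.
elim: c x => // y c IH x pc; have [xy pc'] := andP pc.
rewrite (quot_chain_cons le_order bot_le up_poly th_cong pc).
have IHy := IH y pc'; case: ifPn => nxy.
  exact: subseq_trans IHy (subseq_cons _ _).
have [C [e _ _]] := quot_chain_path le_order bot_le up_poly th_cong pc'.
by move: IHy; rewrite e /= quot_labelE // eqxx.
Qed.

Lemma ascending_quot_chain x y c :
  interval_chain le x y c -> ascending leP lam c -> ascending leP lamQ (qc c).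
Proof.
case/interval_chainP=> d [-> pd _]; apply: subseq_sorted; first exact: label_lt_trans.
exact: labels_quot_chain.
Qed.

Lemma descending_quot_chain x y c :
  interval_chain le x y c -> descending leP lam c -> descending leP lamQ (qc c).
Proof.
case/interval_chainP=> d [-> pd _]; apply: subseq_sorted.
  by move=> b a c' h1 h2; exact: label_lt_trans h2 h1.
exact: labels_quot_chain.
Qed.

Lemma ascending_not_descending (U : finType) (l : U -> U -> P) (c : seq U) :
  (2 < size c)%N -> ascending leP l c -> ~ descending leP l c.
Proof.
case: c => [|x [|y [|z c]]] //= _ /andP[/andP[nab ab] _] /andP[/andP[_ ba] _].
by case/negP: nab; apply/eqP/leP_anti; rewrite ab.
Qed.

Let fibre_move c c' := [/\ max_chain le c, max_chain le c', qc c = qc c'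
  & square_move le c c' \/ increasing_move le leP lam c c'].
Let zigzag := clos_refl_sym_trans (seq T) fibre_move.

Let max_chain_tail s x c : max_chain le (s ++ x :: c) ->
  path (covers le) x c /\ last x c = top.
Proof.
case=> u [v [_ vt h]]; have -> : top = v by apply: le_anti; rewrite vt le_top.
case: s h => [|w s] /=; first by case/and3P=> _ -> /eqP.
by rewrite cat_path last_cat /= => /and3P[_ /and3P[_ _ ->] /eqP].
Qed.

Let max_chain_change s x c c' : max_chain le (s ++ x :: c) ->
  path (covers le) x c' -> last x c' = top -> max_chain le (s ++ x :: c').
Proof.
move=> m pc' lc'; have [pc lc] := max_chain_tail m.
apply: (@replaces_max_chain _ _ x top (x :: c) (x :: c') _ _ _ _ _ m).
- by rewrite interval_chain_cons pc lc eqxx.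
- by rewrite interval_chain_cons pc' lc' eqxx.
- by exists s, [::]; rewrite !cats0.
Qed.

Let quot_chain_change s x c c' : max_chain le (s ++ x :: c) ->
  max_chain le (s ++ x :: c') ->
  qc (x :: c) = qc (x :: c') -> qc (s ++ x :: c) = qc (s ++ x :: c').
Proof.
move=> m m' e; have [pc lc] := max_chain_tail m; have [pc' lc'] := max_chain_tail m'.
have [A [B H]] := quot_chain_replaces le_order bot_le up_poly th_cong x top s [::].
have := H _ pc lc; rewrite cats0 => ->; last exact: max_chain_sorted m.
by have := H _ pc' lc'; rewrite cats0 => ->; [rewrite e|exact: max_chain_sorted m'].
Qed.

Lemma polygon_step x y c1 c2 s t : polygon le x y c1 c2 ->
  [\/ square_move le (s ++ c1 ++ t) (s ++ c2 ++ t),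
      increasing_move le leP lam (s ++ c1 ++ t) (s ++ c2 ++ t)
    | increasing_move le leP lam (s ++ c2 ++ t) (s ++ c1 ++ t)].
Proof.
move=> pol; case: (boolP (square le x y)) => sq.
  by constructor 1; exists x, y, c1, c2; split=> //; exists s, t.
case: (lam_polygonal pol sq) => -[asc desc].
- by constructor 2; exists x, y, c1, c2; split=> //; exists s, t.
- constructor 3; exists x, y, c2, c1; split=> //; last by exists s, t.
  exact: polygon_sym pol.
Qed.

(** Induction from the top. If the chains part at [a] and [b], equality of images makes one of these
    congruent to [x], so the polygon spanned by them collapses. Both chains are then compared, by
    induction above [a] and above [b], with chains that run along the two sides of this polygon and
    continue identically; one polygon move joins the latter. *)
Lemma fibre_zigzag s x c c' : max_chain le (s ++ x :: c) ->
  max_chain le (s ++ x :: c') -> qc (x :: c) = qc (x :: c') ->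
  zigzag (s ++ x :: c) (s ++ x :: c').
Proof.
elim/(le_up_ind le_order): x s c c' => x IH s c c' m m' e.
have [pc lc] := max_chain_tail m; have [pc' lc'] := max_chain_tail m'.
have nil_top d : path (covers le) top d -> d = [::].
  case: d => // u d /andP[tu _]; move: (covers_neq tu).
  suff -> : top = u by rewrite eqxx.
  by apply: le_anti; rewrite le_top (covers_le tu).
have qcC := quot_chain_cons le_order bot_le up_poly th_cong.
have qcp := quot_chain_path le_order bot_le up_poly th_cong.
have qcat := quot_chain_cat le_order bot_le up_poly th_cong.
case: c => [|a c] in m e pc lc *.
  have e1 : c' = [::] by apply: nil_top; rewrite -lc.
  by rewrite e1; exact: rst_refl.
case: c' => [|b c'] in m' e pc' lc' *.
  by have := nil_top (a :: c); rewrite -lc' => /(_ pc).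
have [xa pa] := andP pc; have [xb pb] := andP pc'.
have cancel u d d' : path (covers le) x (u :: d) -> path (covers le) x (u :: d') ->
    qc [:: x, u & d] = qc [:: x, u & d'] -> qc (u :: d) = qc (u :: d').
  by move=> p p'; rewrite !qcC //; case: ifP => // _ [].
have IHs u d d' : covers le x u -> path (covers le) x (u :: d) ->
    path (covers le) x (u :: d') -> last u d = top -> last u d' = top ->
    qc [:: x, u & d] = qc [:: x, u & d'] -> 
    zigzag (s ++ [:: x, u & d]) (s ++ [:: x, u & d']).
  move=> xu p p' l l' eq; rewrite -!(cat_rcons x).
  apply: (IH u (covers_le xu) (covers_neq xu)); rewrite ?cat_rcons.
  - exact: max_chain_change m p l.
  - exact: max_chain_change m p' l'.
  - exact: cancel p p' eq.
case: (eqVneq a b) => [eab|nab]; first by subst b; exact: IHs.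
have [d1 [d2 pol]] := up_polygon le_order bot_le up_poly xa xb nab.
set y := jn a b in pol; have [h1 h2 _ _ _] := pol.
have /andP[p1 /eqP l1] : path (covers le) x (a :: d1) && (last x (a :: d1) == y).
  by rewrite -interval_chain_cons.
have /andP[p2 /eqP l2] : path (covers le) x (b :: d2) && (last x (b :: d2) == y).
  by rewrite -interval_chain_cons.
have ey : y = jn a b by [].
(* Otherwise both images leave the class of [x] at once, into the same class, so a ~ b. Since a /\ b
   = x, meeting with [b] gives x ~ b. *)
have some : th x a || th x b.
  apply: contraT; rewrite negb_or => /andP[nxa nxb].
  move: e; rewrite !qcC // (negPf nxa) (negPf nxb) => -[].
  have [C [-> _ _]] := qcp _ _ pa; have [C' [-> _ _]] := qcp _ _ pb.
  move/(congr1 (head (q x))) => /eqP; rewrite /= (quot_map_eq th_cong) => hab.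
  case/negP: nxa.
  have [m1 m2 m3] := mtP le_order bot_le up_poly a b.
  have := th_mt le_order bot_le up_poly th_cong hab (thr b).
  rewrite (mt_idPl le_order bot_le up_poly (_ : le b b)); last by case: le_order.
  have xm : le x (mt a b) by apply: m3; exact: covers_le.
  case: (covers_between xa xm m1) => em.
    by rewrite em => h; apply: (tht h); rewrite ths.
  by move=> _; case/eqP: nab; apply: (covers_le_eq xa xb); rewrite -em.
have [q1 q2] : qc [:: x, a & d1] = (if th x y then [:: q x] else [:: q x; q y]) /\
               qc [:: x, b & d2] = (if th x y then [:: q x] else [:: q x; q y]).
  case/orP: some => h; first exact: (polygon_collapse le_order bot_le up_poly th_cong pol).
  have [] := polygon_collapse le_order bot_le up_poly th_cong (polygon_sym pol) h.
  by split.
have [C [eC pC lC]] := qcp _ _ pc; rewrite lc in lC.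
have lift g : path (covers (quot_le le th)) (q y) g -> last (q y) g = q top ->
    exists g', [/\ path (covers le) y g', last y g' = top & qc (y :: g') = q y :: g].
  exact: (lift_chain le_order bot_le up_poly th_cong).
(* Both sides map to the class of [x], followed by that of [y] if different. The common continuation
   [g] lifts, starting from [y], what remains of the given quotient chain. *)
have [g [pg lg eg]] : exists g, [/\ path (covers le) y g, last y g = top
    & qc ([:: x, a & d1 ++ g]) = qc [:: x, a & c]].
  have tail g : path (covers le) y g ->
      qc [:: x, a & d1 ++ g] = qc [:: x, a & d1] ++ behead (qc (y :: g)).
    move=> pg; have := @qcat x (a :: d1) g; rewrite cat_path p1 l1 pg.
    by move=> /(_ isT).
  case: (boolP (th x y)) q1 => hxy q1.
    have exy : q y = q x by apply/eqP; rewrite (quot_map_eq th_cong) ths.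
    rewrite -exy in pC lC; have [g [pg lg eg]] := lift C pC lC.
    exists g; split; [exact: pg | exact: lg |]; rewrite (tail g pg) q1 eg eC; reflexivity.
  have [C' eC'] : exists C', C = q y :: C'.
    (* Whichever of [a] and [b] is not congruent to [x] is congruent to [y], so the given quotient
       chain does continue with the class of [y]. *)
    have aux u d : covers le x u -> path (covers le) u d -> ~~ th x u -> th u y ->
        qc [:: x, u & d] = q x :: C -> exists C', C = q y :: C'.
      move=> xu pd nxu uy; rewrite qcC ?(negPf nxu); last by rewrite /= xu.
      have [C' [-> _ _]] := qcp _ _ pd => -[<-]; exists C'; congr (_ :: _).
      by apply/eqP; rewrite (quot_map_eq th_cong).
    have J := th_jn le_order bot_le up_poly th_cong.
    case: (boolP (th x a)) some => ha /= hb.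
      have hby : th b y.
        have := J _ _ _ _ ha (thr b).
        by rewrite (jn_idPr le_order bot_le up_poly) // covers_le.
      have nxb : ~~ th x b by apply: contra hxy => h; exact: tht h hby.
      by apply: (aux b c' xb pb nxb hby); rewrite -e; exact: eC.
    have hay : th a y.
      have := J _ _ _ _ (thr a) hb.
      by rewrite (jn_idPl le_order bot_le up_poly) // covers_le.
    exact: (aux a c xa pa ha hay eC).
  move: pC lC; rewrite eC' /= => /andP[_ pC'] lC'.
  have [g [pg lg eg]] := lift C' pC' lC'.
  exists g; split; [exact: pg | exact: lg |]; rewrite (tail g pg) q1 eg eC eC'; reflexivity.
have pga : path (covers le) x (a :: d1 ++ g).
  by rewrite -cat_cons cat_path p1 l1.
have pgb : path (covers le) x (b :: d2 ++ g).
  by rewrite -cat_cons cat_path p2 l2.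
have lga : last a (d1 ++ g) = top by rewrite last_cat (l1 : last a d1 = y).
have lgb : last b (d2 ++ g) = top by rewrite last_cat (l2 : last b d2 = y).
have egb : qc [:: x, b & d2 ++ g] = qc [:: x, a & d1 ++ g].
  have := @qcat x (b :: d2) g; rewrite cat_path p2 l2 pg => /(_ isT) /= ->.
  have := @qcat x (a :: d1) g; rewrite cat_path p1 l1 pg => /(_ isT) /= ->.
  by rewrite q1 q2.
have z1 : zigzag (s ++ [:: x, a & c]) (s ++ [:: x, a & d1 ++ g]).
  exact: (IHs _ _ _ xa pc pga lc lga (esym eg)).
have z2 : zigzag (s ++ [:: x, b & d2 ++ g]) (s ++ [:: x, b & c']).
  exact: (IHs _ _ _ xb pgb pc' lgb lc' (etrans egb (etrans eg e))).
apply: rst_trans z1 _; apply: rst_trans z2.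
have ma : max_chain le (s ++ [:: x, a & d1 ++ g]) by exact: (max_chain_change m pga lga).
have mb : max_chain le (s ++ [:: x, b & d2 ++ g]) by exact: (max_chain_change m pgb lgb).
have eq : qc (s ++ [:: x, a & d1 ++ g]) = qc (s ++ [:: x, b & d2 ++ g]).
  exact: (quot_chain_change ma mb (esym egb)).
case: (polygon_step s g pol) => mv.
- by apply: rst_step; split; [exact: ma | exact: mb | exact: eq | left].
- by apply: rst_step; split; [exact: ma | exact: mb | exact: eq | right].
- apply: rst_sym; apply: rst_step.
  by split; [exact: mb | exact: ma | exact: esym eq | right].
Qed.

Let quot_bot_min U : (forall Z, leQ U Z) -> U = q bot.
Proof.
move=> Umin; case: leQ_order => _ an _; apply: an.
by rewrite Umin (quot_le_bot le_order bot_le up_poly th_cong).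
Qed.

Let quot_top_max V : (forall Z, leQ Z V) -> V = q top.
Proof.
move=> Vmax; case: leQ_order => _ an _; apply: an; rewrite Vmax andbT.
have [v ->] := quot_mapP V.
exact: (quot_le_map le_order bot_le up_poly th_cong (le_top v)).
Qed.

Lemma lift_max_chain C : max_chain leQ C -> exists2 c, max_chain le c & qc c = C.
Proof.
case=> U [V [/quot_bot_min eU /quot_top_max eV /interval_chainP[D [-> pD lD]]]].
subst U V; have [c [pc lc <-]] :=
  lift_chain le_order bot_le up_poly th_cong (bot_le top) pD lD.
exists (bot :: c) => //; exists bot, top; split; [exact: bot_le | exact: le_top |].
by rewrite interval_chain_cons pc lc eqxx.
Qed.

(** The two atoms lift to coverings of the top of the class of [X], and the polygon they span is
    preserved because neither covering is contracted. Its sides must map to [C1] and [C2], being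
    determined by their atoms. Lifts of the rest of [C] below and above complete it. *)
Lemma lift_polygon X Y C1 C2 C C' : polygon leQ X Y C1 C2 -> max_chain leQ C ->
  replaces C1 C2 C C' ->
  exists x y c1 c2 s t, [/\ polygon le x y c1 c2, qc c1 = C1, qc c2 = C2
    & [/\ max_chain le (s ++ c1 ++ t), max_chain le (s ++ c2 ++ t),
          qc (s ++ c1 ++ t) = C & qc (s ++ c2 ++ t) = C']].
Proof.
move=> polQ mC rep; have [hQ1 hQ2 neQ uqQ meQ] := polQ.
have [A [B [D1 [D2 [e1 e2 nAB XA XB]]]]] := polygon_shape leQ_order polQ.
have [x0 eX] := quot_mapP X; rewrite eX in XA XB.
have [a xa ea] := lift_covers le_order bot_le up_poly th_cong XA.
have [b xb eb] := lift_covers le_order bot_le up_poly th_cong XB.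
set x := up_class le th x0 in xa xb.
have ex : q x = X by rewrite eX; apply: (quot_map_up le_order bot_le up_poly th_cong).
have nab : a != b by apply: contra nAB => /eqP eab; rewrite -ea -eb eab.
have [d1 [d2 pol]] := up_polygon le_order bot_le up_poly xa xb nab.
set y := jn a b in pol; have [h1 h2 _ _ _] := pol.
have nxa : ~~ th x a by exact: (up_covers le_order bot_le up_poly th_cong xa).
have nxb : ~~ th x b by exact: (up_covers le_order bot_le up_poly th_cong xb).
have polI := polygon_preserved le_order bot_le up_poly th_cong pol nxa nxb.
have qcC := quot_chain_cons le_order bot_le up_poly th_cong.
have qcp := quot_chain_path le_order bot_le up_poly th_cong.
have qcat := quot_chain_cat le_order bot_le up_poly th_cong.
have /andP[p1 /eqP l1] : path (covers le) x (a :: d1) && (last x (a :: d1) == y).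
  by rewrite -interval_chain_cons.
have /andP[p2 /eqP l2] : path (covers le) x (b :: d2) && (last x (b :: d2) == y).
  by rewrite -interval_chain_cons.
have [_ pa1] := andP p1; have [_ pb2] := andP p2.
have [E1 [eE1 _ _]] := qcp _ _ pa1; have [E2 [eE2 _ _]] := qcp _ _ pb2.
have q1 : qc [:: x, a & d1] = [:: X, A & E1] by rewrite qcC // (negPf nxa) eE1 ex ea.
have q2 : qc [:: x, b & d2] = [:: X, B & E2] by rewrite qcC // (negPf nxb) eE2 ex eb.
rewrite q1 q2 ex in polI.
have ey : q y = Y.
  apply: (polygon_join leQ_order (d1 := D1) (d2 := D2) (x := X) (a := A) (b := B)).
    by rewrite -e1 -e2.
  rewrite -ea -eb; exact: (quot_is_join le_order bot_le up_poly th_cong).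
have [g1 g2 _ _ _] := polI; rewrite ey in g1 g2.
have {}q1 : qc [:: x, a & d1] = C1.
  rewrite q1; case: (uqQ _ g1) => //; rewrite e2 => -[/eqP].
  by rewrite (negPf nAB).
have {}q2 : qc [:: x, b & d2] = C2.
  rewrite q2; case: (uqQ _ g2) => //; rewrite e1 => -[/eqP].
  by rewrite eq_sym (negPf nAB).
case: rep => Pr [Po [eC eC']].
have mC' : max_chain leQ C'.
  by apply: replaces_max_chain hQ1 hQ2 _ mC; exists Pr, Po.
have [U [V [/quot_bot_min eU /quot_top_max eV hC]]] := mC.
have [E [eE pE lE]] := interval_chainP hQ1; rewrite eC eE in hC.
have [s [ps ls es]] : exists s, [/\ path (covers le) bot s,
    last bot s = x & qc (bot :: s) = rcons Pr X].
  have [pr [epr ppr lpr]] : exists pr, [/\ rcons Pr X = q bot :: pr,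
      path (covers leQ) (q bot) pr & last (q bot) pr = q x].
    case: (Pr) hC => [|Z pr].
      case/and3P=> /eqP eXU _ _; exists [::].
      by split; [rewrite /= eXU eU | | rewrite ex eXU eU].
    case/and3P=> /eqP->; rewrite eU cat_path => /andP[pZ /= /andP[lZ _]] _.
    exists (rcons pr X); split; first by [].
      by rewrite rcons_path pZ lZ.
    by rewrite last_rcons ex.
  have [s [ps ls es]] := lift_chain le_order bot_le up_poly th_cong (bot_le x) ppr lpr.
  by exists s; split; [exact: ps | exact: ls | rewrite es epr].
have [t [pt lt et]] : exists t, [/\ path (covers le) y t, last y t = top
    & qc (y :: t) = Y :: Po].
  have [pPo lPo] : path (covers leQ) Y Po /\ last Y Po = q top.
    rewrite -eV -lE; case: (Pr) hC => [|Z pr] /and3P[_].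
      by rewrite cat_path last_cat => /andP[_ ->] /eqP->.
    rewrite cat_path last_cat /= cat_path last_cat.
    by case/and4P=> _ _ _ -> /eqP->.
  rewrite -ey in pPo lPo.
  have [t [pt lt et]] := lift_chain le_order bot_le up_poly th_cong (le_top y) pPo lPo.
  by exists t; split; [exact: pt | exact: lt | rewrite et ey].
(* [belast] drops the last element of the lower lift, which is the bottom [x] of the polygon. *)
have full u d D : path (covers le) x (u :: d) -> last x (u :: d) = y ->
    qc [:: x, u & d] = X :: D ->
    max_chain le (belast bot s ++ [:: x, u & d] ++ t) /\
    qc (belast bot s ++ [:: x, u & d] ++ t) = Pr ++ (X :: D) ++ Po.
  move=> pd ld ed.
  have -> : belast bot s ++ [:: x, u & d] ++ t = bot :: s ++ (u :: d) ++ t.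
    by rewrite -(cat_cons bot s) (lastI bot s) ls cat_rcons.
  have pdt : path (covers le) x ((u :: d) ++ t) by rewrite cat_path pd ld pt.
  have p3 : path (covers le) bot (s ++ (u :: d) ++ t) by rewrite cat_path ps ls pdt.
  split.
    exists bot, top; split; [exact: bot_le | exact: le_top |].
    by rewrite interval_chain_cons p3 !last_cat ls ld lt eqxx.
  rewrite (qcat bot s _ p3) ls es (qcat x (u :: d) t pdt) ld et ed.
  by rewrite /= cat_rcons.
have {}q1 : qc [:: x, a & d1] = X :: A :: D1 by rewrite q1.
have {}q2 : qc [:: x, b & d2] = X :: B :: D2 by rewrite q2.
have [m1 f1] := full _ _ _ p1 l1 q1; have [m2 f2] := full _ _ _ p2 l2 q2.
exists x, y, [:: x, a & d1], [:: x, b & d2], (belast bot s), t; split.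
- exact: pol.
- by rewrite q1 e1.
- by rewrite q2 e2.
- by split; [exact: m1 | exact: m2 | rewrite f1 eC e1 | rewrite f2 eC' e2].
Qed.

(** Defined through a chosen representative; [quot_MCE] shows that every representative gives the
    same class. *)
Definition quot_MC (X : MC le) : MC leQ :=
  mc_class (max_chain_quot_chain le_order bot_le up_poly th_cong
    (MC_max_chain (svalP (cid (MC_inhabited X))))).

Lemma quot_MCE X c : sval X c -> sval (quot_MC X) (qc c).
Proof.
move=> Xc; rewrite /quot_MC; set d := cid _.
apply: MC_closed (mc_classE _) _.
apply: (square_equiv_quot_chain le_order bot_le up_poly th_cong).
  exact: MC_max_chain (svalP d).
exact: MC_square_equiv (svalP d) Xc.
Qed.

Local Notation MCle := (MC_le leP lam).
Local Notation MCleQ := (MC_le leP lamQ).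

(** The image of a non-square polygon may degenerate, be a square, or stay non-square; in the first
    two cases the classes become equal. *)
Lemma quot_MC_move X X' : MC_move leP lam X X' -> MCleQ (quot_MC X) (quot_MC X').
Proof.
case=> c [c' [Xc Xc' [x [y [c1 [c2 [pol nsq asc rep]]]]]]].
have Qc := quot_MCE Xc; have Qc' := quot_MCE Xc'.
have rQ := replaces_quot_chain le_order bot_le up_poly th_cong pol (MC_max_chain Xc) rep.
have same : qc c = qc c' -> MCleQ (quot_MC X) (quot_MC X').
  by move=> e; rewrite e in Qc; rewrite (MC_inj Qc Qc'); exact: rt_refl.
case: (polygon_image le_order bot_le up_poly th_cong pol) => [e|polQ].
  by apply: same; case: rQ => A [B [-> ->]]; rewrite e.
case: (boolP (square leQ (q x) (q y))) => sqQ.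
  have sm : square_move leQ (qc c) (qc c') by exists (q x), (q y), (qc c1), (qc c2).
  have Qc2 := MC_closed Qc (rst_step _ _ _ _ sm).
  by rewrite (MC_inj Qc2 Qc'); exact: rt_refl.
apply: rt_step; exists (qc c), (qc c'); split; [exact: Qc | exact: Qc' |].
exists (q x), (q y), (qc c1), (qc c2); split=> //.
by have [h1 _ _ _ _] := pol; exact: ascending_quot_chain h1 asc.
Qed.

Lemma quot_MC_le X X' : MCle X X' -> MCleQ (quot_MC X) (quot_MC X').
Proof.
elim=> {X X'} [X X'|X|X Y Z _ h1 _ h2]; [exact: quot_MC_move | exact: rt_refl |].
exact: rt_trans h1 h2.
Qed.

Lemma quot_MC_surj Y : exists X, quot_MC X = Y.
Proof.
have [C YC] := MC_inhabited Y; have [c mc ec] := lift_max_chain (MC_max_chain YC).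
exists (mc_class mc); apply: MC_inj YC; rewrite -ec.
exact: quot_MCE (mc_classE mc).
Qed.

Lemma lift_MC_move Y Y' : MC_move leP lamQ Y Y' ->
  exists X X', [/\ quot_MC X = Y, quot_MC X' = Y' & MC_move leP lam X X'].
Proof.
case=> C [C' [YC YC' [U [V [C1 [C2 [polQ nsqQ ascQ rep]]]]]]].
have [x [y [c1 [c2 [s [t [pol e1 e2 [m m' e e']]]]]]]] :=
  lift_polygon polQ (MC_max_chain YC) rep.
have [h1 h2 _ _ _] := pol.
have nsq : ~~ square le x y.
  apply: contra nsqQ => sq.
  have [exy1 exy2] : q x = U /\ q y = V.
    have [g1 _ _ _ _] := polQ; rewrite -e1 in g1.
    have [d [ed pd ld]] := interval_chainP h1; subst c1.
    have [D [eD _ lD]] := quot_chain_path le_order bot_le up_poly th_cong pd.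
    rewrite eD in g1; move: g1 => /and3P[/eqP exU _ /eqP exV].
    by split; [exact: exU | rewrite -exV lD ld].
  rewrite -exy1 -exy2 -e1 -e2 in polQ *.
  exact: (square_image le_order bot_le up_poly th_cong pol).
exists (mc_class m), (mc_class m'); split.
- by apply: MC_inj YC; rewrite -e; exact: quot_MCE (mc_classE m).
- by apply: MC_inj YC'; rewrite -e'; exact: quot_MCE (mc_classE m').
exists (s ++ c1 ++ t), (s ++ c2 ++ t); split; [exact: mc_classE | exact: mc_classE |].
exists x, y, c1, c2; split; [exact: pol | exact: nsq | | by exists s, t].
(* With the opposite orientation, the image of [c1] would be ascending and descending at once, which
   two labels already exclude. *)
case: (lam_polygonal pol nsq) => -[asc desc] //.
case: (ascending_not_descending _ ascQ); first exact: (polygon_size leQ_order polQ).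
by rewrite -e1; exact: descending_quot_chain h1 desc.
Qed.

Section Fibres.
Variable Y : MC leQ.
Let A : set (MC le) := quot_MC @^-1` [set Y' | pre_equiv MCleQ Y Y']%classic.
Let conn := clos_refl_sym_trans (MC le) (fun X X' => [/\ A X, A X' & MCle X X']).

Let zigzag_invariant c c' : zigzag c c' ->
  qc c = qc c' /\ (max_chain le c <-> max_chain le c').
Proof.
elim=> {c c'} [c c' [m m' e _]|c|c c' _ [e i]|c d c' _ [e i] _ [e' i']].
- by split.
- by split.
- by split; [rewrite e | split=> /i].
- by split; [rewrite e e' | split=> [/i/i'|/i'/i]].
Qed.

Let same_fibre X X' c c' : sval X c -> sval X' c' -> qc c = qc c' -> A X -> A X'.
Proof.
move=> Xc X'c' e; suff -> : A X' = A X by [].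
have := quot_MCE Xc; rewrite e => h.
by rewrite /A /preimage /mkset (MC_inj h (quot_MCE X'c')).
Qed.

Let conn_zigzag c c' : zigzag c c' -> forall X X', sval X c -> sval X' c' ->
  A X -> conn X X'.
Proof.
elim=> {c c'} [c c' [m m' e mv] X X' Xc X'c' AX|c X X' Xc Xc' AX|
    c c' h IH X X' Xc Xc' AX|c d c' h1 IH1 h2 IH2 X X' Xc X'c' AX].
- case: mv => mv.
    by rewrite (MC_inj (MC_closed Xc (rst_step _ _ _ _ mv)) X'c'); exact: rst_refl.
  apply: rst_step; split; [exact: AX | exact: same_fibre Xc X'c' e AX |].
  by apply: rt_step; exists c, c'.
- by rewrite (MC_inj Xc Xc'); exact: rst_refl.
- have [e _] := zigzag_invariant h; apply: rst_sym; apply: (IH _ _ Xc' Xc).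
  exact: same_fibre Xc Xc' (esym e) AX.
- have [e [md _]] := zigzag_invariant h1.
  have Dd := mc_classE (md (MC_max_chain Xc)).
  apply: rst_trans (IH1 _ _ Xc Dd AX) _.
  exact: IH2 Dd X'c' (same_fibre Xc Dd e AX).
Qed.

Let conn_fibre X X' c c' : sval X c -> sval X' c' -> qc c = qc c' -> A X ->
  conn X X'.
Proof.
move=> Xc X'c' e; have m := MC_max_chain Xc; have m' := MC_max_chain X'c'.
have shape d : max_chain le d -> exists d', d = bot :: d'.
  case=> u [v [umin _ /interval_chainP[d' [-> _ _]]]]; exists d'.
  by congr (_ :: _); apply: le_anti; rewrite umin bot_le.
have [d ed] := shape _ m; have [d' ed'] := shape _ m'; subst c c'.
have z := @fibre_zigzag [::] bot d d' m m' e.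
exact: (conn_zigzag z Xc X'c').
Qed.

(** A square of the quotient may lift to a non-square polygon. Equal quotient classes therefore need
    not have equal lifts, but the move across the lifted polygon stays in the fibre, and
    [conn_fibre] joins its ends to the given chains. *)
Let conn_square D D' : square_equiv leQ D D' -> max_chain leQ D ->
  forall X X' c c', sval X c -> sval X' c' -> qc c = D -> qc c' = D' -> A X ->
  conn X X'.
Proof.
elim=> {D D'} [D D' [U [V [C1 [C2 [polQ sqQ rep]]]]]|D|D D' h IH|D E D' h1 IH1 h2 IH2]
  mD X X' c c' Xc X'c' e e' AX.
- have [x [y [c1 [c2 [s [t [pol _ _ [m m' f f']]]]]]]] := lift_polygon polQ mD rep.
  have a1 : A (mc_class m) by apply: same_fibre Xc (mc_classE m) _ AX; rewrite f e.
  have k1 : conn X (mc_class m).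
    by apply: conn_fibre Xc (mc_classE m) _ AX; rewrite f e.
  have mvQ : square_move leQ D D' by exists U, V, C1, C2.
  have eqQ : quot_MC (mc_class m') = quot_MC (mc_class m).
    have h := quot_MCE (mc_classE m); rewrite f in h.
    apply: MC_inj (quot_MCE (mc_classE m')) _; rewrite f'.
    exact: MC_closed h (rst_step _ _ _ _ mvQ).
  have a2 : A (mc_class m') by rewrite /A /preimage /mkset eqQ; exact: a1.
  have k2 : conn (mc_class m') X'.
    by apply: conn_fibre (mc_classE m') X'c' _ a2; rewrite f' e'.
  apply: rst_trans k1 _; apply: rst_trans k2.
  have M := mc_classE m; have M' := mc_classE m'.
  case: (polygon_step s t pol) => mv.
  + by rewrite (MC_inj (MC_closed M (rst_step _ _ _ _ mv)) M'); exact: rst_refl.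
  + apply: rst_step; split; [exact: a1 | exact: a2 | apply: rt_step].
    by exists (s ++ c1 ++ t), (s ++ c2 ++ t).
  + apply: rst_sym; apply: rst_step; split; [exact: a2 | exact: a1 | apply: rt_step].
    by exists (s ++ c2 ++ t), (s ++ c1 ++ t).
- by apply: conn_fibre Xc X'c' _ AX; rewrite e e'.
- have mD0 : max_chain leQ D by apply/(square_equiv_max_chain h).
  apply: rst_sym; apply: (IH mD0 _ _ _ _ X'c' Xc e' e).
  have eqQ : quot_MC X' = quot_MC X.
    have h1 := quot_MCE X'c'; rewrite e' in h1.
    by apply: MC_inj (MC_closed h1 h) _; rewrite -e; exact: quot_MCE.
  by rewrite /A /preimage /mkset eqQ; exact: AX.
- have mE : max_chain leQ E by apply/(square_equiv_max_chain h1).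
  have [d md ed] := lift_max_chain mE; have Md := mc_classE md.
  apply: rst_trans (IH1 mD _ _ _ _ Xc Md e ed AX) _.
  apply: (IH2 mE _ _ _ _ Md X'c' ed e').
  have eqQ : quot_MC (mc_class md) = quot_MC X.
    have h3 := quot_MCE Xc; rewrite e in h3.
    by apply: MC_inj _ (MC_closed h3 h1); rewrite -ed; exact: quot_MCE.
  by rewrite /A /preimage /mkset eqQ; exact: AX.
Qed.

Let conn_eq X X' : quot_MC X = quot_MC X' -> A X -> conn X X'.
Proof.
move=> e AX; have [c Xc] := MC_inhabited X; have [c' X'c'] := MC_inhabited X'.
have h := quot_MCE Xc; have h' := quot_MCE X'c'; rewrite -e in h'.
exact: (conn_square (MC_square_equiv h h') (MC_max_chain h) Xc X'c' erefl erefl).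
Qed.

(** The quotient preorder need not be known to be antisymmetric here, so a fibre lies over a whole
    equivalence class. Every class on a path of moves between two of its members is equivalent to
    them, and each move lifts. *)
Let conn_le Y1 Y2 : MCleQ Y1 Y2 -> MCleQ Y Y1 -> MCleQ Y2 Y ->
  forall X1 X2, quot_MC X1 = Y1 -> quot_MC X2 = Y2 -> conn X1 X2.
Proof.
elim=> {Y1 Y2} [Y1 Y2 mv l1 l2 X1 X2 e1 e2|Y1 l1 l2 X1 X2 e1 e2|
    Y1 Y3 Y2 h1 IH1 h2 IH2 l1 l2 X1 X2 e1 e2].
- have s12 : MCleQ Y1 Y2 by exact: rt_step.
  have inA X : quot_MC X = Y1 \/ quot_MC X = Y2 -> A X.
    by case=> e; rewrite /A /preimage /= e; split=> //; [exact: rt_trans l2 | exact: rt_trans s12].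
  have [X1' [X2' [f1 f2 mv']]] := lift_MC_move mv.
  have a1 := inA X1 (or_introl e1); have a1' := inA X1' (or_introl f1).
  have a2' := inA X2' (or_intror f2).
  apply: rst_trans (conn_eq _ a1) _; first by rewrite e1 -f1.
  apply: rst_trans (conn_eq (etrans f2 (esym e2)) a2').
  by apply: rst_step; split; [exact: a1' | exact: a2' | exact: rt_step].
- by apply: conn_eq; rewrite ?e1 ?e2 // /A /preimage /= e1; split.
- have [X3 e3] := quot_MC_surj Y3.
  apply: rst_trans (IH1 l1 _ _ _ e1 e3) (IH2 _ l2 _ _ e3 e2).
  + exact: rt_trans h2 l2.
  + exact: rt_trans l1 h1.
Qed.

Lemma quot_MC_fibre_connected : pre_connected MCle A.
Proof.
move=> X X' [l1 l2] [l3 l4].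
by apply: (@conn_le (quot_MC X) (quot_MC X')) => //; exact: rt_trans l2 l3.
Qed.

End Fibres.

(** Some move on a path from [Y] to [Y'] leaves the equivalence class of [Y]; nothing lies strictly
    between, so it ends in the class of [Y']. This move lifts, and polygon-completeness makes its
    lift a covering. *)
Lemma quot_MC_covers Y Y' : pre_covers MCleQ Y Y' -> exists X X',
  [/\ pre_covers MCle X X', pre_equiv MCleQ Y (quot_MC X)
    & pre_equiv MCleQ Y' (quot_MC X')].
Proof.
case=> -[yy' ny'y] nb.
suff [Y1 [Y2 [mv eq1 eq2]]] : exists Y1 Y2, [/\ MC_move leP lamQ Y1 Y2,
    pre_equiv MCleQ Y Y1 & pre_equiv MCleQ Y' Y2].
  have [X [X' [f1 f2 mv']]] := lift_MC_move mv.
  by exists X, X'; rewrite f1 f2; split=> //; exact: lam_complete.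
suff key Z : clos_refl_trans_1n _ (MC_move leP lamQ) Z Y' -> pre_equiv MCleQ Y Z ->
    exists Y1 Y2, [/\ MC_move leP lamQ Y1 Y2, pre_equiv MCleQ Y Y1
                     & pre_equiv MCleQ Y' Y2].
  by apply: (key Y (clos_rt_rt1n _ _ _ _ yy')); split; exact: rt_refl.
move=> h; elim: h ny'y nb {yy'} => {Z Y'} [Z|Z1 Z2 Z3 mv h IH] n31 nb [l1 l2].
  by case: n31.
have s12 : MCleQ Z1 Z2 by exact: rt_step.
have s23 : MCleQ Z2 Z3 by exact: clos_rt1n_rt.
case: (pselect (MCleQ Z2 Y)) => h2.
  by apply: IH => //; split=> //; exact: rt_trans l1 s12.
case: (pselect (MCleQ Z3 Z2)) => h3; first by exists Z1, Z2.
by case: (nb Z2); split; split=> //; exact: rt_trans l1 s12.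
Qed.

Theorem quot_MC_contraction : contraction MCle MCleQ quot_MC.
Proof.
split; [exact: quot_MC_surj | exact: quot_MC_le | exact: quot_MC_fibre_connected |].
exact: quot_MC_covers.
Qed.

End QuotientContraction.

(** * Congruences generated by a set of edges closed under polygon forcing *)

Section EdgeCongruence.
Variables (T : finType) (le : rel T) (bot : T) (E : rel T) (dual : T -> T).
Hypotheses (le_order : order_rel le) (bot_le : forall x, le bot x)
  (up_poly : up_polygonal le).
Hypothesis E_covers : forall x y, E x y -> covers le x y.
Hypothesis E_closed : forall x y a b d1 d2,
  polygon le x y (x :: a :: d1) (x :: b :: d2) -> E x a -> path E b d2.
Hypotheses (dualK : involutive dual)
  (dual_le : forall x y, le (dual x) (dual y) = le y x)
  (dual_E : forall x y, E x y -> E (dual y) (dual x)).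

Let le_anti : antisymmetric le. Proof. by case: le_order. Qed.
Let le_trans : transitive le. Proof. by case: le_order. Qed.

Local Notation jn := (jn le).
Let lejl x y : le x (jn x y) := le_jnl le_order bot_le up_poly x y.
Let lejr x y : le y (jn x y) := le_jnr le_order bot_le up_poly x y.
Let jnle x y z : le x z -> le y z -> le (jn x y) z :=
  @jn_le _ _ _ le_order bot_le up_poly x y z.
Let jnl x y : le y x -> jn x y = x := @jn_idPl _ _ _ le_order bot_le up_poly x y.

Definition edge_cong : rel T := connect (fun x y => E x y || E y x).

Let cong_sym x y : edge_cong x y = edge_cong y x.
Proof. by apply: sym_connect_sym => u v; rewrite orbC. Qed.

(** Induction from the top. With an atom [b] of the interval from [x] to [y], the polygon of [x']
    and [b] turns the edge at [x] into a walk of edges from [b] to x' \/ b. Each of these starts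
    strictly above [x], so the induction hypothesis joins them with [y] one after the other. *)
Let cong_step x x' y : E x x' -> le x y -> edge_cong y (jn y x').
Proof.
elim/(le_up_ind le_order): x x' y => x IH x' y xx' xy.
have cxx' := E_covers xx'.
case: (eqVneq x y) => [<-|nxy].
  have -> : jn x x' = x'.
    by apply: le_anti; rewrite lejr jnle ?(covers_le cxx') //; case: le_order.
  by apply: connect1; rewrite xx'.
have [b xb b_y] := exists_atom le_order xy nxy.
case: (eqVneq x' b) => [->|nx'b]; first by rewrite jnl //; exact: connect0.
have [d1 [d2 pol]] := up_polygon le_order bot_le up_poly cxx' xb nx'b.
have pE := E_closed pol xx'.
have lE : last b d2 = jn x' b by have [_ /and3P[_ _ /eqP]] := pol.
have walk d u z : le x u -> x != u -> path E u d -> le u z ->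
    edge_cong z (jn z (last u d)).
  elim: d u z => [|v d IHd] u z xu nxu /=; first by move=> _ uz; rewrite jnl //; exact: connect0.
  case/andP=> uv pd uz; apply: connect_trans (IH u xu nxu v z uv uz) _.
  have cuv := covers_le (E_covers uv).
  have -> : jn z (last v d) = jn (jn z v) (last v d).
    have vl : le v (last v d).
      by apply: chain_le_last => //; apply: sub_path pd => ? ?; exact: E_covers.
    apply: le_anti; apply/andP; split; apply: jnle => //.
    + exact: le_trans (lejl _ _) (lejl _ _).
    + by apply: jnle => //; exact: le_trans vl (lejr _ _).
  apply: IHd => //; first exact: le_trans xu cuv.
  apply/eqP=> xv; subst v; move/eqP: nxu; apply; apply: le_anti.
  by rewrite xu cuv.
have := walk d2 b y (covers_le xb) (covers_neq xb) pE b_y; rewrite lE.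
suff -> : jn y (jn x' b) = jn y x' by [].
apply: le_anti; apply/andP; split; apply: jnle => //.
- by apply: jnle => //; exact: le_trans b_y (lejl _ _).
- exact: le_trans (lejl x' b) (lejr _ _).
Qed.

Let cong_jn x x' y : edge_cong x x' -> edge_cong (jn x y) (jn x' y).
Proof.
have step u v : E u v -> edge_cong (jn u y) (jn v y).
  move=> uv; have := cong_step uv (lejl u y).
  suff -> : jn (jn u y) v = jn v y by [].
  have cuv := covers_le (E_covers uv).
  apply: le_anti; apply/andP; split; apply: jnle => //.
  - apply: jnle => //; exact: le_trans cuv (lejl _ _).
  - exact: le_trans (lejr u y) (lejl _ _).
case/connectP=> p; elim: p x => [|z p IH] x /= pp e; first by rewrite e; exact: connect0.
case/andP: pp => /orP[xz|zx] pp.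
- exact: connect_trans (step _ _ xz) (IH z pp e).
- by apply: connect_trans (IH z pp e); rewrite -/edge_cong cong_sym; exact: step.
Qed.

Let cong_dual x y : edge_cong x y -> edge_cong (dual x) (dual y).
Proof.
case/connectP=> p; elim: p x => [|z p IH] x /= pp e; first by rewrite e; exact: connect0.
case/andP: pp => xz pp; apply: connect_trans (IH z pp e).
by apply: connect1; case/orP: xz => /dual_E->; rewrite ?orbT.
Qed.

Let cong_join x x' y y' j j' : edge_cong x x' -> edge_cong y y' ->
  is_join le x y j -> is_join le x' y' j' -> edge_cong j j'.
Proof.
move=> xx' yy' /(is_join_eq le_order bot_le up_poly)->.
move=> /(is_join_eq le_order bot_le up_poly)->.
apply: connect_trans (cong_jn y xx') _.
rewrite (jnC le_order bot_le up_poly x') (jnC le_order bot_le up_poly x').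
exact: cong_jn.
Qed.

Let dual_meet x y m : is_meet le x y m -> is_join le (dual x) (dual y) (dual m).
Proof.
case=> mx my mm; split; rewrite ?dual_le // => z.
by rewrite -(dualK z) !dual_le; exact: mm.
Qed.

(** Compatibility with meets is that with joins, transported by the order-reversing involution,
    which preserves the edge set. *)
Lemma edge_cong_lattice : lattice_congruence le edge_cong.
Proof.
split.
- move=> x y z; split=> [|xy]; first exact: connect0.
  apply/idP/idP; apply: connect_trans => //.
  by rewrite -/edge_cong cong_sym.
- exact: cong_join.
- move=> x x' y y' m m' /cong_dual h1 /cong_dual h2 /dual_meet h3 /dual_meet h4.
  by have := cong_dual (cong_join h1 h2 h3 h4); rewrite !dualK.
Qed.

Lemma edge_cong_invariant (X : Type) (f : T -> X) x y :
  (forall u v, E u v -> f u = f v) -> edge_cong x y -> f x = f y.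
Proof.
move=> fE /connectP[p]; elim: p x => [|z p IH] x /=; first by move=> _ ->.
case/andP=> xz pp e; rewrite -(IH z pp e).
by case/orP: xz => /fE.
Qed.

End EdgeCongruence.

(** * The weak order of a finite Coxeter group *)

Import Order.TTheory GRing.Theory Num.Theory.
Local Open Scope ring_scope.

(** * Counting, positions and sorting in sequences *)

Lemma count_flip (X : eqType) (P Q : pred X) (r : seq X) (p0 : X) :
  uniq r -> p0 \in r -> ~~ P p0 -> Q p0 ->
  {in r, forall p, p != p0 -> P p = Q p} -> count Q r = (count P r).+1.
Proof.
move=> ur hr nP hQ H; rewrite !(seq.permP (perm_to_rem hr)) /= hQ (negPf nP) add0n add1n.
congr _.+1; apply/esym; apply: eq_in_count => p; rewrite mem_rem_uniq // inE.
by case/andP=> np /H; exact.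
Qed.

(** Rearranging a segment can change the relative position of two entries only if both belong to the
    segment. *)
Lemma index_segment (X : eqType) (L M M' N : seq X) b c :
  perm_eq M M' -> ~~ ((b \in M) && (c \in M)) ->
  (index b (L ++ M' ++ N) < index c (L ++ M' ++ N))%N =
  (index b (L ++ M ++ N) < index c (L ++ M ++ N))%N.
Proof.
move=> pM nbc; have sM := perm_size pM; have mM := perm_mem pM.
rewrite !index_cat -!mM -sM.
have ib v : v \in M -> (index v M < size M)%N /\ (index v M' < size M)%N.
  by move=> hv; rewrite index_mem hv sM index_mem -mM hv.
have il v : v \in L -> (index v L < size L)%N by rewrite index_mem.
case: (boolP (b \in L)) => bL; case: (boolP (c \in L)) => cL //;
case: (boolP (b \in M)) nbc => bM; case: (boolP (c \in M)) => cM //= _.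
all: try (have [? ?] := ib _ bM); try (have [? ?] := ib _ cM).
all: try (have ? := il _ bL); try (have ? := il _ cL).
all: by apply/idP/idP; lia.
Qed.

Lemma path_iota_map (X : Type) (e : rel X) (f : nat -> X) k d :
  (forall l, (k <= l < k + d)%N -> e (f l) (f l.+1)) ->
  path e (f k) [seq f l | l <- iota k.+1 d].
Proof.
elim: d k => //= d IH k He; apply/andP; split.
  by apply: He; rewrite leqnn addnS ltnS leq_addr.
by apply: IH => l /andP[kl ld]; apply: He; rewrite (ltnW kl) addnS -addSn.
Qed.

(** A termination measure for sorting by adjacent exchanges: it is bounded, and putting a descending
    neighbouring pair in order raises it. *)
Fixpoint weighted_sum (k : nat) (l : seq nat) : nat :=
  if l is x :: l' then (k * x + weighted_sum k.+1 l')%N else 0%N.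

Lemma weighted_sum_swap k l1 x y l2 : (y < x)%N ->
  (weighted_sum k (l1 ++ [:: x, y & l2]) < weighted_sum k (l1 ++ [:: y, x & l2]))%N.
Proof.
elim: l1 k => [|z l1 IH] k yx /=; last by rewrite ltn_add2l; exact: IH.
by move: (weighted_sum _ _) => t; nia.
Qed.

Lemma weighted_sum_le N k l : all (fun x => x <= N)%N l ->
  (weighted_sum k l <= (k + size l) * N * size l)%N.
Proof.
elim: l k => [|x l IH] k //= /andP[xN lN].
have := IH k.+1 lN; rewrite addSn -addnS => h.
have h1 : (k * x <= (k + (size l).+1) * N)%N by apply: leq_mul => //; exact: leq_addr.
by rewrite mulnS; apply: leq_add.
Qed.

Lemma unsorted_split (l : seq nat) : ~~ sorted ltn l ->
  exists l1 x y l2, l = l1 ++ [:: x, y & l2] /\ (y <= x)%N.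
Proof.
case: l => // x l; elim: l x => // y l IH x /=; rewrite negb_and -leqNgt.
case/orP=> [yx|/IH[l1 [x' [y' [l2 [-> h]]]]]]; first by exists [::], x, y, l.
by exists (x :: l1), x', y', l2.
Qed.

Section FiniteCoxeterGroups.
Variables (R : realType) (gT : finGroupType) (n : nat) (s : 'I_n -> gT).
Variables (A : 'M[R]_n) (delta : 'I_n -> R).
Variable rho : mx_representation R [set: gT]%SET n.
Hypotheses (hW : coxeter_system s) (hA : cartan_matrix s A)
  (hdelta : symmetriser s A delta) (hrho : reflection_representation s A rho).

Local Notation a_ := (simple_root R).
Local Notation m_ := (coxeter_m s).
Local Notation K := (bil_form A delta).
Local Notation wp := (word_prod s).
Implicit Types (w x y g : gT) (i j : 'I_n).

(** * The action on vectors, words and lengths *)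

Definition act (w : gT) (v : 'cV[R]_n) := rho w *m v.

Lemma act1 v : act 1%g v = v.
Proof. by rewrite /act repr_mx1 mul1mx. Qed.

Lemma actM x y v : act (x * y)%g v = act x (act y v).
Proof. by rewrite /act repr_mxM ?finset.in_setT // mulmxA. Qed.

Lemma actK w v : act w^-1%g (act w v) = v.
Proof. by rewrite -actM mulVg act1. Qed.

Lemma actKV w v : act w (act w^-1%g v) = v.
Proof. by rewrite -actM mulgV act1. Qed.

Lemma actD w u v : act w (u + v) = act w u + act w v.
Proof. exact: mulmxDr. Qed.

Lemma actN w v : act w (- v) = - act w v.
Proof. exact: mulmxN. Qed.

Lemma actZ w c v : act w (c *: v) = c *: act w v.
Proof. by rewrite /act -scalemxAr. Qed.

Lemma act0 w : act w 0 = 0.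
Proof. exact: mulmx0. Qed.

Lemma act_inj w : injective (act w).
Proof. exact: can_inj (actK w). Qed.

Lemma s_inj : injective s. Proof. by case: hW. Qed.

Lemma ss1 i : (s i * s i = 1)%g.
Proof. by case: hW => _ /(_ i) o _ _; rewrite -[LHS]/(s i ^+ 2)%g -o expg_order. Qed.

Lemma sV i : (s i)^-1%g = s i.
Proof. by apply: (mulgI (s i)); rewrite mulgV ss1. Qed.

Lemma sK i w : (w * s i * s i)%g = w.
Proof. by rewrite -mulgA ss1 mulg1. Qed.

Lemma wp_cat u v : wp (u ++ v) = (wp u * wp v)%g.
Proof. by rewrite /word_prod big_cat. Qed.

Lemma wp_cons i u : wp (i :: u) = (s i * wp u)%g.
Proof. by rewrite /word_prod big_cons. Qed.

Lemma wp_nil : wp [::] = 1%g.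
Proof. by rewrite /word_prod big_nil. Qed.

Lemma wp_rcons u i : wp (rcons u i) = (wp u * s i)%g.
Proof. by rewrite -cats1 wp_cat wp_cons wp_nil mulg1. Qed.

Lemma wp_exists w : exists u, wp u = w.
Proof.
case: hW => _ _ gen _.
have : w \in <<[set s i | i : 'I_n]%SET>>%g by rewrite gen finset.in_setT.
case/gen_prodgP=> k [c cP ->]; elim: k c cP => [|k IH] c cP.
  by exists [::]; rewrite wp_nil big_ord0.
have /imsetP[i _ ei] := cP ord_max.
have [u eu] := IH (fun j : 'I_k => c (widen_ord (leqnSn k) j)) (fun j : 'I_k => cP _).
by exists (rcons u i); rewrite wp_rcons eu big_ord_recr /= ei.
Qed.

Lemma word_ind (P : gT -> Prop) :
  P 1%g -> (forall i w, P w -> P (s i * w)%g) -> forall w, P w.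
Proof.
move=> P1 PS w; have [u <-] := wp_exists w; elim: u => [|i u IH].
  by rewrite wp_nil.
by rewrite wp_cons; exact: PS.
Qed.

Lemma wp_length_exists w :
  exists k, [exists t : k.-tuple 'I_n, wp t == w].
Proof.
have [u eu] := wp_exists w; exists (size u); apply/existsP; exists (in_tuple u).
by rewrite /= eu.
Qed.

Definition len w := ex_minn (wp_length_exists w).

Lemma len_min u : (len (wp u) <= size u)%N.
Proof.
rewrite /len; case: ex_minnP => k _; apply; apply/existsP.
by exists (in_tuple u); rewrite eqxx.
Qed.

Lemma len_word w : exists2 u, wp u = w & size u = len w.
Proof.
rewrite /len; case: ex_minnP => k /existsP[t /eqP e] _.
by exists t; rewrite // size_tuple.
Qed.

Lemma reduced_wordP w u : reduced_word s w u <-> wp u = w /\ size u = len w.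
Proof.
split=> [[e umin]|[<- e]]; split=> //.
  apply/eqP; rewrite eqn_leq -{2}e len_min andbT.
  by have [v ev <-] := len_word w; exact: umin.
by move=> v ev; rewrite e -ev; exact: len_min.
Qed.

Lemma lenM x y : (len (x * y)%g <= len x + len y)%N.
Proof.
have [u <- <-] := len_word x; have [v <- <-] := len_word y.
by rewrite -wp_cat -size_cat; exact: len_min.
Qed.

Lemma len1 : len 1%g = 0%N.
Proof. by apply/eqP; rewrite -leqn0 -wp_nil; exact: len_min. Qed.

Lemma lens_le i : (len (s i) <= 1)%N.
Proof. by have := len_min [:: i]; rewrite wp_cons wp_nil mulg1. Qed.

(** The presentation of the group enters here: sending every generator to a transposition respects
    the relations and gives the sign character. *)
Lemma len_parity : exists sg : gT -> bool,
  (forall i, sg (s i)) /\ (forall x y, sg (x * y)%g = sg x (+) sg y).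
Proof.
case: hW => _ _ _ /(_ {perm bool} (fun _ => tperm true false)) [i j|phi phis].
  by rewrite tperm2 expg1n.
exists (fun w => odd_perm (phi w)); split=> [i|x y].
  by rewrite phis odd_tperm.
by rewrite gmulfM odd_permM.
Qed.

Lemma len_sS_neq w i : len (w * s i)%g != len w.
Proof.
have [sg [sgs sgM]] := len_parity.
have sg1 : sg 1%g = false by have := sgM 1%g 1%g; rewrite mulg1 addbb.
have sgl x : sg x = odd (len x).
  have [u <- <-] := len_word x; elim: u => [|j u IH]; first by rewrite wp_nil sg1.
  by rewrite wp_cons sgM sgs IH.
apply/eqP=> e; have := sgl (w * s i)%g; rewrite e -sgl sgM sgs addbT.
by case: (sg w).
Qed.

Lemma len_sS w i : len (w * s i)%g = (len w).+1 \/ (len (w * s i)%g).+1 = len w.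
Proof.
have := len_sS_neq w i; have := lenM w (s i); have := lenM (w * s i)%g (s i).
have := lens_le i; rewrite sK => h1 h2 h3 /eqP h4.
have [|] := leqP (len w) (len (w * s i)%g) => h5; [left | right]; lia.
Qed.

Lemma lenV w : len w^-1%g = len w.
Proof.
have half x : (len x^-1%g <= len x)%N.
  have [u <- <-] := len_word x; elim: u => [|i u IH]; first by rewrite wp_nil invg1 len1.
  rewrite wp_cons invMg sV; apply: leq_trans (lenM _ _) _.
  by rewrite -[size _]/(size u).+1 -addn1; exact: leq_add IH (lens_le i).
by apply/eqP; rewrite eqn_leq half -{1}(invgK w) half.
Qed.

Lemma len_last w : w != 1%g -> exists i, (len (w * s i)%g).+1 = len w.
Proof.
have [u <- e] := len_word w; case/lastP: u e => [|u i] e; first by rewrite wp_nil eqxx.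
move=> _; exists i; case: (len_sS (wp (rcons u i)) i) => //.
have := len_min u; rewrite -e size_rcons wp_rcons sK => h1 h2.
by rewrite h2 in h1; lia.
Qed.

(* The word s_i s_j s_i ... with k letters; [alt_letter i j k] is the letter
   that continues it. *)
Fixpoint palt (i j : 'I_n) (k : nat) : gT :=
  if k is k'.+1 then (s i * palt j i k')%g else 1%g.

Definition alt_letter (i j : 'I_n) (k : nat) := if odd k then j else i.

Lemma palt_add i j k l :
  palt i j (k + l) = (palt i j k * palt (alt_letter i j k) (alt_letter j i k) l)%g.
Proof.
elim: k i j => [|k IH] i j; first by rewrite add0n mul1g.
rewrite addSn /= IH mulgA; congr (_ * _)%g.
by rewrite /alt_letter /=; case: (odd k).
Qed.

Lemma paltSr i j k : palt i j k.+1 = (palt i j k * s (alt_letter i j k))%g.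
Proof. by rewrite -addn1 palt_add /= mulg1. Qed.

Lemma paltV i j k : (palt i j k)^-1%g = palt (alt_letter j i k) (alt_letter i j k) k.
Proof.
elim: k => [|k IH]; first by rewrite invg1.
rewrite paltSr invMg sV IH /= /alt_letter /=.
by case: (odd k).
Qed.

Lemma palt_double i j k : palt i j k.*2 = ((s i * s j) ^+ k)%g.
Proof. by elim: k => [|k IH] //; rewrite doubleS /= IH expgS mulgA. Qed.

Lemma m_sym i j : m_ i j = m_ j i.
Proof. by rewrite /coxeter_m -orderV invMg !sV. Qed.

(** The braid relation: the quotient of the two sides is the alternating word of length 2m, that is
    (s_i s_j)^m. *)
Lemma palt_m i j : palt i j (m_ i j) = palt j i (m_ i j).
Proof.
apply/eqP; rewrite eq_mulgV1 paltV -palt_add addnn palt_double.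
by rewrite expg_order.
Qed.

Lemma palt_len i j k : (len (palt i j k) <= k)%N.
Proof.
elim: k i j => [|k IH] i j; first by rewrite len1.
by apply: leq_trans (lenM _ _) _; rewrite -add1n; exact: leq_add (lens_le i) (IH j i).
Qed.

Lemma m_gt0 i j : (0 < m_ i j)%N. Proof. exact: order_gt0. Qed.

Lemma m_gt1 i j : i != j -> (1 < m_ i j)%N.
Proof.
move=> nij; rewrite ltn_neqAle m_gt0 andbT eq_sym order_eq1.
apply: contra nij => /eqP h; apply/eqP/s_inj.
by rewrite -[LHS]mulg1 -(ss1 j) mulgA h mul1g.
Qed.

(** * The Cartan matrix and the invariant form *)

Lemma delta_gt0 i : 0 < delta i. Proof. by case: hdelta. Qed.

Lemma delta_symm i j : delta i * A i j = delta j * A j i.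
Proof. by case: hdelta. Qed.

Lemma col_decomp (v : 'cV[R]_n) : v = \sum_j v j 0 *: a_ j.
Proof.
apply/matrixP=> k l; rewrite summxE ord1 (bigD1 k) //= big1 => [|j nj].
  by rewrite !mxE !eqxx mulr1 addr0.
by rewrite !mxE eq_sym (negPf nj) mulr0.
Qed.

Lemma simpleE i k : (a_ i) k 0 = (k == i)%:R.
Proof. by rewrite mxE eqxx andbT. Qed.

Lemma act_sum w (I : finType) (F : I -> 'cV[R]_n) :
  act w (\sum_k F k) = \sum_k act w (F k).
Proof. exact: mulmx_sumr. Qed.

Lemma act_s i v : act (s i) v = v - (A *m v) i 0 *: a_ i.
Proof.
rewrite {1}(col_decomp v) act_sum.
under eq_bigr do rewrite actZ /act hrho scalerBr scalerA.
rewrite big_split /= -col_decomp sumrN -scaler_suml; congr (_ - _ *: _).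
by rewrite mxE; apply: eq_bigr => j _; rewrite mulrC.
Qed.

Lemma act_s_simple i j : act (s i) (a_ j) = a_ j - A i j *: a_ i.
Proof. exact: hrho. Qed.

Lemma act_s_self i : act (s i) (a_ i) = - a_ i.
Proof.
rewrite act_s_simple; case: hA => -> _ _ _; rewrite scaler_nat mulr2n opprD addrA.
by rewrite subrr sub0r.
Qed.

Lemma act_s_coord i v k : k != i -> (act (s i) v) k 0 = v k 0.
Proof. by move=> nk; rewrite act_s !mxE (negPf nk) mulr0 subr0. Qed.

Lemma KE u v : K u v = \sum_i delta i * u i 0 * (A *m v) i 0.
Proof.
rewrite /bil_form -mulmxA mxE; apply: eq_bigr => i _; rewrite !mxE.
rewrite mulr_sumr mulr_sumr; apply: eq_bigr => j _; rewrite !mxE; ring.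
Qed.

Lemma KC u v : K u v = K v u.
Proof.
rewrite !KE; under eq_bigr do rewrite mxE mulr_sumr.
rewrite exchange_big /=; apply: eq_bigr => j _; rewrite mxE mulr_sumr.
apply: eq_bigr => i _; have := delta_symm i j => e.
by rewrite -[LHS]/(delta i * u i 0 * (A i j * v j 0)) mulrACA e; ring.
Qed.

Lemma KDr u v v' : K u (v + v') = K u v + K u v'.
Proof. by rewrite /bil_form mulmxDr mxE. Qed.

Lemma KZr u c v : K u (c *: v) = c * K u v.
Proof. by rewrite /bil_form -scalemxAr mxE. Qed.

Lemma KNr u v : K u (- v) = - K u v.
Proof. by rewrite -scaleN1r KZr mulN1r. Qed.

Lemma KDl u u' v : K (u + u') v = K u v + K u' v.
Proof. by rewrite KC KDr !(KC v). Qed.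

Lemma KZl u c v : K (c *: u) v = c * K u v.
Proof. by rewrite KC KZr KC. Qed.

Lemma KNl u v : K (- u) v = - K u v.
Proof. by rewrite KC KNr KC. Qed.

Lemma K_simple i v : K (a_ i) v = delta i * (A *m v) i 0.
Proof.
rewrite KE (bigD1 i) //= big1 => [|j nj]; first by rewrite simpleE eqxx mulr1 addr0.
by rewrite simpleE (negPf nj) mulr0 mul0r.
Qed.

Lemma K_simple2 i j : K (a_ i) (a_ j) = delta i * A i j.
Proof.
rewrite K_simple mxE (bigD1 j) //= big1 => [|k nk]; first by rewrite simpleE eqxx mulr1 addr0.
by rewrite simpleE (negPf nk) mulr0.
Qed.

Lemma A_ii i : A i i = 2. Proof. by case: hA. Qed.

Lemma act_s_K i v : act (s i) v = v - (K (a_ i) v / delta i) *: a_ i.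
Proof. by rewrite act_s K_simple mulrC mulKf // gt_eqF ?delta_gt0. Qed.

Lemma K_act w u v : K (act w u) (act w v) = K u v.
Proof.
elim/word_ind: w u v => [|i w IH] u v; first by rewrite !act1.
rewrite !actM -[RHS]IH; set u' := act w u; set v' := act w v.
rewrite !act_s_K !(KDl, KDr, KNl, KNr, KZl, KZr) K_simple2 A_ii (KC u' (a_ i)).
have := delta_gt0 i; move: (delta i) => d d0; field; lra.
Qed.

Lemma A_neq_le0 i j : i != j -> A i j <= 0.
Proof. by case: hA => _ H _ _; exact: H. Qed.

(** * Rescaled simple roots and quotients of sines *)

Definition inv_norm i : R := (Num.sqrt (delta i))^-1.

(* On the rescaled simple roots, s_i acts by the cosine of pi / m(i, j), whatever
   the Cartan matrix. *)
Definition e_ i : 'cV[R]_n := inv_norm i *: a_ i.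

Definition cosm i j : R := cos (pi / (m_ i j)%:R).

Lemma inv_norm_gt0 i : 0 < inv_norm i.
Proof. by rewrite invr_gt0 sqrtr_gt0 delta_gt0. Qed.

Lemma inv_norm2 i : inv_norm i ^+ 2 * delta i = 1.
Proof.
have d0 := delta_gt0 i.
by rewrite exprVn sqr_sqrtr ?ltW // mulVf // gt_eqF.
Qed.

Lemma angle_le i j : i != j -> pi / (m_ i j)%:R <= pi / 2 :> R.
Proof.
move=> nij; have m1 := m_gt1 nij; rewrite ler_pM2l ?pi_gt0 // lef_pV2 ?posrE //.
- by rewrite ler_nat.
- by rewrite ltr0n; lia.
Qed.

Lemma angle_gt0 i j : 0 < pi / (m_ i j)%:R :> R.
Proof. by rewrite divr_gt0 ?pi_gt0 // ltr0n m_gt0. Qed.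

Lemma cosm_ge0 i j : i != j -> 0 <= cosm i j.
Proof.
move=> nij; apply: cos_ge0_pihalf; rewrite angle_le // andbT.
by have := angle_gt0 i j; have := @pi_gt0 R; lra.
Qed.

Lemma sin_angle_gt0 i j : i != j -> 0 < sin (pi / (m_ i j)%:R) :> R.
Proof.
move=> nij; apply: sin_gt0_pi; rewrite angle_gt0 /=.
by have := angle_le nij; have := @pi_gt0 R; lra.
Qed.

Lemma act_e i j : i != j -> act (s i) (e_ j) = e_ j + (2 * cosm i j) *: e_ i.
Proof.
move=> nij; rewrite actZ act_s_simple scalerBr /e_; congr (_ + _).
rewrite !scalerA -scaleNr; congr (_ *: _).
have Aij := A_neq_le0 nij; have c0 := cosm_ge0 nij.
have ni := inv_norm_gt0 i; have nj := inv_norm_gt0 j.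
have eA : A i j * A j i = 4 * cosm i j ^+ 2 by case: hA => _ _ ->.
(* Both coefficients are non-negative, so it suffices to compare squares, which are determined by
   the product of the two Cartan entries and the symmetriser. *)
have sq : (- (inv_norm j * A i j)) ^+ 2 = (2 * cosm i j * inv_norm i) ^+ 2.
  rewrite sqrrN !exprMn -[2 ^+ 2]/(2 * 2 : R).
  have e1 := inv_norm2 i; have e2 := inv_norm2 j; have e3 := delta_symm i j.
  have -> : A i j ^+ 2 = 4 * cosm i j ^+ 2 * inv_norm i ^+ 2 * delta j.
    rewrite -eA; transitivity (A i j ^+ 2 * (inv_norm i ^+ 2 * delta i)).
      by rewrite e1 mulr1.
    transitivity (A i j * inv_norm i ^+ 2 * (delta i * A i j)); first by ring.
    by rewrite e3; ring.
  transitivity (4 * cosm i j ^+ 2 * inv_norm i ^+ 2 * (inv_norm j ^+ 2 * delta j)); first by ring.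
  by rewrite e2; ring.
apply/eqP; move/eqP: sq; rewrite eqrXn2 //.
- by rewrite oppr_ge0 mulr_ge0_le0 // ltW.
- by rewrite !mulr_ge0 // ltW.
Qed.

Lemma act_e_self i : act (s i) (e_ i) = - e_ i.
Proof. by rewrite actZ act_s_self scalerN. Qed.

(** The Chebyshev polynomial of the second kind U_(k-1) at cos(pi/m). The recurrence [chebSS] is the
    one satisfied by the coordinates of roots along an alternating word. *)
Definition cheb i j (k : nat) : R :=
  sin (k%:R * (pi / (m_ i j)%:R)) / sin (pi / (m_ i j)%:R).

Lemma cheb_sym i j k : cheb i j k = cheb j i k.
Proof. by rewrite /cheb m_sym. Qed.

Lemma cheb0 i j : cheb i j 0 = 0.
Proof. by rewrite /cheb mul0r sin0 mul0r. Qed.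

Lemma cheb1 i j : i != j -> cheb i j 1 = 1.
Proof. by move=> nij; rewrite /cheb mul1r divff // gt_eqF // sin_angle_gt0. Qed.

Lemma chebSS i j k : cheb i j k.+2 = 2 * cosm i j * cheb i j k.+1 - cheb i j k.
Proof.
rewrite /cheb /cosm; set t := pi / _.
have -> : k.+2%:R * t = k.+1%:R * t + t by rewrite -addn1 natrD mulrDl mul1r.
have -> : k%:R * t = k.+1%:R * t - t by rewrite -[k.+1]addn1 natrD mulrDl mul1r addrK.
by rewrite sinD sinB; ring.
Qed.

Lemma cheb_ge0 i j k : i != j -> (k <= m_ i j)%N -> 0 <= cheb i j k.
Proof.
move=> nij km; apply: divr_ge0; last by rewrite ltW // sin_angle_gt0.
apply: sin_ge0_pi; apply/andP; split.
  by rewrite mulr_ge0 // ltW // angle_gt0.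
rewrite mulrCA ler_piMr ?pi_ge0 // ler_pdivrMr ?ltr0n ?m_gt0 // mul1r.
by rewrite ler_nat.
Qed.

Lemma cheb_gt0 i j k : i != j -> (0 < k < m_ i j)%N -> 0 < cheb i j k.
Proof.
move=> nij /andP[k0 km]; apply: divr_gt0; last exact: sin_angle_gt0.
apply: sin_gt0_pi; apply/andP; split.
  by rewrite mulr_gt0 ?ltr0n // angle_gt0.
rewrite mulrCA -ltr_pdivlMl ?pi_gt0 // mulVf ?gt_eqF ?pi_gt0 //.
by rewrite ltr_pdivrMr ?ltr0n ?m_gt0 // mul1r ltr_nat.
Qed.

Lemma cheb_rev i j k : (k <= m_ i j)%N -> cheb i j (m_ i j - k) = cheb i j k.
Proof.
move=> km; rewrite /cheb natrB // mulrBl.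
have -> : (m_ i j)%:R * (pi / (m_ i j)%:R) = pi :> R.
  by rewrite mulrCA divff ?mulr1 // pnatr_eq0 -lt0n m_gt0.
by rewrite sinB sinpi cospi mul0r sub0r mulN1r opprK.
Qed.

Lemma cheb_ge1 i j k : i != j -> (0 < k < m_ i j)%N -> 1 <= cheb i j k.
Proof.
move=> nij /andP[k0 km]; rewrite /cheb ler_pdivlMr ?sin_angle_gt0 // mul1r.
set t := pi / _; have t0 : 0 < t := angle_gt0 i j.
have mt : (m_ i j)%:R * t = pi.
  by rewrite mulrCA divff ?mulr1 // pnatr_eq0 -lt0n m_gt0.
(* Half sum and half difference of kt and t: sin(kt) - sin(t) = 2 cos(u) sin(v), and both factors
   are non-negative in the range. *)
pose u := (k.+1)%:R * t / 2; pose v := (k.-1)%:R * t / 2.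
have ek : k%:R * t = u + v.
  by rewrite /u /v; case: k k0 {km u v} => // k _ /=; rewrite -!natr1; field.
have e1 : t = u - v.
  by rewrite /u /v; case: k k0 {km u v ek} => // k _ /=; rewrite -!natr1; field.
rewrite ek {1}e1 sinB sinD -subr_ge0.
have -> : sin u * cos v + cos u * sin v - (sin u * cos v - cos u * sin v) =
  2 * (cos u * sin v) by ring.
have k1m : k.+1%:R * t <= pi by rewrite -mt ler_pM2r // ler_nat.
have kk : (k.-1)%:R * t <= k.+1%:R * t by rewrite ler_pM2r // ler_nat; lia.
have v0 : 0 <= (k.-1)%:R * t by rewrite mulr_ge0 // ltW.
have u0 : 0 <= k.+1%:R * t by rewrite mulr_ge0 // ltW.
have p0 := @pi_gt0 R.
rewrite !mulr_ge0 //.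
- by apply: cos_ge0_pihalf; rewrite /u; apply/andP; split; lra.
- by apply: sin_ge0_pi; rewrite /v; apply/andP; split; lra.
Qed.

(** The three-term sine identity. It places the direction with index b in the cone of those with
    indices a and c, as the coefficients depend on differences of indices only. *)
Lemma cheb_cone i j (a b c : nat) : (a <= b <= c)%N ->
  cheb i j (c - a) * cheb i j b =
  cheb i j (c - b) * cheb i j a + cheb i j (b - a) * cheb i j c.
Proof.
case/andP=> ab bc; have ac := leq_trans ab bc.
rewrite /cheb !natrB // !mulrBl; set t := pi / _.
rewrite !sinB; set sa := sin (a%:R * t); set ca := cos (a%:R * t).
set sb := sin (b%:R * t); set cb := cos (b%:R * t).
set sc := sin (c%:R * t); set cc := cos (c%:R * t); ring.
Qed.

(** Prefixing one reflection to the alternating word exchanges the two roles and applies the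
    recurrence [chebSS] once. *)
Lemma palt_e i j k : i != j ->
  act (palt i j k) (e_ (alt_letter i j k)) = cheb i j k.+1 *: e_ i + cheb i j k *: e_ j.
Proof.
elim: k i j => [|k IH] i j nij.
  by rewrite act1 cheb1 // cheb0 scale1r scale0r addr0.
have -> : alt_letter i j k.+1 = alt_letter j i k by rewrite /alt_letter /=; case: (odd k).
rewrite /= actM IH 1?eq_sym // actD (actZ _ _ (e_ j)) (actZ _ _ (e_ i)) act_e // act_e_self.
rewrite !(cheb_sym j i) chebSS scalerDr scalerA scalerN -addrA -scaleNr -scalerDl addrC.
by congr (_ *: _ + _); rewrite mulrC.
Qed.

(** * Roots and inversion sets *)

Definition vpos (v : 'cV[R]_n) := [forall i, 0 <= v i 0].

Lemma vposP (v : 'cV[R]_n) : reflect (forall i, 0 <= v i 0) (vpos v).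
Proof. exact: forallP. Qed.

Lemma vposD u v : vpos u -> vpos v -> vpos (u + v).
Proof. by move=> /vposP hu /vposP hv; apply/vposP => i; rewrite mxE addr_ge0. Qed.

Lemma vposZ c v : 0 <= c -> vpos v -> vpos (c *: v).
Proof. by move=> c0 /vposP hv; apply/vposP => i; rewrite mxE mulr_ge0. Qed.

Lemma vpos_simple i : vpos (a_ i).
Proof. by apply/vposP => k; rewrite simpleE. Qed.

Lemma vpos0 v : vpos v -> vpos (- v) -> v = 0.
Proof.
move=> /vposP hv /vposP hn; apply/matrixP=> k l; rewrite ord1 mxE.
by apply: le_anti; rewrite hv andbT; have := hn k; rewrite mxE oppr_ge0.
Qed.

Lemma vposZE c v : 0 < c -> vpos (c *: v) = vpos v.
Proof.
move=> c0; apply/idP/idP => h; last by rewrite vposZ ?ltW.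
have -> : v = c^-1 *: (c *: v) by rewrite scalerA mulVf ?gt_eqF ?scale1r.
by rewrite vposZ ?invr_ge0 ?ltW.
Qed.

Lemma vpos_act_e w i : vpos (act w (e_ i)) = vpos (act w (a_ i)).
Proof. by rewrite actZ vposZE // inv_norm_gt0. Qed.

Lemma len_mulr_ge w x : (len w <= len (w * x)%g + len x)%N.
Proof. by have := lenM (w * x)%g x^-1%g; rewrite mulgK lenV. Qed.

(* Humphreys, Reflection groups and Coxeter groups, Theorem 5.4: w is split as
   v times the longest alternating word in t and i that ends it. *)
Theorem vpos_act_simple w i : (len w < len (w * s i)%g)%N -> vpos (act w (a_ i)).
Proof.
have [N] := ubnP (len w); elim: N w i => // N IH w i wN up.
have [->|w1] := eqVneq w 1%g; first by rewrite act1 vpos_simple.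
have [t down] := len_last w1.
have nti : t != i by apply: contraTneq up => <-; rewrite -leqNgt -down.
pose P k := (len (w * palt t i k)%g + k == len w)%N.
have P1 : P 1%N by rewrite /P /= mulg1 addn1 down.
have Pb k : P k -> (k <= len w)%N by move/eqP<-; exact: leq_addl.
case: (ex_maxnP (ex_intro P _ P1) Pb) => k /eqP Pk kmax.
have k0 : (0 < k)%N := kmax _ P1.
(* If k reached m, the braid relation would let the split-off word start with [s i], and [w * s i]
   would be shorter than [w]. *)
have km : (k < m_ t i)%N.
  rewrite ltnNge; apply/negP => mk; pose v := (w * palt t i (m_ t i))%g.
  have lv : (len v + m_ t i <= len w)%N.
    rewrite -Pk -[X in (_ <= _ + X)%N](subnK mk) addnA leq_add2r.
    have -> : palt t i k = (palt t i (m_ t i) *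
        palt (alt_letter t i (m_ t i)) (alt_letter i t (m_ t i)) (k - m_ t i))%g.
      by rewrite -palt_add subnKC.
    rewrite mulgA -/v.
    exact: leq_trans (len_mulr_ge v _) (leq_add (leqnn _) (palt_len _ _ _)).
  have ev : (w * s i)%g = (v * (palt t i (m_ t i).-1)^-1)%g.
    have e0 : palt t i (m_ t i) = (s i * palt t i (m_ t i).-1)%g.
      by rewrite palt_m; case: (m_ t i) (m_gt0 t i).
    by rewrite /v e0 mulgA mulgK.
  have h1 := lenM v (palt t i (m_ t i).-1)^-1%g; rewrite -ev lenV in h1.
  have h2 := palt_len t i (m_ t i).-1; have h3 := m_gt0 t i.
  have h4 : (len (w * s i)%g <= len v + (m_ t i).-1)%N.
    exact: leq_trans h1 (leq_add (leqnn _) h2).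
  have h5 : (len v + (m_ t i).-1 < len v + m_ t i)%N by rewrite ltn_add2l prednK.
  by have := leq_trans up (leq_trans h4 (leq_trans (ltnW h5) lv)); rewrite ltnn.
set v := (w * palt t i k)%g in Pk.
pose r := alt_letter t i k; pose r' := alt_letter i t k.
have vN : (len v < N)%N.
  have h : (len v < len w)%N by rewrite -Pk -addn1 leq_add2l.
  exact: leq_trans h wN.
(* [r] is the letter that would prolong the split-off word, so a shorter [v * s r] would contradict
   the maximality of k. The other letter [r'] takes back the last step, hence lengthens [v]. *)
have A1 : vpos (act v (a_ r)).
  apply: IH => //; case: (len_sS v r) => [->//|h]; exfalso.
  have : P k.+1 by rewrite /P paltSr mulgA -/v -/r addnS -addSn h Pk.
  by move/kmax; rewrite ltnn.
have A2 : vpos (act v (a_ r')).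
  apply: IH => //.
  have -> : (v * s r')%g = (w * palt t i k.-1)%g.
    rewrite /v -{1}(prednK k0) paltSr.
    have -> : r' = alt_letter t i k.-1.
      by rewrite /r' /alt_letter -{1}(prednK k0) /=; case: (odd _).
    by rewrite mulgA sK.
  have h := len_mulr_ge w (palt t i k.-1); have h' := palt_len t i k.-1.
  have : (len w <= len (w * palt t i k.-1)%g + k.-1)%N.
    by apply: leq_trans h _; rewrite leq_add2l.
  by rewrite -Pk -{1}(prednK k0) addnS -addSn leq_add2r.
(* Now w a_i is a combination of the two positive vectors just found, with coefficients that are
   non-negative because k < m. *)
have ew : w = (v * palt r' r k)%g by rewrite /r' /r -paltV mulgK.
have ei : i = alt_letter r' r k by rewrite /r' /r /alt_letter; case: (odd k).
have nr : r' != r by rewrite /r' /r /alt_letter; case: (odd k); rewrite // eq_sym.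
have mr : m_ r' r = m_ t i by rewrite /r' /r /alt_letter; case: (odd k); rewrite // m_sym.
rewrite -vpos_act_e ew actM {1}ei palt_e // actD !(actZ _ (cheb _ _ _)).
apply: vposD; apply: vposZ; rewrite ?cheb_ge0 ?mr ?vpos_act_e //.
exact: ltnW.
Qed.

Local Notation isroot := (root_system rho).

Lemma isroot_act w b : isroot b -> isroot (act w b).
Proof. by case=> w' [i ->]; exists (w * w')%g, i; exact: esym (actM w w' _). Qed.

Lemma isroot_simple i : isroot (a_ i).
Proof. by exists 1%g, i; exact: esym (act1 _). Qed.

Lemma isrootN b : isroot b -> isroot (- b).
Proof.
case=> w [i ->]; exists (w * s i)%g, i; transitivity (act (w * s i)%g (a_ i)) => //.
by rewrite actM act_s_self actN.
Qed.

Lemma simple_neq0 i : a_ i != 0.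
Proof.
by apply/eqP=> /matrixP/(_ i 0)/eqP; rewrite simpleE eqxx mxE oner_eq0.
Qed.

Lemma root_neq0 b : isroot b -> b != 0.
Proof.
case=> w [i ->]; rewrite -/(act _ _); apply: contra (simple_neq0 i) => /eqP h.
by apply/eqP/(@act_inj w); rewrite h act0.
Qed.

(** If w a_i is not positive, then w s_i is shorter than w, and [vpos_act_simple] for w s_i makes -w
    a_i positive. *)
Lemma root_sign b : isroot b -> vpos (- b) = ~~ vpos b.
Proof.
move=> rb; have [pb|nb] := boolP (vpos b).
  by apply/negP => nb; move: (root_neq0 rb); rewrite (vpos0 pb nb) eqxx.
case: rb nb => w [i ->]; rewrite -/(act _ _) => nb.
case: (len_sS w i) => [h|h].
  by case/negP: nb; apply: vpos_act_simple; rewrite h.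
have -> : - act w (a_ i) = act (w * s i)%g (a_ i) by rewrite actM act_s_self actN.
by apply: vpos_act_simple; rewrite sK -h.
Qed.

Lemma len_ltP w i : (len w < len (w * s i)%g)%N = vpos (act w (a_ i)).
Proof.
apply/idP/idP; first exact: vpos_act_simple.
apply: contraLR; rewrite -leqNgt => h.
rewrite -root_sign; last exact: isroot_act (isroot_simple i).
have -> : - act w (a_ i) = act (w * s i)%g (a_ i) by rewrite actM act_s_self actN.
apply: vpos_act_simple; rewrite sK; case: (len_sS w i) => e; last by rewrite -e.
by rewrite e ltnn in h.
Qed.

Lemma descent w : w != 1%g -> exists i, ~~ vpos (act w (a_ i)).
Proof.
by move=> /len_last[i h]; exists i; rewrite -len_ltP -leqNgt -h.
Qed.

Lemma act_faithful w : (forall v, act w v = v) -> w = 1%g.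
Proof.
move=> H; apply/eqP; apply: contraT => /descent[i].
by rewrite H vpos_simple.
Qed.

Lemma act_refl w i v : act (w * s i * w^-1)%g v =
  v - (K (act w (a_ i)) v / delta i) *: act w (a_ i).
Proof.
rewrite !actM act_s_K actD actN actZ actKV; congr (_ - (_ / _) *: _).
by rewrite -(K_act w) actKV.
Qed.

Lemma K_root w i : K (act w (a_ i)) (act w (a_ i)) = 2 * delta i.
Proof. by rewrite K_act K_simple2 A_ii mulrC. Qed.

(* Proportional roots have equal reflections, so their simple reflections are
   conjugate and their norms agree. *)
Lemma root_reduced b c k : isroot b -> isroot c -> 0 < k -> b = k *: c -> b = c.
Proof.
case=> w [i ->] [w' [j ->]]; rewrite -!/(act _ _) => k0 e.
have := K_root w i; rewrite e KZl KZr K_root => eK.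
have di := delta_gt0 i; have dj := delta_gt0 j.
have dk : k ^+ 2 * delta j = delta i by lra.
have rr : (w * s i * w^-1 = w' * s j * w'^-1)%g.
  apply/eqP; rewrite eq_mulgV1; apply/eqP/act_faithful => v.
  rewrite actM; set u := act _^-1%g v.
  have -> : v = act (w' * s j * w'^-1)%g u by rewrite actKV.
  rewrite !act_refl e KZl scalerA -dk; congr (_ - _ *: _).
  by field; rewrite !gt_eqF.
have ej : s j = (s i ^ (w^-1 * w'))%g.
  transitivity (w'^-1 * (w * s i * w^-1) * w')%g.
    by rewrite rr !mulgA mulVg mul1g mulgKV.
  by rewrite conjgE invMg invgK !mulgA.
have dd : delta i = delta j by case: hdelta => _ _ /(_ i j _ ej).
have k1 : k = 1.
  apply/eqP; rewrite -(@eqrXn2 _ 2) // ?ltW // expr1n.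
  by apply/eqP; apply: (mulIf (lt0r_neq0 dj)); rewrite dk dd mul1r.
by move: e; rewrite k1 scale1r.
Qed.

(** [s i] changes only the i-th coordinate. A positive root that becomes negative is therefore a
    multiple of a_i, and equals it by [root_reduced]. *)
Lemma s_pos b i : isroot b -> vpos b -> b != a_ i -> vpos (act (s i) b).
Proof.
move=> rb pb; apply: contraR; rewrite -root_sign; last exact: isroot_act.
move=> /vposP nb; have z k : k != i -> b k 0 = 0.
  move=> nk; apply: le_anti; rewrite (vposP _ pb) andbT.
  by have := nb k; rewrite mxE act_s_coord // oppr_ge0.
have e : b = b i 0 *: a_ i.
  rewrite {1}(col_decomp b) (bigD1 i) //= big1 ?addr0 // => k nk.
  by rewrite z ?scale0r.
apply/eqP; apply: (root_reduced rb (isroot_simple i) _ e).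
rewrite lt_neqAle (vposP _ pb) andbT eq_sym.
by apply: contra (root_neq0 rb) => /eqP bi; rewrite e bi scale0r.
Qed.

Definition proots : seq 'cV[R]_n :=
  undup [seq b <- [seq act w (a_ i) | w <- enum gT, i <- enum 'I_n] | vpos b].

Lemma mem_proots b : b \in proots <-> isroot b /\ vpos b.
Proof.
rewrite mem_undup mem_filter; split=> [/andP[pb /allpairsP[[w i] [_ _ eb]]]|[[w [i ->]] pb]].
  by split; [rewrite eb; exact: isroot_act (isroot_simple _) | exact: pb].
rewrite pb andTb; apply/allpairsPdep; by exists w, i; rewrite !mem_enum.
Qed.

Lemma proots_uniq : uniq proots. Proof. exact: undup_uniq. Qed.

Lemma pos_rootsE b : pos_roots rho b <-> b \in proots.
Proof.
by split=> [[rb /vposP pb]|/mem_proots[rb /vposP pb]]; first exact/mem_proots.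
Qed.

Definition inv w b := (b \in proots) && ~~ vpos (act w^-1%g b).

Lemma inversionsE w b : inversions rho w b <-> inv w b.
Proof.
rewrite /inv; split.
- case=> /pos_rootsE pb [c [rc nc] e]; rewrite pb -e -/(act _ _) actK -root_sign //=.
  by apply/vposP => i; rewrite mxE oppr_ge0.
- case/andP=> pb nb; split; first exact/pos_rootsE.
  have [rb _] := (mem_proots b).1 pb; have rc := isroot_act w^-1%g rb.
  exists (act w^-1%g b); last exact: actKV.
  split=> // i; move: nb; rewrite -root_sign // => /vposP/(_ i).
  by rewrite mxE oppr_ge0.
Qed.

Lemma weak_leP v w : reflect (forall b, inv v b -> inv w b) (weak_le rho v w).
Proof.
apply: (iffP (asboolP _)) => H b.
- by move/inversionsE/H/inversionsE.
- by move/inversionsE/H/inversionsE.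
Qed.

Lemma inv1 b : inv 1%g b = false.
Proof.
apply/negP => /andP[/mem_proots[_ pb]].
by rewrite invg1 act1 pb.
Qed.

Lemma inv_step w i b : vpos (act w (a_ i)) ->
  inv (w * s i)%g b = inv w b || (b == act w (a_ i)).
Proof.
move=> up; rewrite /inv invMg sV actM; set c := act w^-1%g b.
have eb : b = act w c by rewrite actKV.
have -> : (b == act w (a_ i)) = (c == a_ i) by rewrite eb (inj_eq (@act_inj w)).
have [pb|nb] := boolP (b \in proots); last first.
  apply/esym/negP => /eqP ec; case/negP: nb; apply/mem_proots.
  by rewrite eb ec; split=> //; exact: isroot_act (isroot_simple i).
have [rb vb] := (mem_proots b).1 pb.
have rc : isroot c := isroot_act w^-1%g rb.
have [->|nc] /= := eqVneq c (a_ i).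
  by rewrite orbT act_s_self root_sign ?vpos_simple //; exact: isroot_simple.
rewrite orbF; congr (~~ _); have [pc|npc] := boolP (vpos c); first exact: s_pos.
apply/negbTE; rewrite -root_sign; last exact: isroot_act.
rewrite -actN; apply: s_pos; [exact: isrootN | by rewrite root_sign |].
apply/eqP=> e; move: vb; rewrite eb -[c]opprK e actN root_sign ?up //.
exact: isroot_act (isroot_simple i).
Qed.

Lemma weak_le_step w i : vpos (act w (a_ i)) -> weak_le rho w (w * s i)%g.
Proof. by move=> up; apply/weak_leP => b; rewrite inv_step // => ->. Qed.

Lemma pos_simple_act w i : vpos (act w (a_ i)) -> act w (a_ i) \in proots.
Proof. by move=> up; apply/mem_proots; split=> //; exact: isroot_act (isroot_simple i). Qed.

(** The letter is a descent i of w^-1 v. If v a_i were negative, its opposite would be an inversion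
    of v, hence of w, contrary to the choice of i. *)
Lemma weak_le_next v w : weak_le rho v w -> v != w ->
  exists2 i, vpos (act v (a_ i)) & inv w (act v (a_ i)).
Proof.
move=> /weak_leP vw nvw.
have /descent[i ni] : (w^-1 * v)%g != 1%g.
  by rewrite -eq_invg_mul invgK eq_sym.
have rv : isroot (act v (a_ i)) := isroot_act v (isroot_simple i).
have up : vpos (act v (a_ i)).
  apply: contraT; rewrite -root_sign // => nv; case/negP: (ni).
  have : inv v (- act v (a_ i)).
    rewrite /inv actN actK root_sign ?vpos_simple ?andbT; last exact: isroot_simple.
    by apply/mem_proots; split=> //; exact: isrootN.
  move/vw; rewrite /inv actN -actM => /andP[_].
  by rewrite root_sign ?negbK //; exact: isroot_act (isroot_simple i).
by exists i => //; rewrite /inv pos_simple_act // -actM.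
Qed.

Lemma weak_le_refl : reflexive (weak_le rho).
Proof. by move=> w; apply/weak_leP. Qed.

Lemma inv_simple_act v i : ~~ inv v (act v (a_ i)).
Proof. by rewrite /inv actK vpos_simple andbF. Qed.

Lemma weak_order : order_rel (weak_le rho).
Proof.
split; first exact: weak_le_refl.
- move=> v w /andP[vw /weak_leP wv]; apply/eqP; apply: contraT => nvw.
  have [i _ /wv] := weak_le_next vw nvw.
  by rewrite (negPf (inv_simple_act v i)).
- by move=> v u w /weak_leP uv /weak_leP vw; apply/weak_leP => b /uv/vw.
Qed.

Lemma weak_le_stepE v i w : vpos (act v (a_ i)) ->
  weak_le rho (v * s i)%g w = weak_le rho v w && inv w (act v (a_ i)).
Proof.
move=> up; apply/weak_leP/andP=> [H|[/weak_leP H h] b].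
  split; last by apply: H; rewrite inv_step // eqxx orbT.
  by apply/weak_leP => b h; apply: H; rewrite inv_step // h.
by rewrite inv_step // => /orP[/H|/eqP->].
Qed.

Lemma weak_coversP v w :
  covers (weak_le rho) v w <-> exists2 i, vpos (act v (a_ i)) & w = (v * s i)%g.
Proof.
split=> [vw|[i up ->]].
  have [i up h] := weak_le_next (covers_le vw) (covers_neq vw).
  have le1 : weak_le rho (v * s i)%g w by rewrite weak_le_stepE // (covers_le vw).
  exists i => //; case: (covers_between vw (weak_le_step up) le1) => // e.
  by have := len_sS_neq v i; rewrite e eqxx.
apply: coversP; first exact: weak_le_step.
  by apply/eqP=> e; have := len_sS_neq v i; rewrite -e eqxx.
move=> z vz /weak_leP zs; have [->|nz] := eqVneq z v; [by left | right].
have [j upj h] := weak_le_next vz (etrans (congr1 negb (eq_sym _ _)) nz : v != z).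
have := zs _ h; rewrite inv_step // (negPf (inv_simple_act v j)) /= => /eqP e.
have ij : j = i.
  apply/eqP; apply: contraT => nij; have /matrixP/(_ j 0)/eqP := act_inj e.
  by rewrite !simpleE eqxx (negPf nij) oner_eq0.
case: weak_order => _ an _; apply: an; apply/andP; split; first exact/weak_leP.
by rewrite -ij weak_le_stepE // vz h.
Qed.

Lemma root_labelE v i : vpos (act v (a_ i)) ->
  root_label rho v (v * s i)%g = act v (a_ i).
Proof.
move=> up; apply: xget_subset1.
  split; first by apply/inversionsE; rewrite inv_step // eqxx orbT.
  by move/inversionsE; rewrite (negPf (inv_simple_act v i)).
have H b : (inversions rho (v * s i)%g `\` inversions rho v)%classic b -> b = act v (a_ i).
  case=> /inversionsE + nb; rewrite inv_step // => /orP[h|/eqP//].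
  by case: nb; exact/inversionsE.
by move=> b c /H-> /H->.
Qed.

Lemma labels_uniq v c : path (covers (weak_le rho)) v c ->
  uniq (labels (root_label rho) (v :: c)) /\
  forall b, (b \in labels (root_label rho) (v :: c)) = inv (last v c) b && ~~ inv v b.
Proof.
elim: c v => [|w c IH] v; first by move=> _; split=> // b; rewrite /= andbN.
case/andP=> vw pc; have [i up ew] := (weak_coversP v w).1 vw.
have [u M] := IH w pc.
have -> : labels (root_label rho) [:: v, w & c] =
   act v (a_ i) :: labels (root_label rho) (w :: c) by rewrite /= {1}ew root_labelE.
have iw b : inv w b = inv v b || (b == act v (a_ i)) by rewrite ew inv_step.
have lastw : inv (last w c) (act v (a_ i)).
  apply: (elimT (weak_leP _ _) (chain_le_last weak_order pc)).
  by rewrite iw eqxx orbT.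
split; first by rewrite cons_uniq u andbT M iw eqxx orbT andbF.
move=> b; rewrite inE M iw negb_or [last v _]/=.
have [->|nb] := eqVneq b (act v (a_ i)); last by rewrite andbT.
by rewrite lastw inv_simple_act.
Qed.

Lemma weak_bot w : weak_le rho 1%g w.
Proof. by apply/weak_leP => b; rewrite inv1. Qed.

(** * Dihedral intervals and rank-two subsystems *)

Local Notation le_ := (weak_le rho).
Local Notation lam := (root_label rho).

Lemma inv_closed w b u v (p q : R) : 0 <= p -> 0 <= q -> b = p *: u + q *: v ->
  b \in proots -> inv w u -> inv w v -> inv w b.
Proof.
move=> p0 q0 eb pb /andP[/mem_proots[ru pu] nu'] /andP[/mem_proots[rv pv] nv].
rewrite /inv pb /=; have [rb _] := (mem_proots b).1 pb.
rewrite -root_sign; last exact: isroot_act.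
rewrite eb actD !actZ opprD -!scalerN vposD // vposZ // root_sign //; exact: isroot_act.
Qed.

Lemma inv_coclosed w b u v (p q : R) : 0 <= p -> 0 <= q -> b = p *: u + q *: v ->
  u \in proots -> v \in proots -> ~~ inv w u -> ~~ inv w v -> ~~ inv w b.
Proof.
move=> p0 q0 eb pu pv; rewrite /inv pu pv /= !negbK => hu hv.
by rewrite negb_and eb actD !actZ negbK vposD ?vposZ ?orbT.
Qed.

Lemma weak_le_trans : transitive le_. Proof. by case: weak_order. Qed.

(** The coordinate plane of two simple roots is stable under their dihedral subgroup, which
    identifies the letters that can occur inside a dihedral interval. *)
Definition supp2 i j (v : 'cV[R]_n) := [forall k, (k != i) && (k != j) ==> (v k 0 == 0)].

Lemma supp2_act i j r v : (r == i) || (r == j) -> supp2 i j (act (s r) v) = supp2 i j v.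
Proof.
move=> hr; apply: eq_forallb => k; have [nki|//] := boolP (k != i).
have [nkj|//] := boolP (k != j).
by rewrite act_s_coord //; case/orP: hr => /eqP->.
Qed.

Lemma supp2_palt i j k v : supp2 i j (act (palt i j k) v) = supp2 i j v.
Proof.
have aux a b l : (a == i) || (a == j) -> (b == i) || (b == j) ->
    supp2 i j (act (palt a b l) v) = supp2 i j v.
  elim: l a b => [|l IH] a b ha hb; first by rewrite act1.
  by rewrite actM supp2_act // IH.
by apply: aux; rewrite eqxx ?orbT.
Qed.

Lemma supp2_simple i j k : supp2 i j (a_ k) -> k = i \/ k = j.
Proof.
move/forallP/(_ k); rewrite simpleE eqxx oner_eq0 implybF negb_and !negbK.
by case/orP=> /eqP; [left | right].
Qed.

Lemma comb2_l i j (p q : R) : i != j -> (p *: a_ i + q *: a_ j) i 0 = p.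
Proof.
move=> nij; rewrite mxE mxE simpleE eqxx mulr1 mxE simpleE (negPf nij).
by rewrite mulr0 addr0.
Qed.

Lemma comb2_r i j (p q : R) : i != j -> (p *: a_ i + q *: a_ j) j 0 = q.
Proof. by move=> nij; rewrite addrC comb2_l // eq_sym. Qed.

Section DihedralInterval.
Variables (x : gT) (i j : 'I_n).
Hypotheses (nij : i != j) (xi : vpos (act x (a_ i))) (xj : vpos (act x (a_ j))).

Definition dih_top : gT := (x * palt i j (m_ i j))%g.
Definition dih_elt k : gT := (x * palt i j k)%g.
Definition dih_root k := act (x * palt i j k)%g (a_ (alt_letter i j k)).
Definition dih_chain := x :: mkseq (fun k => (x * palt i j k.+1)%g) (m_ i j).

Lemma dih_rootE k : dih_root k = (inv_norm (alt_letter i j k))^-1 *: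
  (cheb i j k.+1 *: act x (e_ i) + cheb i j k *: act x (e_ j)).
Proof.
have -> : dih_root k =
      (inv_norm (alt_letter i j k))^-1 *: act x (act (palt i j k) (e_ (alt_letter i j k))).
  rewrite -actM actZ scalerA mulVf ?scale1r //.
  by rewrite gt_eqF ?inv_norm_gt0.
by rewrite palt_e // actD (actZ _ (cheb _ _ _)) (actZ _ (cheb i j k)).
Qed.

Lemma isroot_dih k : isroot (dih_root k).
Proof. exact: isroot_act (isroot_simple _). Qed.

Lemma dih_root_pos k : (k < m_ i j)%N -> vpos (dih_root k).
Proof.
move=> km; rewrite dih_rootE; apply: vposZ; first by rewrite invr_ge0 ltW ?inv_norm_gt0.
apply: vposD; apply: vposZ; rewrite ?cheb_ge0 ?vpos_act_e //; exact: ltnW.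
Qed.

Lemma dih_elt0 : dih_elt 0 = x. Proof. exact: mulg1. Qed.

Lemma dih_eltS k : dih_elt k.+1 = (dih_elt k * s (alt_letter i j k))%g.
Proof. by rewrite /dih_elt paltSr mulgA. Qed.

Lemma dih_covers k : (k < m_ i j)%N -> covers le_ (dih_elt k) (dih_elt k.+1).
Proof.
move=> km; apply/weak_coversP; exists (alt_letter i j k); first exact: dih_root_pos.
exact: dih_eltS.
Qed.

Lemma dih_label k : (k < m_ i j)%N -> lam (dih_elt k) (dih_elt k.+1) = dih_root k.
Proof. by move=> km; rewrite dih_eltS root_labelE //; exact: dih_root_pos. Qed.

Let tail := mkseq (fun k => (x * palt i j k.+1)%g) (m_ i j).

Let nth_tail k : (k <= m_ i j)%N -> nth x (x :: tail) k = dih_elt k.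
Proof. by case: k => [|k] km /=; rewrite ?dih_elt0 // nth_mkseq. Qed.

Lemma dih_path : path (covers le_) x tail.
Proof.
apply/(pathP x) => k; rewrite size_mkseq => km.
rewrite nth_tail ?(ltnW km) // nth_mkseq //; exact: dih_covers.
Qed.

Lemma dih_last : last x tail = dih_top.
Proof. by rewrite (last_nth x) size_mkseq nth_tail. Qed.

Lemma dih_labels : labels lam dih_chain = mkseq dih_root (m_ i j).
Proof.
apply: (@eq_from_nth _ 0); first by rewrite size_pairmap !size_mkseq.
move=> k; rewrite size_pairmap size_mkseq => km.
rewrite (nth_pairmap x) ?size_mkseq // nth_tail ?(ltnW km) // !nth_mkseq //.
exact: dih_label.
Qed.

Lemma dih_interval_chain : interval_chain le_ x dih_top dih_chain.
Proof. by rewrite interval_chain_cons dih_path dih_last eqxx. Qed.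

Lemma dih_le k l : (k <= l <= m_ i j)%N -> le_ (dih_elt k) (dih_elt l).
Proof.
elim: l => [|l IH] /andP[kl lm].
  by move: kl; rewrite leqn0 => /eqP->; exact: weak_le_refl.
move: kl; rewrite leq_eqVlt => /predU1P[->|kl]; first exact: weak_le_refl.
apply: weak_le_trans (IH _) (covers_le (dih_covers lm)).
by rewrite -ltnS kl ltnW.
Qed.

Lemma dih_rootN k l : (k <= l < m_ i j)%N -> ~~ inv (dih_elt k) (dih_root l).
Proof.
case/andP=> kl lm; have := @dih_le k l; rewrite kl ltnW // => /(_ isT)/weak_leP H.
by apply/negP => /H; rewrite (negPf (inv_simple_act _ _)).
Qed.

Lemma dih_rootI k l : (k < l <= m_ i j)%N -> inv (dih_elt l) (dih_root k).
Proof.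
case/andP=> kl lm; have := @dih_le k.+1 l; rewrite kl lm => /(_ isT)/weak_leP; apply.
rewrite dih_eltS inv_step; first by rewrite eqxx orbT.
by apply: dih_root_pos; exact: leq_trans kl lm.
Qed.

Lemma dih_root_first : dih_root 0 = act x (a_ i).
Proof. by rewrite /dih_root mulg1. Qed.

(** The sine coefficients at m and m-1 are 0 and 1, so the last root is proportional to x a_j. The
    last letter depends on the parity of m and need not be [j]; [root_reduced] gives equality. *)
Lemma dih_root_last : dih_root (m_ i j).-1 = act x (a_ j).
Proof.
have m0 := m_gt0 i j; have m1 := m_gt1 nij; set l := alt_letter i j (m_ i j).-1.
have l0 := inv_norm_gt0 l; have j0 := inv_norm_gt0 j.
apply: (@root_reduced _ _ ((inv_norm l)^-1 * inv_norm j)).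
- exact: isroot_dih.
- exact: isroot_act (isroot_simple _).
- by apply: mulr_gt0 j0; rewrite invr_gt0.
rewrite dih_rootE prednK //.
have -> : cheb i j (m_ i j) = 0 by rewrite -[m_ i j]subn0 cheb_rev // cheb0.
have -> : cheb i j (m_ i j).-1 = 1 by rewrite -subn1 cheb_rev ?cheb1.
by rewrite scale0r add0r scale1r actZ scalerA.
Qed.

Lemma mem_dih_labels b : (b \in labels lam dih_chain) =
  inv dih_top b && ~~ inv x b.
Proof. by have [_ ->] := labels_uniq dih_path; rewrite dih_last. Qed.

Lemma inv_dih_top b : inv dih_top b = inv x b || (b \in labels lam dih_chain).
Proof.
rewrite mem_dih_labels; have [h|] //= := boolP (inv x b); last by rewrite andbT.
have := @dih_le 0 (m_ i j); rewrite leq0n leqnn dih_elt0 => /(_ isT)/weak_leP.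
exact.
Qed.

Lemma dih_labels_supp b : b \in labels lam dih_chain ->
  exists p q : R, [/\ 0 <= p, 0 <= q & b = p *: act x (a_ i) + q *: act x (a_ j)].
Proof.
rewrite dih_labels => /mapP[k]; rewrite mem_iota => /andP[_ km] ->.
exists ((inv_norm (alt_letter i j k))^-1 * (cheb i j k.+1 * inv_norm i)),
       ((inv_norm (alt_letter i j k))^-1 * (cheb i j k * inv_norm j)).
have h a : 0 <= inv_norm a by rewrite ltW ?inv_norm_gt0.
have hi : 0 <= (inv_norm (alt_letter i j k))^-1 by rewrite invr_ge0.
rewrite add0n in km; have ck := cheb_ge0 nij (ltnW km); have ck1 := cheb_ge0 nij km.
split; [exact: mulr_ge0 hi (mulr_ge0 ck1 (h i)) | exact: mulr_ge0 hi (mulr_ge0 ck (h j)) |].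
by rewrite dih_rootE !(actZ _ (inv_norm _)) scalerDr !scalerA.
Qed.

(** The coefficients are the coordinates of x^-1 b. This root cannot be negative, since then b would
    be negative too; so b lies in the cone of the first and last label, and closedness of inversions
    applies. *)
Lemma dih_labels_span b (p q : R) : b \in proots ->
  b = p *: act x (a_ i) + q *: act x (a_ j) -> b \in labels lam dih_chain.
Proof.
move=> pb eb; have [rb vb] := (mem_proots b).1 pb.
pose c := act x^-1%g b; have ec : c = p *: a_ i + q *: a_ j.
  by rewrite /c eb actD !actZ !actK.
have rc : isroot c by exact: isroot_act.
have pc : vpos c.
  apply: contraT; rewrite -root_sign // => nc.
  have ci : - c = (- p) *: a_ i + (- q) *: a_ j by rewrite ec opprD !scaleNr.
  have p0 : 0 <= - p by have := vposP _ nc i; rewrite ci comb2_l.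
  have q0 : 0 <= - q by have := vposP _ nc j; rewrite ci comb2_r.
  suff : ~~ vpos b by rewrite vb.
  rewrite -root_sign // eb opprD -!scaleNr; apply: vposD; exact: vposZ.
have nb : ~~ inv x b by rewrite /inv -/c pc andbF.
have p0 : 0 <= p by have := vposP _ pc i; rewrite ec comb2_l.
have q0 : 0 <= q by have := vposP _ pc j; rewrite ec comb2_r.
rewrite mem_dih_labels nb andbT; apply: inv_closed p0 q0 eb pb _ _.
- by rewrite -dih_root_first; apply: (@dih_rootI 0); rewrite m_gt0 leqnn.
- by rewrite -dih_root_last; apply: (@dih_rootI _ (m_ i j)); rewrite prednK ?m_gt0 ?leqnn.
Qed.

(** Inversions of the top that are new over [x] lie in the cone of x a_i and x a_j, and the
    inversions of [z] are closed under this. *)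
Lemma dih_top_min z : le_ (x * s i)%g z -> le_ (x * s j)%g z -> le_ dih_top z.
Proof.
rewrite !weak_le_stepE // => /andP[xz zi] /andP[_ zj]; apply/weak_leP => b.
rewrite inv_dih_top => /orP[|h]; first exact: (elimT (weak_leP _ _) xz).
have [p [q [p0 q0 eb]]] := dih_labels_supp h.
apply: inv_closed p0 q0 eb _ zi zj.
by move: h; rewrite mem_dih_labels => /andP[/andP[]].
Qed.

(** The label of a step inside the interval lies in the plane of x a_i and x a_j; carried back by
    the alternating word, it is a simple root supported on i and j. *)
Lemma dih_step k r : (k <= m_ i j)%N -> vpos (act (dih_elt k) (a_ r)) ->
  le_ (dih_elt k * s r)%g dih_top -> r = i \/ r = j.
Proof.
move=> km up; rewrite weak_le_stepE // => /andP[_ h].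
have nx : ~~ inv x (act (dih_elt k) (a_ r)).
  have := @dih_le 0 k; rewrite leq0n km dih_elt0 => /(_ isT)/weak_leP H.
  by apply/negP=> /H; rewrite (negPf (inv_simple_act _ _)).
have : act (dih_elt k) (a_ r) \in labels lam dih_chain by rewrite mem_dih_labels h nx.
case/dih_labels_supp=> p [q [_ _]]; rewrite /dih_elt actM -!actZ -actD => /act_inj e.
apply: supp2_simple; rewrite -(supp2_palt _ _ k) e; apply/forallP => l.
apply/implyP=> /andP[nli nlj]; rewrite !mxE (negPf nli) (negPf nlj) /=.
by rewrite !mulr0 addr0.
Qed.

(** Past the bottom there is no branching: only the letters i and j stay in the interval, and the
    one used last leads back down. *)
Lemma dih_chain_unique d k c : (k + d = m_ i j)%N -> (0 < k)%N ->
  path (covers le_) (dih_elt k) c -> last (dih_elt k) c = dih_top ->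
  c = [seq dih_elt l | l <- iota k.+1 d].
Proof.
elim: d k c => [|d IH] k c.
  rewrite addn0 => -> _ pc lc; case: c pc lc => // u c pc lc.
  move: (chain_uniq weak_order pc); rewrite cons_uniq => /andP[/negP[]].
  by rewrite -[dih_elt _]/dih_top -lc /= mem_last.
move=> kd k0; case: c => [|z c] /= pc lc.
  have km : (k < m_ i j)%N by rewrite -kd addnS ltnS leq_addr.
  have := @dih_rootN k k; rewrite leqnn km => /(_ isT).
  by rewrite lc (dih_rootI (l := m_ i j)) // km leqnn.
have km : (k < m_ i j)%N by rewrite -kd addnS ltnS leq_addr.
case/andP: pc => /weak_coversP[r up ez] pc.
have lez : le_ z dih_top by rewrite -lc; exact: (chain_le_last weak_order pc).
have er : r = alt_letter i j k.
  have : r = i \/ r = j by apply: (dih_step (ltnW km) up); rewrite -ez.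
  have : r != alt_letter i j k.-1.
    apply: contraTneq up => ->; rewrite -root_sign; last exact: isroot_act (isroot_simple _).
    have -> : dih_elt k = (dih_elt k.-1 * s (alt_letter i j k.-1))%g.
      by rewrite -dih_eltS prednK.
    rewrite actM act_s_self actN opprK; apply: dih_root_pos.
    by apply: leq_ltn_trans km; exact: leq_pred.
  rewrite /alt_letter -{2}(prednK k0) /=; case: (odd _) => /=.
  + by move=> /eqP nr [].
  + by move=> /eqP nr [].
have ez' : z = dih_elt k.+1 by rewrite dih_eltS -er.
rewrite ez' in pc lc *; congr (_ :: _).
by apply: IH => //; rewrite addSn -addnS.
Qed.

End DihedralInterval.

Lemma dih_top_sym x i j : dih_top x j i = dih_top x i j.
Proof. by rewrite /dih_top (m_sym j i) palt_m. Qed.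

Lemma dih_chainE x i j : dih_chain x i j =
  x :: [seq dih_elt x i j l | l <- iota 1 (m_ i j)].
Proof.
by rewrite /dih_chain /mkseq (iotaDl 1 0) -map_comp; congr (_ :: _); apply: eq_map.
Qed.

Lemma dih_interval_chains x i j C : i != j -> vpos (act x (a_ i)) -> vpos (act x (a_ j)) ->
  interval_chain le_ x (dih_top x i j) C -> C = dih_chain x i j \/ C = dih_chain x j i.
Proof.
move=> nij xi xj /interval_chainP[[|z c] [-> pc lc]].
  have := @dih_rootI x i j nij xi xj 0 (m_ i j).
  rewrite m_gt0 leqnn => /(_ isT); rewrite dih_root_first -[dih_elt _ _ _ _]lc.
  by rewrite (negPf (inv_simple_act _ _)).
have [xz pz] := andP pc; have [r up ez] := (weak_coversP x z).1 xz.
have aux a b : a != b -> vpos (act x (a_ a)) -> vpos (act x (a_ b)) ->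
    last z c = dih_top x a b -> r = a -> [:: x, z & c] = dih_chain x a b.
  move=> nab xa xb l ra; have m0 := m_gt0 a b.
  have ez1 : z = dih_elt x a b 1 by rewrite dih_eltS dih_elt0 ez ra.
  rewrite dih_chainE -(prednK m0) /= -ez1; congr [:: _, _ & _].
  apply: (@dih_chain_unique x a b nab xa xb); rewrite -?ez1 //.
  by rewrite add1n prednK.
have lez : le_ z (dih_top x i j) by rewrite -lc; exact: (chain_le_last weak_order pz).
have [er|er] : r = i \/ r = j.
  apply: (@dih_step x i j nij xi xj 0); rewrite ?dih_elt0 //.
  by rewrite -ez.
- by left; exact: aux.
- by right; apply: aux; rewrite // 1?eq_sym // dih_top_sym.
Qed.

Lemma dih_polygon x i j : i != j -> vpos (act x (a_ i)) -> vpos (act x (a_ j)) ->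
  polygon le_ x (dih_top x i j) (dih_chain x i j) (dih_chain x j i).
Proof.
move=> nij xi xj; have nji : j != i by rewrite eq_sym.
split; first exact: dih_interval_chain.
- by rewrite -dih_top_sym; exact: dih_interval_chain.
- rewrite !dih_chainE -(prednK (m_gt0 i j)) -(prednK (m_gt0 j i)) /= => -[].
  rewrite !dih_eltS !dih_elt0 => /mulgI/s_inj/eqP.
  by rewrite (negPf nij).
- by move=> C; exact: dih_interval_chains.
move=> z; rewrite !dih_chainE !inE => /predU1P[->|/mapP[k]]; first by left.
rewrite mem_iota add1n ltnS => /andP[k0 km] ez /predU1P[->|/mapP[l]]; first by left.
rewrite mem_iota add1n ltnS => /andP[l0 lm] ez'; right.
(* On the side that starts with j this root is inverted from the first step on; on the other side it
   is the last label, so a common element above [x] is the top. *)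
have h : inv z (act x (a_ j)).
  rewrite ez' -(dih_root_first x j i); apply: dih_rootI => //.
  by rewrite l0.
move: km; rewrite leq_eqVlt => /predU1P[ek|km]; first by rewrite ez ek.
have hk : (k <= (m_ i j).-1 < m_ i j)%N.
  by rewrite -ltnS prednK ?m_gt0 // km /=.
by have := dih_rootN nij xi xj hk; rewrite dih_root_last // -ez h.
Qed.

Lemma dih_is_join x i j : i != j -> vpos (act x (a_ i)) -> vpos (act x (a_ j)) ->
  is_join le_ (x * s i)%g (x * s j)%g (dih_top x i j).
Proof.
move=> nij xi xj; have aux a b : a != b -> vpos (act x (a_ a)) -> vpos (act x (a_ b)) ->
    le_ (x * s a)%g (dih_top x a b).
  move=> nab xa xb; have := @dih_le x a b nab xa xb 1 (m_ a b).
  by rewrite m_gt0 leqnn dih_eltS dih_elt0; apply.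
split; first exact: aux.
  by rewrite -dih_top_sym; apply: aux; rewrite // eq_sym.
by move=> z; exact: dih_top_min.
Qed.

Lemma weak_up_polygonal : up_polygonal le_.
Proof.
move=> x a b /weak_coversP[i xi ->] /weak_coversP[j xj ->] nab.
have nij : i != j by apply: contra nab => /eqP->.
exists (dih_top x i j), [seq dih_elt x i j l | l <- iota 2 (m_ i j).-1],
  [seq dih_elt x j i l | l <- iota 2 (m_ j i).-1]; split; last exact: dih_is_join.
have := dih_polygon nij xi xj.
rewrite !dih_chainE -{1}(prednK (m_gt0 i j)) -{1}(prednK (m_gt0 j i)) /=.
by rewrite !dih_eltS !dih_elt0.
Qed.

Lemma weak_polygonP x y c1 c2 : polygon le_ x y c1 c2 -> exists i j,
  [/\ i != j, vpos (act x (a_ i)), vpos (act x (a_ j)), y = dih_top x i j &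
      c1 = dih_chain x i j /\ c2 = dih_chain x j i].
Proof.
move=> pol; have [a [b [d1 [d2 [e1 e2 nab xa xb]]]]] := polygon_shape weak_order pol.
have [i xi ea] := (weak_coversP x a).1 xa; have [j xj eb] := (weak_coversP x b).1 xb.
have nij : i != j by apply: contra nab => /eqP eij; rewrite ea eb eij.
have nji : j != i by rewrite eq_sym.
have ey : dih_top x i j = y.
  apply: (polygon_join weak_order (d1 := d1) (d2 := d2) (x := x) (a := a) (b := b)).
    by rewrite -e1 -e2.
  by rewrite ea eb; exact: dih_is_join.
exists i, j; split=> //; have [h1 h2 _ _ _] := pol; rewrite -ey in h1 h2.
have second u v : i != j -> dih_chain x u v = [:: x, (x * s u)%g &
    [seq dih_elt x u v l | l <- iota 2 (m_ u v).-1]].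
  by rewrite dih_chainE -{1}(prednK (m_gt0 u v)) /= dih_eltS dih_elt0.
split.
- case: (dih_interval_chains nij xi xj h1) => // e.
  by move: e nab; rewrite e1 second // ea eb => -[->]; rewrite eqxx.
- case: (dih_interval_chains nij xi xj h2) => // e.
  by move: e nab; rewrite e2 second // ea eb => -[->]; rewrite eqxx.
Qed.

Lemma size_dih_chain x i j : size (dih_chain x i j) = (m_ i j).+1.
Proof. by rewrite /= size_mkseq. Qed.

Lemma dih_square x i j : i != j -> vpos (act x (a_ i)) -> vpos (act x (a_ j)) ->
  square le_ x (dih_top x i j) <-> m_ i j = 2%N.
Proof.
move=> nij xi xj; have := squareP weak_order (dih_polygon nij xi xj).
rewrite !size_dih_chain (m_sym j i) => h; split=> [/h[[->]]|e] //.
by apply/h; rewrite e.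
Qed.

(** The symmetry sin(pi - a) = sin a makes the two roots positive multiples of each other, hence
    equal by [root_reduced]. *)
Lemma dih_root_rev x i j k : i != j -> vpos (act x (a_ i)) -> vpos (act x (a_ j)) ->
  (k < m_ i j)%N -> dih_root x j i k = dih_root x i j ((m_ i j).-1 - k).
Proof.
move=> nij xi xj km; have nji : j != i by rewrite eq_sym.
set l := ((m_ i j).-1 - k)%N.
have lS : l.+1 = (m_ i j - k)%N by rewrite /l -subSn ?prednK ?m_gt0 // -ltnS prednK ?m_gt0.
have el : l = (m_ i j - k.+1)%N by rewrite /l subnS -predn_sub.
set u := alt_letter j i k; set v := alt_letter i j l.
have u0 := inv_norm_gt0 u; have v0 := inv_norm_gt0 v.
apply: (@root_reduced _ _ ((inv_norm u)^-1 * inv_norm v)); try exact: isroot_dih.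
  by apply: mulr_gt0 v0; rewrite invr_gt0.
rewrite (dih_rootE _ nji) (dih_rootE _ nij) -/u -/v lS el !(cheb_rev, cheb_sym j i) //; last first.
  exact: ltnW.
by rewrite scalerA -mulrA divff ?mulr1 ?gt_eqF // addrC.
Qed.

Lemma dih_labels_rev x i j : i != j -> vpos (act x (a_ i)) -> vpos (act x (a_ j)) ->
  labels lam (dih_chain x j i) = rev (labels lam (dih_chain x i j)).
Proof.
move=> nij xi xj; have nji : j != i by rewrite eq_sym.
rewrite !dih_labels //; apply: (@eq_from_nth _ 0).
  by rewrite size_rev !size_mkseq m_sym.
move=> k; rewrite size_mkseq m_sym => km; rewrite nth_rev size_mkseq //.
have k2 : (m_ i j - k.+1 < m_ i j)%N by rewrite ltn_subrL (leq_ltn_trans _ km).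
rewrite (nth_mkseq _ _ km) (nth_mkseq _ _ k2).
by rewrite dih_root_rev // subnS -predn_sub.
Qed.

(** All roots in the plane of b and c. For distinct positive roots it is the one rank-two subsystem
    containing both, by [rank_two_unique]. *)
Definition psi2 (b c : 'cV[R]_n) : set 'cV[R]_n :=
  [set d | isroot d /\ exists p q : R, d = p *: b + q *: c]%classic.

Lemma pos_not_proportional b c k : b \in proots -> c \in proots -> b != c -> b <> k *: c.
Proof.
move=> /mem_proots[rb pb] /mem_proots[rc pc] nbc e.
case: (ltrgtP k 0) => k0.
- have : vpos (- b) by rewrite e -scaleNr vposZ // oppr_ge0 ltW.
  by rewrite root_sign // pb.
- by move: nbc; rewrite (root_reduced rb rc k0 e) eqxx.
- by move: (root_neq0 rb); rewrite e k0 scale0r eqxx.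
Qed.

Section RankTwo.
Variables b c : 'cV[R]_n.
Hypotheses (pb : b \in proots) (pc : c \in proots) (nbc : b != c).

Let rb : isroot b. Proof. by have [] := (mem_proots b).1 pb. Qed.
Let rc : isroot c. Proof. by have [] := (mem_proots c).1 pc. Qed.
Let U := (<[b]> + <[c]>)%VS.

Let memU v : reflect (exists p q : R, v = p *: b + q *: c) (v \in U).
Proof.
apply: (iffP memv_addP) => [[u /vlineP[p ->] [w /vlineP[q ->] ->]]|[p [q ->]]].
  by exists p, q.
by exists (p *: b); [exact: memvZ (memv_line b) | exists (q *: c);
   [exact: memvZ (memv_line c) |]].
Qed.

Let dimU : \dim U = 2%N.
Proof.
rewrite dimv_disjoint_sum ?dim_vline ?root_neq0 //.
apply/eqP; rewrite -subv0; apply/subvP => v /memv_capP[/vlineP[p ep] /vlineP[q eq]].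
rewrite memv0 ep; have [->|p0] := eqVneq p 0; first by rewrite scale0r.
case: (@pos_not_proportional b c (p^-1 * q) pb pc nbc).
by rewrite -scalerA -eq ep scalerA mulVf // scale1r.
Qed.

Let Ule (U' : {vspace 'cV[R]_n}) : b \in U' -> c \in U' -> (U <= U')%VS.
Proof. by move=> hb hc; rewrite subv_add -!memvE hb hc. Qed.

Let Ueq (U' : {vspace 'cV[R]_n}) : \dim U' = 2%N -> b \in U' -> c \in U' -> U' = U.
Proof.
by move=> d hb hc; apply/eqP; rewrite eq_sym eqEdim Ule //= d dimU.
Qed.

Lemma psi2_pre_rank_two : pre_rank_two s rho (psi2 b c).
Proof.
split.
- by move=> d [].
- exists U; split; first exact: dimU.
    by move=> d [_ h]; apply/memU.
  move=> U' H; apply: Ule; apply: H; split=> //.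
    by exists 1, 0; rewrite scale1r scale0r addr0.
  by exists 0, 1; rewrite scale1r scale0r add0r.
move=> b' c' r [rb' [p [q eb']]] [rc' [p' [q' ec']]] [w [i er]].
rewrite -!/(act _ _) er act_refl; set be := act w (a_ i).
set t := K be b' / delta i => e.
have t0 : t != 0.
  apply: contra (root_neq0 rb') => /eqP h; move: e; rewrite h scale0r subr0 => e.
  have : (2 : R) *: b' = 0 by rewrite scaler_nat mulr2n {1}e addNr.
  by move/eqP; rewrite scaler_eq0 pnatr_eq0.
(* Since b' - t be = -b', the root of the reflection [r] is a multiple of b'; reflecting c' then
   stays in the plane. *)
have ebe : be = (2 / t) *: b'.
  have tb : t *: be = 2 *: b'.
    apply/matrixP=> k l; have := congr1 (fun M : 'cV[R]_n => M k l) e.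
    by rewrite !mxE; lra.
  by rewrite [2 / t]mulrC -scalerA -tb scalerA mulVf ?scale1r.
split; first exact: isroot_act.
rewrite act_refl -/be ebe eb' ec'; set t' := K _ _ / _.
set t2 := 2 / t; exists (p' - t' * t2 * p), (q' - t' * t2 * q).
by apply/matrixP=> k l; rewrite !mxE; ring.
Qed.

Let psi2_max Psi : pre_rank_two s rho Psi -> Psi b -> Psi c -> (Psi `<=` psi2 b c)%classic.
Proof.
case=> sub [U' [d2 memU' _]] _ hb hc v hv; split; first exact: sub.
by apply/memU; rewrite -(Ueq d2) ?memU'.
Qed.

Lemma psi2_rank_two : rank_two_subsystem s rho (psi2 b c).
Proof.
split; first exact: psi2_pre_rank_two.
move=> Psi pre sub; apply/seteqP; split=> //; apply: psi2_max => //.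
  by apply: sub; split=> //; exists 1, 0; rewrite scale1r scale0r addr0.
by apply: sub; split=> //; exists 0, 1; rewrite scale1r scale0r add0r.
Qed.

Lemma rank_two_unique Psi : rank_two_subsystem s rho Psi -> Psi b -> Psi c ->
  Psi = psi2 b c.
Proof.
by case=> pre mx hb hc; apply/esym/mx; [exact: psi2_pre_rank_two | exact: psi2_max].
Qed.

End RankTwo.

Local Notation comm := (commutative_subsystem A delta).

Lemma dih_simple_neq x i j : i != j -> act x (a_ i) != act x (a_ j).
Proof.
move=> nij; apply: contra nij => /eqP/act_inj/matrixP/(_ i 0).
rewrite !simpleE eqxx; have [//|_] := eqVneq i j.
by move/eqP; rewrite oner_eq0.
Qed.

Lemma dih_labelsE x i j b : i != j -> vpos (act x (a_ i)) -> vpos (act x (a_ j)) ->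
  (b \in labels lam (dih_chain x i j)) <->
  psi2 (act x (a_ i)) (act x (a_ j)) b /\ vpos b.
Proof.
move=> nij xi xj; split=> [h|[[rb [p [q e]]] pb]].
  have [p [q [_ _ e]]] := dih_labels_supp nij xi xj h.
  have : b \in proots.
    by move: h; rewrite mem_dih_labels // => /andP[/andP[]].
  by case/mem_proots=> rb vb; split=> //; split=> //; exists p, q.
by apply: dih_labels_span e => //; apply/mem_proots.
Qed.

Lemma m2_orthogonal i j : i != j -> m_ i j = 2%N -> A i j = 0.
Proof.
move=> nij m2; case: hA => _ _ /(_ i j) + z; rewrite -/(cosm i j) /cosm m2 cos_pihalf.
rewrite expr0n mulr0 => /eqP; rewrite mulf_eq0 => /orP[/eqP//|/eqP/z]; exact.
Qed.

(** The labels of the interval are the m positive roots of the subsystem, and a set of two opposite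
    pairs contains at most two positive roots. *)
Lemma dih_comm x i j : i != j -> vpos (act x (a_ i)) -> vpos (act x (a_ j)) ->
  comm (psi2 (act x (a_ i)) (act x (a_ j))) <-> m_ i j = 2%N.
Proof.
move=> nij xi xj; set b := act x (a_ i); set c := act x (a_ j).
have lab := fun d => @dih_labelsE x i j d nij xi xj.
split=> [[u [v [e _]]]|m2].
  pose p (t : 'cV[R]_n) := if vpos t then t else - t.
  have pE (t d : 'cV[R]_n) : vpos d -> d = t \/ d = - t -> d = p t.
    rewrite /p => vd [e'|e']; subst d; first by rewrite vd.
    by case: ifP => // vt; rewrite (vpos0 vt vd) oppr0.
  have sub : {subset labels lam (dih_chain x i j) <= [:: p u; p v]}.
    move=> d /lab[+ vd]; rewrite -/b -/c e !inE => -[[[h|h]|h]|h].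
    - by rewrite (pE u d vd (or_introl h)) eqxx.
    - by rewrite (pE u d vd (or_intror h)) eqxx.
    - by rewrite (pE v d vd (or_introl h)) eqxx orbT.
    - by rewrite (pE v d vd (or_intror h)) eqxx orbT.
  have := uniq_leq_size (labels_uniq (dih_path nij xi xj)).1 sub.
  rewrite dih_labels // size_mkseq /= => m2; apply/eqP.
  by rewrite eqn_leq m2 m_gt1.
exists b, c; split; last by rewrite K_act K_simple2 m2_orthogonal // mulr0.
have two d : psi2 b c d -> vpos d -> d = b \/ d = c.
  move=> hd vd; have /lab : psi2 b c d /\ vpos d by [].
  rewrite dih_labels // m2 /mkseq /= !inE => /orP[/eqP->|/eqP->]; [left | right].
    exact: dih_root_first.
  by have := dih_root_last x nij; rewrite m2.
apply/seteqP; split=> d.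
  move=> hd; have [rd [p [q e]]] := hd; have [vd|nd] := boolP (vpos d).
    by case: (two d hd vd) => ->; [left; left; left | left; right].
  have hN : psi2 b c (- d).
    by split; [exact: isrootN | exists (- p), (- q); rewrite e opprD !scaleNr].
  have vN : vpos (- d) by rewrite root_sign.
  by case: (two _ hN vN) => e'; [left; left; right | right]; rewrite -e' opprK.
have rb : isroot b := isroot_act x (isroot_simple i).
have rc : isroot c := isroot_act x (isroot_simple j).
case=> [[[->|->]|->]|->].
- by split=> //; exists 1, 0; rewrite scale1r scale0r addr0.
- by split; [exact: isrootN | exists (- 1), 0; rewrite scaleN1r scale0r addr0].
- by split=> //; exists 0, 1; rewrite scale1r scale0r add0r.
- by split; [exact: isrootN | exists 0, (- 1); rewrite scaleN1r scale0r add0r].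
Qed.

(** The coordinates of [V] are sines with consecutive indices, so [cheb_cone] applies to both with
    the same coefficients. The factors [N] undo the normalisation. *)
Lemma dih_cone x i j k l r : i != j -> (k < l < r)%N -> (r < m_ i j)%N ->
  exists p q : R, [/\ 0 <= p, 0 <= q &
    dih_root x i j l = p *: dih_root x i j k + q *: dih_root x i j r].
Proof.
move=> nij /andP[kl lr] rm; have kr := ltn_trans kl lr.
pose V t := cheb i j t.+1 *: act x (e_ i) + cheb i j t *: act x (e_ j).
pose N t := inv_norm (alt_letter i j t).
have N0 t : 0 < N t := inv_norm_gt0 _.
have E t : dih_root x i j t = (N t)^-1 *: V t by exact: dih_rootE.
have c0 : 0 < cheb i j (r - k).
  by apply: cheb_gt0 => //; rewrite subn_gt0 kr (leq_ltn_trans (leq_subr _ _)).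
have c1 : 0 <= cheb i j (r - l).
  by apply: cheb_ge0 => //; rewrite (leq_trans (leq_subr _ _)) // ltnW.
have c2 : 0 <= cheb i j (l - k).
  apply: cheb_ge0 => //; apply: leq_trans (leq_subr _ _) _.
  exact: leq_trans (ltnW lr) (ltnW rm).
have cone : cheb i j (r - k) *: V l = cheb i j (r - l) *: V k + cheb i j (l - k) *: V r.
  have klr : (k <= l <= r)%N by rewrite (ltnW kl) (ltnW lr).
  have e1 := cheb_cone i j klr.
  have e2 : cheb i j (r - k) * cheb i j l.+1 =
      cheb i j (r - l) * cheb i j k.+1 + cheb i j (l - k) * cheb i j r.+1.
    exact: (@cheb_cone i j k.+1 l.+1 r.+1 klr).
  rewrite /V !scalerDr !scalerA e1 e2 !scalerDl; exact: addrACA.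
exists ((N l)^-1 * (cheb i j (r - k))^-1 * (cheb i j (r - l) * N k)),
       ((N l)^-1 * (cheb i j (r - k))^-1 * (cheb i j (l - k) * N r)).
have Nl : 0 <= (N l)^-1 by rewrite invr_ge0 ltW.
have ci : 0 <= (cheb i j (r - k))^-1 by rewrite invr_ge0 ltW.
split.
- by apply: mulr_ge0 (mulr_ge0 Nl ci) (mulr_ge0 c1 (ltW (N0 k))).
- by apply: mulr_ge0 (mulr_ge0 Nl ci) (mulr_ge0 c2 (ltW (N0 r))).
have E' t : N t *: dih_root x i j t = V t.
  by rewrite E scalerA mulfV ?scale1r ?gt_eqF.
transitivity (((N l)^-1 * (cheb i j (r - k))^-1) *:
    (cheb i j (r - l) *: (N k *: dih_root x i j k) +
     cheb i j (l - k) *: (N r *: dih_root x i j r))).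
  by rewrite !E' -cone scalerA -mulrA mulVf ?gt_eqF // mulr1 E.
by rewrite scalerDr !scalerA !mulrA.
Qed.

(** * Reduced words, heaps and maximal chains *)

(** A recursive form of [root_sequence] that needs no reducedness, hence suits concatenation and
    prefixes; the two agree on reduced words by [red_root_sequence]. *)
Fixpoint word_roots w (u : seq 'I_n) : seq 'cV[R]_n :=
  if u is i :: u' then act w (a_ i) :: word_roots (w * s i)%g u' else [::].

Lemma size_word_roots w u : size (word_roots w u) = size u.
Proof. by elim: u w => //= i u IH w; rewrite IH. Qed.

Lemma word_roots_cat w u v :
  word_roots w (u ++ v) = word_roots w u ++ word_roots (w * wp u)%g v.
Proof.
elim: u w => [|i u IH] w; first by rewrite wp_nil mulg1.
by rewrite /= IH wp_cons mulgA.
Qed.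

Lemma word_roots_inj w u v : word_roots w u = word_roots w v -> u = v.
Proof.
elim: u w v => [|i u IH] w [|j v] //= [/act_inj e].
have -> : i = j.
  apply/eqP; apply: contraT => nij; move/matrixP/(_ i 0)/eqP: e.
  rewrite !simpleE eqxx (negPf nij) => /eqP h.
  by case/eqP: (oner_neq0 R); exact: h.
by move/IH->.
Qed.

Let chain_from w u := scanl (fun g i => (g * s i)%g) w u.

Lemma reduced_chain w u : len (w * wp u)%g = (len w + size u)%N ->
  [/\ path (covers le_) w (chain_from w u), last w (chain_from w u) = (w * wp u)%g
    & labels lam (w :: chain_from w u) = word_roots w u].
Proof.
elim: u w => [|i u IH] w /=; first by rewrite wp_nil mulg1.
rewrite wp_cons mulgA addnS => h.
have h1 := lenM (w * s i)%g (wp u); have h2 := len_min u.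
have lS : len (w * s i)%g = (len w).+1.
  case: (len_sS w i) => // e; exfalso.
  have := leq_trans h1 (leq_add (leqnn _) h2); rewrite h -e.
  by rewrite -!addSn leq_add2r ltnNge leqnSn.
have up : vpos (act w (a_ i)) by rewrite -len_ltP lS.
have [p l lb] : [/\ path (covers le_) (w * s i)%g (chain_from (w * s i)%g u),
  last (w * s i)%g (chain_from (w * s i)%g u) = (w * s i * wp u)%g &
  labels lam ((w * s i)%g :: chain_from (w * s i)%g u) = word_roots (w * s i)%g u].
  by apply: IH; rewrite h lS addSn.
split=> //; last by rewrite /= root_labelE //; congr (_ :: _).
by rewrite p andbT; apply/weak_coversP; exists i.
Qed.

Definition red (u : seq 'I_n) := len (wp u) = size u.

Lemma red_inv u : red u -> uniq (word_roots 1%g u) /\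
  forall b, inv (wp u) b = (b \in word_roots 1%g u).
Proof.
move=> ru; have [] := @reduced_chain 1%g u; first by rewrite mul1g len1 add0n.
rewrite mul1g => p l <-; have [un M] := labels_uniq p.
by split=> // b; rewrite M l inv1 andbT.
Qed.

Lemma red_root_sequence u : red u -> root_sequence s rho u = word_roots 1%g u.
Proof. by move=> ru; have [] := @reduced_chain 1%g u; rewrite ?mul1g ?len1. Qed.

Lemma red_take u k : red u -> red (take k u).
Proof.
rewrite /red -{1 2}(cat_take_drop k u) wp_cat size_cat => h.
apply/eqP; rewrite eqn_leq len_min /=.
have := leq_trans (lenM (wp (take k u)) _) (leq_add (leqnn _) (len_min (drop k u))).
by rewrite h leq_add2r.
Qed.

(** Turns positions in a reduced word into inversion sets of its prefixes, to which closedness and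
    coclosedness apply. *)
Lemma inv_take u k b : red u -> b \in word_roots 1%g u ->
  inv (wp (take k u)) b = (index b (word_roots 1%g u) < k)%N.
Proof.
move=> ru hb; have [_ ->] := red_inv (red_take k ru).
have -> : word_roots 1%g (take k u) = take k (word_roots 1%g u).
  rewrite -{2}(cat_take_drop k u) word_roots_cat take_cat size_word_roots size_take.
  case: (ltnP k (size u)) => ks; first by rewrite ltnn subnn take0 cats0.
  by rewrite ltnNge ks /= drop_oversize // take_oversize // cats0.
by rewrite in_take.
Qed.

(** * The longest element and the duality it induces *)

Section LongestElement.
Variable w0 : gT.
Hypothesis hw0 : longest s w0.

Lemma len_w0 w : (len w <= len w0)%N.
Proof.
have [u eu su] := len_word w0; have [v ev sv] := len_word w.
rewrite -su -sv; apply: (hw0 (w' := w)); exact/reduced_wordP.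
Qed.

Lemma w0_simple i : ~~ vpos (act w0^-1%g (a_ i)).
Proof. by rewrite -len_ltP -leqNgt lenV len_w0. Qed.

Lemma vpos_sum (I : finType) (F : I -> 'cV[R]_n) :
  (forall k, vpos (F k)) -> vpos (\sum_k F k).
Proof.
move=> H; elim/big_ind: _ => //; last by move=> u v; exact: vposD.
by apply/vposP => k; rewrite mxE.
Qed.

Lemma vpos_w0 c : isroot c -> vpos (act w0^-1%g c) = ~~ vpos c.
Proof.
have half b : isroot b -> vpos b -> ~~ vpos (act w0^-1%g b).
  move=> rb vb; rewrite -root_sign; last exact: isroot_act.
  rewrite {1}(col_decomp b) act_sum -sumrN; apply: vpos_sum => i.
  rewrite actZ -scalerN; apply: vposZ; first exact: (vposP _ vb).
  by rewrite root_sign ?w0_simple //; exact: isroot_act (isroot_simple i).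
move=> rc; have [vc|nc] := boolP (vpos c); first exact/negbTE/half.
rewrite -[c]opprK actN root_sign; last exact: isroot_act (isrootN rc).
by apply: half; [exact: isrootN | rewrite root_sign].
Qed.

Lemma inv_mul_w0 w b : inv (w * w0)%g b = (b \in proots) && ~~ inv w b.
Proof.
rewrite /inv; have [pb|//] := boolP (b \in proots); rewrite /= negbK invMg actM.
by rewrite vpos_w0 ?negbK //; apply: isroot_act; have [] := (mem_proots b).1 pb.
Qed.

Lemma inv_w0 b : inv w0 b = (b \in proots).
Proof. by have := inv_mul_w0 1%g b; rewrite mul1g inv1 andbT. Qed.

Lemma weak_top w : le_ w w0.
Proof. by apply/weak_leP => b; rewrite inv_w0 => /andP[]. Qed.

Lemma w0_invol : (w0 * w0 = 1)%g.
Proof.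
case: weak_order => _ an _; apply: an; rewrite weak_bot andbT.
by apply/weak_leP => b; rewrite inv_mul_w0 inv_w0 andbN.
Qed.

Lemma weak_dual v w : le_ (v * w0)%g (w * w0)%g = le_ w v.
Proof.
have half a b : le_ a b -> le_ (b * w0)%g (a * w0)%g.
  move=> /weak_leP ab; apply/weak_leP => d; rewrite !inv_mul_w0.
  by case/andP=> -> /=; apply: contra; exact: ab.
apply/idP/idP; last exact: half.
by move/half; rewrite -!mulgA w0_invol !mulg1.
Qed.

(** * The root order of a reduced word and its heap *)

Section ReducedWord.
Variable u : seq 'I_n.
Hypothesis hu : reduced_word s w0 u.

Local Notation rs := (word_roots 1%g u).
Local Notation ix b := (index b rs).
Local Notation hp := (heap s A delta rho u).

Let ru : red u.
Proof. by have [e h] := (reduced_wordP w0 u).1 hu; rewrite /red e h. Qed.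

Let wu : wp u = w0. Proof. by have [] := (reduced_wordP w0 u).1 hu. Qed.

Lemma rs_uniq : uniq rs. Proof. by have [] := red_inv ru. Qed.

Lemma mem_rs b : (b \in rs) = (b \in proots).
Proof. by have [_ <-] := red_inv ru; rewrite wu inv_w0. Qed.

Lemma ix_inj b c : b \in proots -> c \in proots -> ix b = ix c -> b = c.
Proof. by rewrite -!mem_rs => hb hc; exact: index_inj. Qed.

Lemma heap_genP b c : heap_gen s A delta rho u b c <->
  [/\ b \in proots, c \in proots, (ix b < ix c)%N &
    exists Psi, [/\ rank_two_subsystem s rho Psi, ~ comm Psi, Psi b & Psi c]].
Proof.
rewrite /heap_gen red_root_sequence //; split.
- case=> i [j [/andP[ij js] -> -> H]].
  have is_ := ltn_trans ij js.
  by rewrite -!mem_rs !mem_nth // !index_uniq ?rs_uniq.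
- case; rewrite -!mem_rs => hb hc bc H; exists (ix b), (ix c).
  by rewrite bc index_mem hc !nth_index.
Qed.

(** The order of positions in [u] is one of the partial orders of which the heap is the
    intersection; antisymmetry of the heap follows. *)
Lemma heapP b c : hp b c ->
  [/\ b \in proots, c \in proots & (ix b <= ix c)%N].
Proof.
move/asboolP=> [/pos_rootsE pb /pos_rootsE pc H]; split=> //.
apply: (H (fun b c => is_true (ix b <= ix c)%N)).
- split=> [b' _|b' c' /pos_rootsE hb /pos_rootsE hc bc cb|b' c' d' _ _ _].
  + exact: leqnn.
  + by apply: ix_inj => //; apply/eqP; rewrite eqn_leq bc cb.
  + exact: leq_trans.
- by move=> b' c' /heap_genP[_ _ /ltnW].
Qed.

Lemma heap_gen_heap b c : heap_gen s A delta rho u b c -> hp b c.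
Proof.
move=> h; have [pb pc _ _] := (heap_genP b c).1 h.
by apply/asboolP; split; [exact/pos_rootsE | exact/pos_rootsE | move=> r _; apply].
Qed.

Lemma heap_trans : transitive hp.
Proof.
move=> c b d /asboolP[pb pc H1] /asboolP[_ pd H2]; apply/asboolP; split=> // r r1 r2.
have [_ _ tr] := r1; apply: tr (H1 r r1 r2) (H2 r r1 r2) => //.
Qed.

Lemma heap_anti : antisymmetric hp.
Proof.
move=> b c /andP[/heapP[pb pc bc] /heapP[_ _ cb]].
by apply: ix_inj => //; apply/eqP; rewrite eqn_leq bc cb.
Qed.

Lemma label_lt_ix b c : label_lt hp b c -> (ix b < ix c)%N.
Proof.
case/andP=> nbc /heapP[pb pc]; rewrite leq_eqVlt => /predU1P[e|//].
by move: nbc; rewrite (ix_inj pb pc e) eqxx.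
Qed.

Lemma dih_ix_increasing x i j k l : i != j -> vpos (act x (a_ i)) -> vpos (act x (a_ j)) ->
  (ix (act x (a_ i)) < ix (act x (a_ j)))%N -> (k < l < m_ i j)%N ->
  (ix (dih_root x i j k) < ix (dih_root x i j l))%N.
Proof.
move=> nij xi xj lt0 /andP[kl lm]; have km := ltn_trans kl lm.
have pr t : (t < m_ i j)%N -> dih_root x i j t \in proots.
  by move=> tm; apply/mem_proots; split; [exact: isroot_dih | exact: dih_root_pos].
rewrite ltnNge leq_eqVlt; apply/negP => /predU1P[e|lk].
  have := @dih_rootN x i j nij xi xj l l; rewrite leqnn lm => /(_ isT).
  rewrite (ix_inj (pr _ lm) (pr _ km) e) (dih_rootI nij xi xj (k := k) (l := l)) //.
  by rewrite kl ltnW.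
(* If the l-th root came before the k-th, the prefix ending with it would invert l but not k. If it
   inverts the first root, closedness adds k; otherwise it omits the last root as well, and
   coclosedness removes l. *)
pose N := (ix (dih_root x i j l)).+1; pose w := wp (take N u).
have iw t : (t < m_ i j)%N -> inv w (dih_root x i j t) = (ix (dih_root x i j t) < N)%N.
  by move=> tm; apply: inv_take => //; rewrite mem_rs pr.
have wl : inv w (dih_root x i j l) by rewrite iw.
have wk : ~~ inv w (dih_root x i j k) by rewrite iw // -leqNgt.
have m0 := m_gt0 i j.
have [h0|h0] := boolP (inv w (dih_root x i j 0)).
  case: k => [|k] in kl km wk lk *; first by rewrite h0 in wk.
  have h1 : (0 < k.+1 < l)%N by rewrite kl.
  have [p [q [p0 q0 e]]] := dih_cone x nij h1 lm.
  by case/negP: wk; apply: inv_closed p0 q0 e (pr _ km) h0 wl.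
have hm : ~~ inv w (dih_root x i j (m_ i j).-1).
  rewrite iw ?prednK // -leqNgt dih_root_last //.
  by move: h0; rewrite iw // -leqNgt dih_root_first => h0; exact: leq_trans h0 (ltnW lt0).
have lm' : (l < (m_ i j).-1)%N.
  rewrite ltn_neqAle -ltnS prednK // lm andbT.
  by apply: contraNneq hm => <-.
have h1 : (k < l < (m_ i j).-1)%N by rewrite kl.
have mm : ((m_ i j).-1 < m_ i j)%N by rewrite prednK.
have [p [q [p0 q0 e]]] := dih_cone x nij h1 mm.
by case/negP: (inv_coclosed p0 q0 e (pr _ km) (pr _ mm) wk hm).
Qed.

Lemma dih_psi2 x i j k : (k < m_ i j)%N -> i != j -> vpos (act x (a_ i)) ->
  vpos (act x (a_ j)) -> psi2 (act x (a_ i)) (act x (a_ j)) (dih_root x i j k).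
Proof.
move=> km nij xi xj; have [] := (dih_labelsE (dih_root x i j k) nij xi xj).1.
  by rewrite dih_labels // map_f // mem_iota.
by [].
Qed.

Lemma dih_rank_two x i j : i != j -> vpos (act x (a_ i)) -> vpos (act x (a_ j)) ->
  rank_two_subsystem s rho (psi2 (act x (a_ i)) (act x (a_ j))).
Proof.
by move=> nij xi xj; apply: psi2_rank_two; rewrite ?pos_simple_act ?dih_simple_neq.
Qed.

Lemma dih_ascending x i j : i != j -> vpos (act x (a_ i)) -> vpos (act x (a_ j)) ->
  m_ i j <> 2%N -> (ix (act x (a_ i)) < ix (act x (a_ j)))%N ->
  ascending hp lam (dih_chain x i j).
Proof.
move=> nij xi xj nm lt0; rewrite /ascending dih_labels //.
apply/(sortedP 0) => k; rewrite size_mkseq => km; rewrite !nth_mkseq ?(ltnW km) //.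
have lt1 : (ix (dih_root x i j k) < ix (dih_root x i j k.+1))%N.
  by apply: dih_ix_increasing; rewrite ?leqnn.
apply/andP; split; first by apply: contraTneq lt1 => ->; rewrite ltnn.
apply: heap_gen_heap; apply/heap_genP.
have pr t : (t < m_ i j)%N -> dih_root x i j t \in proots.
  by move=> tm; apply/mem_proots; split; [exact: isroot_dih | exact: dih_root_pos].
split; [exact: pr (ltnW km) | exact: pr | exact: lt1 |].
exists (psi2 (act x (a_ i)) (act x (a_ j))); split.
- exact: dih_rank_two.
- by move/(dih_comm nij xi xj).
- exact: dih_psi2 (ltnW km) nij xi xj.
- exact: dih_psi2.
Qed.

Lemma weak_polygonal : polygonal le_ hp lam.
Proof.
move=> x y c1 c2 /weak_polygonP[i [j [nij xi xj -> [-> ->]]]] nsq.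
have nm : m_ i j <> 2%N by move/(dih_square nij xi xj); apply/negP.
have nji : j != i by rewrite eq_sym.
have desc a b : a != b -> vpos (act x (a_ a)) -> vpos (act x (a_ b)) ->
    ascending hp lam (dih_chain x a b) -> descending hp lam (dih_chain x b a).
  by move=> nab xa xb; rewrite /ascending /descending (dih_labels_rev nab xa xb) rev_sorted.
case: (ltngtP (ix (act x (a_ i))) (ix (act x (a_ j)))) => h.
- have a1 := dih_ascending nij xi xj nm h.
  by left; split; [exact: a1 | exact: desc nij xi xj a1].
- have nm' : m_ j i <> 2%N by rewrite m_sym.
  have a1 := dih_ascending nji xj xi nm' h.
  by right; split; [exact: a1 | exact: desc nji xj xi a1].
- have := dih_simple_neq x nij.
  by rewrite (ix_inj (pos_simple_act xi) (pos_simple_act xj) h) eqxx.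
Qed.

(** * The grading of maximal chains *)

Definition extremal (b c : 'cV[R]_n) : Prop := b != c /\
  exists Psi, [/\ rank_two_subsystem s rho Psi, ~ comm Psi, Psi b, Psi c
    & forall d, d \in proots -> Psi d -> (ix b <= ix d <= ix c)%N].

(* The number of non-commutative rank-two subsystems traversed by the chain [C]
   in the order opposite to [u], each counted by its first and last root. *)
Definition chain_rank (C : seq gT) : nat :=
  count (fun p => `[< extremal p.1 p.2 >] &&
                  (index p.2 (labels lam C) < index p.1 (labels lam C))%N)
        [seq (b, c) | b <- proots, c <- proots].

Lemma labels_replace a x d t : labels lam (a ++ (x :: d) ++ t) =
  labels lam (rcons a x) ++ labels lam (x :: d) ++ labels lam (last x d :: t).
Proof.
case: a => [|z a] /=; first exact: pairmap_cat.
by rewrite -cats1 !pairmap_cat /= pairmap_cat -catA.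
Qed.

Lemma dih_subsystem Psi x i j b c : i != j -> vpos (act x (a_ i)) ->
  vpos (act x (a_ j)) -> rank_two_subsystem s rho Psi -> Psi b -> Psi c -> b != c ->
  b \in labels lam (dih_chain x i j) -> c \in labels lam (dih_chain x i j) ->
  Psi = psi2 (act x (a_ i)) (act x (a_ j)).
Proof.
move=> nij xi xj hPsi Pb Pc nbc /(dih_labelsE b nij xi xj)[hb vb].
move=> /(dih_labelsE c nij xi xj)[hc vc].
have pb : b \in proots by apply/mem_proots; split=> //; case: hb.
have pc : c \in proots by apply/mem_proots; split=> //; case: hc.
rewrite (rank_two_unique pb pc nbc hPsi Pb Pc); apply/esym.
exact: (rank_two_unique pb pc nbc (dih_rank_two nij xi xj) hb hc).
Qed.

Lemma mem_pairs p :
  p \in [seq (b, c) | b <- proots, c <- proots] -> p.1 \in proots /\ p.2 \in proots.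
Proof. by case/allpairsPdep=> b [c [hb hc ->]]. Qed.

(** A pair whose order changes has both roots among the labels of the square, hence spans its
    commutative subsystem, and such pairs are not counted. *)
Lemma chain_rank_square C C' :
  max_chain le_ C -> square_move le_ C C' -> chain_rank C = chain_rank C'.
Proof.
move=> mC [x [y [c1 [c2 [pol sq [a [t [eC eC']]]]]]]].
have [i [j [nij xi xj ey [e1 e2]]]] := weak_polygonP pol; subst y c1 c2.
have m2 := (dih_square nij xi xj).1 sq.
apply: eq_in_count => -[b c] _ /=; have [|//] := boolP `[< extremal b c >].
move/asboolP=> [nbc [Psi [hPsi ncomm Pb Pc _]]] /=.
rewrite eC eC' !labels_replace.
have -> : last x (mkseq (fun k => (x * palt j i k.+1)%g) (m_ j i)) =
          last x (mkseq (fun k => (x * palt i j k.+1)%g) (m_ i j)).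
  by rewrite !dih_last dih_top_sym.
apply/esym; apply: index_segment; last first.
  apply/negP=> /andP[hc hb]; apply: ncomm.
  by rewrite (dih_subsystem nij xi xj hPsi Pb Pc nbc hb hc); exact/(dih_comm nij xi xj).
by rewrite -!/(dih_chain _ _ _) (dih_labels_rev nij xi xj) perm_sym perm_rev.
Qed.

Lemma chain_rank_move C C' : max_chain le_ C ->
  increasing_move le_ hp lam C C' -> chain_rank C' = (chain_rank C).+1.
Proof.
move=> mC [x [y [c1 [c2 [pol nsq asc [a [t [eC eC']]]]]]]].
have [i [j [nij xi xj ey [e1 e2]]]] := weak_polygonP pol; subst y c1 c2.
have nm : m_ i j <> 2%N by move/(dih_square nij xi xj); apply/negP.
have m1 := m_gt1 nij; have m0 := m_gt0 i j.
set M := labels lam (dih_chain x i j) in asc.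
have eM : M = mkseq (dih_root x i j) (m_ i j) := dih_labels nij xi xj.
have sM : size M = m_ i j by rewrite eM size_mkseq.
have asc' : sorted (fun b c => (ix b < ix c)%N) M.
  by apply: sub_sorted asc => b c; exact: label_lt_ix.
have ltM k l : (k < l < m_ i j)%N -> (ix (nth 0%R M k) < ix (nth 0%R M l))%N.
  case/andP=> kl lm; pose r (b c : 'cV[R]_n) := (ix b < ix c)%N.
  have rt : transitive r by move=> b c d; exact: ltn_trans.
  by apply: (sorted_ltn_nth rt 0 asc'); rewrite // inE sM // (ltn_trans kl).
pose b0 := nth 0 M 0; pose c0 := nth 0 M (m_ i j).-1.
have memM k : (k < m_ i j)%N -> nth 0 M k \in M by move=> km; rewrite mem_nth ?sM.
have MP b : b \in M <-> psi2 (act x (a_ i)) (act x (a_ j)) b /\ vpos b.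
  exact: dih_labelsE.
have Mroot b : b \in M -> b \in proots.
  by move/MP=> [[rb _] vb]; apply/mem_proots.
have ncomm : ~ comm (psi2 (act x (a_ i)) (act x (a_ j))) by move/(dih_comm nij xi xj).
have between d : d \in M -> (ix b0 <= ix d <= ix c0)%N.
  move=> /(nthP 0)[k]; rewrite sM => km <-; apply/andP; split.
  - case: k km => [|k] km; first exact: leqnn.
    by apply: ltnW; apply: ltM; rewrite km.
  - have [->|nk] := eqVneq k (m_ i j).-1; first exact: leqnn.
    by apply: ltnW; apply: ltM; rewrite ltn_neqAle nk -ltnS prednK // km /=.
have mm : ((m_ i j).-1 < m_ i j)%N by rewrite prednK.
have lt0 : (ix b0 < ix c0)%N by apply: ltM; rewrite mm andbT -ltnS prednK.
have nbc0 : b0 != c0 by apply: contraTneq lt0 => ->; rewrite ltnn.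
have ext0 : extremal b0 c0.
  split=> //; exists (psi2 (act x (a_ i)) (act x (a_ j))); split=> //.
  - exact: dih_rank_two.
  - by have [] := (MP b0).1 (memM _ m0).
  - by have [] := (MP c0).1 (memM _ mm).
  - move=> d pd hd; apply: between; apply/MP; split=> //.
    by have [] := (mem_proots d).1 pd.
have lC := labels_replace a x (mkseq (fun k => (x * palt i j k.+1)%g) (m_ i j)) t.
have lC' := labels_replace a x (mkseq (fun k => (x * palt j i k.+1)%g) (m_ j i)) t.
rewrite -!/(dih_chain _ _ _) -/M -eC in lC; rewrite -!/(dih_chain _ _ _) -eC' in lC'.
have el : last x (mkseq (fun k => (x * palt j i k.+1)%g) (m_ j i)) =
          last x (mkseq (fun k => (x * palt i j k.+1)%g) (m_ i j)).
  by rewrite !dih_last dih_top_sym.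
rewrite el (dih_labels_rev nij xi xj) -/M in lC'.
have unC : uniq (labels lam C).
  case: (mC) => g [g' [_ _ /interval_chainP[c [-> pc _]]]].
  by have [] := labels_uniq pc.
have unM : uniq M by move: unC; rewrite lC !cat_uniq => /and3P[_ _ /andP[]].
have notL b : b \in M -> b \notin labels lam (rcons a x).
  move=> hb; apply/negP => hl; move: unC; rewrite lC cat_uniq.
  by case/and3P=> _ /hasPn/(_ b) + _; rewrite mem_cat hb => /(_ isT); rewrite hl.
(* [b0] and [c0] are the first and last labels of the ascending side, hence the extremes of the
   subsystem of this polygon; no other counted pair changes its order. *)
apply: (count_flip (p0 := (b0, c0))).
- by apply: allpairs_uniq; rewrite ?proots_uniq // => -[? ?] [? ?].
- by apply/allpairsPdep; exists b0, c0; rewrite !Mroot ?memM.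
- rewrite negb_and -leqNgt /= lC !index_cat.
  rewrite !(negPf (notL _ (memM _ _))) // !memM // leq_add2l.
  by rewrite !index_uniq ?sM // orbT.
- rewrite asboolT //= lC' !index_cat.
  rewrite !(negPf (notL _ (memM _ _))) // !mem_rev !memM // ltn_add2l.
  have e1 : c0 = nth 0 (rev M) 0 by rewrite nth_rev ?sM // subn1.
  have e2 : b0 = nth 0 (rev M) (m_ i j).-1 by rewrite nth_rev ?sM // prednK // subnn.
  by rewrite e1 e2 !index_uniq ?rev_uniq ?size_rev ?sM // -ltnS prednK.
move=> [b c] /mem_pairs[/= pb pc] ne; have [|//] := boolP `[< extremal b c >].
move/asboolP=> [nbc [Psi [hPsi nc Pb Pc mx]]] /=; rewrite lC lC'.
apply/esym; apply: index_segment; last first.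
  (* An extremal pair inside [M] spans the subsystem of [M], so it consists of the first and last
     roots of [M] in the order of [u]. *)
  apply/negP=> /andP[hc hb]; case/eqP: ne.
  have eP := dih_subsystem nij xi xj hPsi Pb Pc nbc hb hc.
  have mxM d : d \in M -> (ix b <= ix d <= ix c)%N.
    by move=> dM; apply: mx; [exact: Mroot | rewrite eP; have [] := (MP d).1 dM].
  congr (_, _); apply: ix_inj; rewrite ?Mroot ?memM //; apply/eqP; rewrite eqn_leq.
  + have /andP[-> _] := mxM _ (memM _ m0).
    by have /andP[-> _] := between _ hb.
  + have /andP[_ ->] := mxM _ (memM _ mm); rewrite andbT.
    by have /andP[_ ->] := between _ hc.
by rewrite perm_sym perm_rev.
Qed.

Lemma weak_MC_order : Relation_Definitions.order (MC le_) (MC_le hp lam).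
Proof. exact: graded_MC_order chain_rank_square chain_rank_move. Qed.

Lemma weak_polygon_complete : polygon_complete le_ hp lam.
Proof. exact: graded_polygon_complete chain_rank_square chain_rank_move. Qed.

End ReducedWord.

(** * Forcing *)

Lemma weak_covers_dual x y :
  covers le_ x y -> covers le_ (y * w0)%g (x * w0)%g.
Proof.
move=> xy; apply: coversP.
- by rewrite weak_dual (covers_le xy).
- by rewrite (inj_eq (mulIg w0)) eq_sym (covers_neq xy).
move=> z yz zx; have ez : z = (z * w0 * w0)%g by rewrite -mulgA w0_invol mulg1.
rewrite ez !weak_dual in yz zx.
by case: (covers_between xy zx yz) => e; [right | left]; rewrite ez e.
Qed.

Lemma covers_label x y : covers le_ x y ->
  lam x y \in proots /\ forall b, inv y b = inv x b || (b == lam x y).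
Proof.
case/weak_coversP=> i up ->; rewrite root_labelE //.
by split; [exact: pos_simple_act | move=> b; exact: inv_step].
Qed.

Lemma covers_label_new x y : covers le_ x y -> ~~ inv x (lam x y).
Proof. by case/weak_coversP=> i up ->; rewrite root_labelE // inv_simple_act. Qed.

Lemma label_dual x y : covers le_ x y -> lam (y * w0)%g (x * w0)%g = lam x y.
Proof.
move=> xy; have dxy := weak_covers_dual xy.
have [pl H] := covers_label dxy; have [_ H'] := covers_label xy.
have := covers_label_new dxy; have := H (lam (y * w0)%g (x * w0)%g).
rewrite eqxx orbT !inv_mul_w0 pl /= => nx; rewrite negbK H' (negPf nx) /=.
by move/eqP.
Qed.

(* The coordinate sum of the root rescaled to unit length, in the basis of
   rescaled simple roots. *)
Definition height (b : 'cV[R]_n) : R :=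
  (\sum_k b k 0 / inv_norm k) / Num.sqrt (K b b / 2).

Let H (v : 'cV[R]_n) : R := \sum_k v k 0 / inv_norm k.

Let HD u v : H (u + v) = H u + H v.
Proof. by rewrite /H -big_split; apply: eq_bigr => k _; rewrite mxE mulrDl. Qed.

Let HZ c v : H (c *: v) = c * H v.
Proof. by rewrite /H mulr_sumr; apply: eq_bigr => k _; rewrite mxE mulrA. Qed.

Let H_gt0 v : vpos v -> v != 0 -> 0 < H v.
Proof.
move=> vv nv; rewrite lt_neqAle sumr_ge0 ?andbT; last first.
  by move=> k _; rewrite divr_ge0 ?(vposP _ vv) ?ltW ?inv_norm_gt0.
rewrite eq_sym; apply: contra nv => /eqP h; apply/eqP/matrixP=> k l; rewrite ord1 mxE {l}.
have /eqP := h; rewrite psumr_eq0; last first.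
  by move=> i _; rewrite divr_ge0 ?(vposP _ vv) ?ltW ?inv_norm_gt0.
move/allP/(_ k); rewrite mem_index_enum => /(_ isT)/implyP/(_ isT).
by rewrite mulf_eq0 invr_eq0 (gt_eqF (inv_norm_gt0 k)) orbF => /eqP.
Qed.

(** Because K(b, b) = 2 delta_i for b = w a_i, normalising b means multiplying by [inv_norm i]; the
    height becomes the linear functional [H] on rescaled roots. *)
Let heightE w i : height (act w (a_ i)) = H (act w (e_ i)).
Proof.
rewrite /height K_root mulrAC divff ?pnatr_eq0 // mul1r actZ HZ mulrC.
by rewrite /inv_norm.
Qed.

(** At an interior label both sine coefficients are at least 1 ([cheb_ge1]), and the two ends have
    positive heights. *)
Lemma height_nonsimple x i j k : i != j -> vpos (act x (a_ i)) -> vpos (act x (a_ j)) ->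
  (0 < k)%N -> (k.+1 < m_ i j)%N -> height (act x (a_ j)) < height (dih_root x i j k).
Proof.
move=> nij xi xj k0 km.
have -> : height (dih_root x i j k) =
    cheb i j k.+1 * H (act x (e_ i)) + cheb i j k * H (act x (e_ j)).
  rewrite -!HZ -HD -(actZ _ _ (e_ i)) -(actZ _ _ (e_ j)) -actD -palt_e // -actM.
  exact: heightE.
have pos a : vpos (act x (a_ a)) -> 0 < H (act x (e_ a)).
  move=> va; apply: H_gt0; first by rewrite vpos_act_e.
  rewrite actZ scaler_eq0 negb_or gt_eqF ?inv_norm_gt0 //=.
  exact: root_neq0 (isroot_act x (isroot_simple a)).
have pi := pos i xi; have pj := pos j xj; rewrite heightE.
have c1 : 1 <= cheb i j k by apply: cheb_ge1; rewrite // k0 ltnW.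
have c2 : 1 <= cheb i j k.+1 by apply: cheb_ge1.
by nra.
Qed.

Section Forcing.
Variable b0 : 'cV[R]_n.

Definition contracted x y :=
  covers le_ x y && ((lam x y == b0) || (height b0 < height (lam x y))).

(** The opposite side above its first step carries the interior labels, which are higher than that
    of the contracted edge, and finally this very label. *)
Lemma contracted_closed x y a b d1 d2 :
  polygon le_ x y (x :: a :: d1) (x :: b :: d2) -> contracted x a -> path contracted b d2.
Proof.
move=> pol /andP[_ hc].
have [i [j [nij xi xj ey [e1 e2]]]] := weak_polygonP pol.
have nji : j != i by rewrite eq_sym.
move: e1; rewrite dih_chainE -{1}(prednK (m_gt0 i j)) /= dih_eltS dih_elt0 => -[ea _].
move: e2; rewrite dih_chainE -{1}(prednK (m_gt0 j i)) /= => -[-> ->].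
rewrite ea root_labelE // in hc.
have hb : height b0 <= height (act x (a_ i)) by case/orP: hc => [/eqP->|/ltW].
apply: path_iota_map => l; rewrite add1n prednK ?m_gt0 // => /andP[l0 lm].
apply/andP; split; first exact: dih_covers.
rewrite dih_label //.
have [el|nl] := eqVneq l (m_ j i).-1; first by rewrite el dih_root_last.
apply/orP; right; apply: le_lt_trans hb _; apply: height_nonsimple => //.
by rewrite -(prednK (m_gt0 j i)) ltnS ltn_neqAle nl -ltnS prednK ?m_gt0.
Qed.

Lemma contracted_congruence : lattice_congruence le_ (edge_cong contracted).
Proof.
apply: (@edge_cong_lattice _ le_ 1%g contracted (fun w => (w * w0)%g)).
- exact: weak_order.
- exact: weak_bot.
- exact: weak_up_polygonal.
- by move=> x y /andP[].
- exact: contracted_closed.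
- by move=> x; rewrite -mulgA w0_invol mulg1.
- by move=> x y; exact: weak_dual.
- move=> x y /andP[xy h]; rewrite /contracted weak_covers_dual //=.
  by rewrite label_dual.
Qed.

End Forcing.

Lemma weak_forcing_consistent : forcing_consistent le_ lam.
Proof.
suff half x y x' y' : covers le_ x y -> covers le_ x' y' ->
    forcing_equiv le_ x y x' y' -> height (lam x y) <= height (lam x' y') ->
    lam x y = lam x' y'.
  move=> x y x' y' xy xy' f; have [h|/ltW h] := leP (height (lam x y)) (height (lam x' y')).
    exact: half.
  by apply/esym/half => // th hth; split=> /(f th hth).
move=> xy xy' f hle; apply/eqP; apply: contraT => ne.
have c' : edge_cong (contracted (lam x' y')) x' y'.
  by apply: connect1; rewrite /contracted xy' eqxx.
have c := (f _ (contracted_congruence (lam x' y'))).2 c'.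
(* Contracted edges have label [lam x' y'] or a higher one, never [lam x y]; so whether [lam x y] is
   an inversion is constant on congruence classes, whereas it changes from [x] to [y]. *)
have keep u v : contracted (lam x' y') u v -> inv u (lam x y) = inv v (lam x y).
  case/andP=> uv h; have [_ ->] := covers_label uv.
  suff /negPf-> : lam x y != lam u v by rewrite orbF.
  apply/eqP=> e; rewrite -e (negPf ne) /= in h.
  by have := lt_le_trans h hle; rewrite ltxx.
have := edge_cong_invariant keep c.
have [_ ->] := covers_label xy.
by rewrite eqxx orbT (negPf (covers_label_new xy)).
Qed.

(** * Commutation moves *)

Lemma m_ii i : m_ i i = 1%N.
Proof. by rewrite /coxeter_m ss1 order1. Qed.

Lemma m2_commute i j : m_ i j = 2%N -> (s i * s j = s j * s i)%g.
Proof. by move=> m2; have := palt_m i j; rewrite m2 /= !mulg1. Qed.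

Lemma A0_m2 i j : i != j -> A i j = 0 -> m_ i j = 2%N.
Proof.
move=> nij A0; apply/eqP; rewrite eqn_leq m_gt1 // andbT leqNgt; apply/negP => m3.
have : cosm i j = 0.
  have : A i j * A j i = 4 * cosm i j ^+ 2 by case: hA => _ _ ->.
  by rewrite A0 mul0r => /esym/eqP; rewrite mulf_eq0 pnatr_eq0 /= sqrf_eq0 => /eqP.
apply/eqP; rewrite gt_eqF //; apply: cos_gt0_pihalf; apply/andP; split.
  by have := angle_gt0 i j; have := @pi_gt0 R; lra.
rewrite ltr_pM2l ?pi_gt0 // ltf_pV2 ?posrE // ?ltr_nat //.
by rewrite ltr0n m_gt0.
Qed.

(** The plane also contains Q = w a_j. With only two roots up to sign, two of P, Q and S = Q - a_ij
    P agree up to sign; this can only be Q and S, which forces a_ij = 0. *)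
Lemma comm_adjacent w i j : i != j ->
  comm (psi2 (act w (a_ i)) (act (w * s i)%g (a_ j))) -> m_ i j = 2%N.
Proof.
move=> nij [u [v [e _]]]; set P := act w (a_ i) in e; set S := act _ (a_ j) in e.
pose Q := act w (a_ j).
have eS : S = Q - A i j *: P by rewrite /S actM act_s_simple actD actN actZ.
have rP : isroot P := isroot_act w (isroot_simple i).
have rQ : isroot Q := isroot_act w (isroot_simple j).
have rS : isroot S := isroot_act _ (isroot_simple j).
have inP : psi2 P S P by split=> //; exists 1, 0; rewrite scale1r scale0r addr0.
have inS : psi2 P S S by split=> //; exists 0, 1; rewrite scale1r scale0r add0r.
have inQ : psi2 P S Q by split=> //; exists (A i j), 1; rewrite scale1r eS addrC subrK.
have cls t : psi2 P S t -> (t = u \/ t = - u) \/ (t = v \/ t = - v).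
  by rewrite e => -[[[]|]|]; auto.
have pm (t t' z : 'cV[R]_n) : t = z \/ t = - z -> t' = z \/ t' = - z -> t = t' \/ t = - t'.
  by case=> -> [->|->]; rewrite ?opprK; auto.
have ij0 : (i == j) = false by exact: negPf.
have ji0 : (j == i) = false by rewrite eq_sym.
have coordP (t t' : 'cV[R]_n) k : act w t = act w t' \/ act w t = - act w t' ->
    t k 0 = t' k 0 \/ t k 0 = - t' k 0.
  case=> [/act_inj->|]; first by left.
  by rewrite -actN => /act_inj->; right; rewrite mxE.
have PQ : ~ (P = Q \/ P = - Q).
  move=> /(coordP _ _ i); rewrite !simpleE eqxx ij0 oppr0.
  by case=> /eqP; rewrite oner_eq0.
have ES : S = act w ((- A i j) *: a_ i + 1 *: a_ j).
  by rewrite /S actM act_s_simple scale1r scaleNr addrC.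
have PS : ~ (P = S \/ P = - S).
  rewrite ES => /(coordP _ _ j); rewrite simpleE ji0 comb2_r //.
  by case=> /esym/eqP; rewrite ?oppr_eq0 oner_eq0.
have QS : Q = S \/ Q = - S -> A i j = 0.
  rewrite ES => /(coordP _ _ i); rewrite simpleE ij0 comb2_l //.
  by case=> /esym/eqP; rewrite ?opprK ?oppr_eq0 => /eqP.
apply: A0_m2 => //; case: (cls _ inP) (cls _ inQ) (cls _ inS) => [p|p] [q|q] [r|r].
- by case: PQ; exact: pm p q.
- by case: PQ; exact: pm p q.
- by case: PS; exact: pm p r.
- by apply: QS; exact: pm q r.
- by apply: QS; exact: pm q r.
- by case: PS; exact: pm p r.
- by case: PQ; exact: pm p q.
- by case: PQ; exact: pm p q.
Qed.

Local Notation hp u := (heap s A delta rho u).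

Lemma commutation_reduced u v :
  commutation_move s u v -> reduced_word s w0 u -> reduced_word s w0 v.
Proof.
case=> a [b [i [j [-> -> m2]]]] /reduced_wordP[e sz]; apply/reduced_wordP.
rewrite -sz -e !wp_cat !wp_cons wp_nil !size_cat /=; split=> //.
by rewrite !mulg1 (m2_commute m2).
Qed.

Lemma commutation_sym u v : commutation_move s u v -> commutation_move s v u.
Proof.
by case=> a [b [i [j [-> -> m2]]]]; exists a, b, j, i; split=> //; rewrite m_sym.
Qed.

Lemma commutation_roots a b i j : i != j -> m_ i j = 2%N ->
  word_roots 1%g (a ++ [:: i; j] ++ b) = word_roots 1%g a ++
    [:: act (wp a) (a_ i); act (wp a) (a_ j)] ++ word_roots (wp a * s i * s j)%g b.
Proof.
move=> nij m2; rewrite word_roots_cat mul1g /= actM act_s_simple.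
by rewrite (m2_orthogonal nij m2) scale0r subr0.
Qed.

Lemma commutation_heap_gen u v : reduced_word s w0 u -> commutation_move s u v ->
  forall b c, heap_gen s A delta rho u b c -> heap_gen s A delta rho v b c.
Proof.
move=> hu mv; have hv := commutation_reduced mv hu.
move=> d c /(heap_genP hu)[pd pc lt [Psi [hPsi nc Pd Pc]]]; apply/(heap_genP hv).
split=> //; last by exists Psi.
case: mv hu hv lt => a [b [i [j [-> -> m2]]]] hu hv.
have nij : i != j by apply: contra_eqN m2 => /eqP->; rewrite m_ii.
have nji : j != i by rewrite eq_sym.
have eu := commutation_roots a b nij m2.
have ev : word_roots 1%g (a ++ [:: j; i] ++ b) = word_roots 1%g a ++
    [:: act (wp a) (a_ j); act (wp a) (a_ i)] ++ word_roots (wp a * s i * s j)%g b.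
  by rewrite commutation_roots // 1?m_sym // -!mulgA (m2_commute m2).
have pi : act (wp a) (a_ i) \in proots.
  by rewrite -(mem_rs hu) eu !mem_cat !inE eqxx ?orbT.
have pj : act (wp a) (a_ j) \in proots.
  by rewrite -(mem_rs hu) eu !mem_cat !inE eqxx ?orbT.
rewrite ev eu => lt; set M := [:: act (wp a) (a_ i); act (wp a) (a_ j)] in lt.
rewrite (@index_segment _ _ M) //; first by apply/seq.permP => P /=; rewrite addnCA.
apply/negP; rewrite !inE => /andP[hd hc]; apply: nc.
have [Pi Pj] : Psi (act (wp a) (a_ i)) /\ Psi (act (wp a) (a_ j)).
  case/orP: hd => /eqP ed; case/orP: hc => /eqP ec; rewrite -?ed -?ec //.
  - by move: lt; rewrite ed ec ltnn.
  - by move: lt; rewrite ed ec ltnn.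
rewrite (rank_two_unique pi pj (dih_simple_neq _ nij) hPsi Pi Pj).
apply/(dih_comm nij) => //.
  by have [] := (mem_proots _).1 pi.
by have [] := (mem_proots _).1 pj.
Qed.

Lemma commutation_heap u v : reduced_word s w0 u -> commutation_move s u v ->
  hp u = hp v.
Proof.
have half u' v' : reduced_word s w0 u' -> commutation_move s u' v' ->
    forall b c, hp u' b c -> hp v' b c.
  move=> hu mv b c /asboolP[pb pc Hu]; apply/asboolP; split=> // r pr Hr.
  by apply: Hu => // b' c' /(commutation_heap_gen hu mv); exact: Hr.
move=> hu mv; apply/funext=> b; apply/funext=> c; apply/idP/idP; first exact: half.
apply: half; [exact: commutation_reduced mv hu | exact: commutation_sym].
Qed.

(** The roots of [u] are recorded by their positions in [u'] and sorted: at a descent the two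
    neighbouring letters commute, and exchanging them keeps the heap and raises the measure. A
    sorted record means u = u'. *)
Lemma heap_eq_commutation u u' : reduced_word s w0 u -> reduced_word s w0 u' ->
  hp u = hp u' -> clos_refl_sym_trans (seq 'I_n) (commutation_move s) u u'.
Proof.
move=> hu hu'; pose f v := [seq index b (word_roots 1%g u') | b <- word_roots 1%g v].
have szr v : reduced_word s w0 v -> size v = len w0 by case/reduced_wordP.
have fN v : reduced_word s w0 v -> all (fun k : nat => k <= len w0)%N (f v).
  move=> hv; apply/allP => k /mapP[b hb ->]; apply: ltnW.
  by rewrite -(szr u' hu') -(size_word_roots 1%g u') index_mem (mem_rs hu') -(mem_rs hv).
(* The bound of [weighted_sum_le] with initial weight 0 and both the number and the size of entries
   bounded by the length of [w0]. *)
pose B := (len w0 * len w0 * len w0)%N.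
have fB v : reduced_word s w0 v -> (weighted_sum 0 (f v) <= B)%N.
  move=> hv; have := weighted_sum_le 0 (fN v hv).
  by rewrite add0n size_map size_word_roots (szr v hv).
have [k] := ubnP (B - weighted_sum 0 (f u))%N; elim: k u hu => // k IH u hu kB e.
have permr : perm_eq (word_roots 1%g u) (word_roots 1%g u').
  apply: uniq_perm; rewrite ?(rs_uniq hu) ?(rs_uniq hu') // => b.
  by rewrite (mem_rs hu) (mem_rs hu').
have unf : uniq (f u).
  rewrite map_inj_in_uniq ?(rs_uniq hu) // => b c hb hc.
  by apply: (ix_inj hu'); rewrite -(mem_rs hu).
have [srt|/unsorted_split[l1 [x [y [l2 [ef yx]]]]]] := boolP (sorted ltn (f u)).
  have e1 : f u = f u'.
    apply: (irr_sorted_eq ltn_trans ltnn srt).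
      rewrite [f u'](_ : _ = iota 0 (size (word_roots 1%g u'))) ?iota_ltn_sorted //.
      apply: (@eq_from_nth _ 0%N); rewrite ?size_map ?size_iota // => l lm.
      by rewrite (nth_map 0) // nth_iota // index_uniq ?(rs_uniq hu').
    by move=> l; apply: perm_mem; exact: perm_map permr.
  have back v : reduced_word s w0 v ->
      word_roots 1%g v = [seq nth 0 (word_roots 1%g u') k | k <- f v].
    move=> hv; rewrite /f -map_comp -[LHS]map_id; apply/eq_in_map => b hb /=.
    by rewrite nth_index // (mem_rs hu') -(mem_rs hv).
  suff -> : u = u' by exact: rst_refl.
  apply: (@word_roots_inj 1%g); apply: etrans (back u hu) _.
  by rewrite e1; exact: esym (back u' hu').
have {}yx : (y < x)%N.
  rewrite ltn_neqAle yx andbT; apply/eqP=> exy; move: unf.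
  by rewrite ef exy cat_uniq /= mem_head !andbF.
have szu : size u = (size l1 + (size l2).+2)%N.
  by rewrite -(size_word_roots 1%g)
       -(size_map (fun b => index b (word_roots 1%g u'))) -/(f u) ef size_cat.
pose a := take (size l1) u.
have sa : size a = size l1 by rewrite size_takel // szu leq_addr.
have [i [j [b eu]]] : exists i j b, u = a ++ [:: i; j] ++ b.
  have := size_drop (size l1) u; rewrite szu addKn.
  case ed : (drop (size l1) u) => [|i [|j b]] //= _; exists i, j, b.
  by rewrite -ed cat_take_drop.
set b1 := act (wp a) (a_ i); set b2 := act (wp a * s i)%g (a_ j).
have eR : word_roots 1%g u = word_roots 1%g a ++ [:: b1, b2 & word_roots (wp a * s i * s j)%g b].
  by rewrite {1}eu word_roots_cat mul1g.
have := ef; rewrite /f eR map_cat => /eqP.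
rewrite eqseq_cat ?size_map ?size_word_roots //= => /andP[/eqP el1 /eqP[ex ey el2]].
have pb1 : b1 \in proots by rewrite -(mem_rs hu) eR mem_cat mem_head orbT.
have pb2 : b2 \in proots by rewrite -(mem_rs hu) eR mem_cat !inE eqxx !orbT.
have nij : i != j.
  apply/eqP=> eij; have := (mem_proots b2).1 pb2; rewrite /b2 -eij actM act_s_self actN.
  case=> _; rewrite root_sign; last exact: isroot_act (isroot_simple i).
  by have [_ ->] := (mem_proots b1).1 pb1.
have nb : b1 != b2.
  have := rs_uniq hu; rewrite eR cat_uniq => /and3P[_ _].
  by rewrite cons_uniq inE negb_or => /andP[/andP[]].
(* In a non-commutative subsystem [b1] would precede [b2] in the heap of [u], hence in that of [u'],
   where their positions are the other way round. *)
have m2 : m_ i j = 2%N.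
  case: (pselect (comm (psi2 b1 b2))) => [|nc]; first exact: comm_adjacent.
  have hg : heap_gen s A delta rho u b1 b2.
    apply/(heap_genP hu); split=> //.
      have n1 : nth 0 (word_roots 1%g u) (size a) = b1.
        by rewrite eR nth_cat size_word_roots ltnn subnn.
      have n2 : nth 0 (word_roots 1%g u) (size a).+1 = b2.
        by rewrite eR nth_cat size_word_roots ltnNge leqnSn /= subSnn.
      have su : size (word_roots 1%g u) = (size a + (size l2).+2)%N.
        by rewrite size_word_roots szu sa.
      rewrite -n1 -n2 !index_uniq ?(rs_uniq hu) // su.
        by rewrite !addnS !ltnS leq_addr.
      by rewrite !addnS !ltnS leqW // leq_addr.
    exists (psi2 b1 b2); split=> //; first exact: psi2_rank_two.
      split; first by have [] := (mem_proots b1).1 pb1.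
      by exists 1, 0; rewrite scale1r scale0r addr0.
    split; first by have [] := (mem_proots b2).1 pb2.
    by exists 0, 1; rewrite scale1r scale0r add0r.
  have := heap_gen_heap hu hg; rewrite e => /(heapP hu')[_ _].
  by rewrite ex ey leqNgt yx.
pose v := a ++ [:: j; i] ++ b.
have mv : commutation_move s u v by exists a, b, i, j.
have hv := commutation_reduced mv hu.
apply: rst_trans (rst_step _ _ _ _ mv) _; apply: IH => //; last first.
  by rewrite -(commutation_heap hu mv).
have fv : f v = l1 ++ [:: y, x & l2].
  rewrite /f /v commutation_roots // 1?eq_sym // 1?m_sym // map_cat /= el1 -el2.
  rewrite -mulgA -(m2_commute m2) mulgA ex -ey /b2 actM act_s_simple.
  by rewrite (m2_orthogonal nij m2) scale0r subr0.
have := weighted_sum_swap 0 l1 l2 yx; rewrite -fv -ef => hlt.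
have := fB v hv; lia.
Qed.

Lemma commutation_heap_eq u u' : reduced_word s w0 u ->
  clos_refl_sym_trans (seq 'I_n) (commutation_move s) u u' -> hp u = hp u'.
Proof.
move=> hu /clos_rst_rst1n_iff h; elim: h hu => {u u'} [//|u v w mv _ IH hu].
have hv : reduced_word s w0 v.
  by case: mv => mv; [|have {}mv := commutation_sym mv]; exact: commutation_reduced mv hu.
rewrite -IH //; case: mv => [mv|/commutation_sym mv]; exact: commutation_heap.
Qed.

End LongestElement.
End FiniteCoxeterGroups.

Local Open Scope classical_set_scope.

Theorem mainTheorem5 (R : realType) (gT : finGroupType) (n : nat)
    (s : 'I_n -> gT) (hW : coxeter_system s)
    (A : 'M[R]_n) (hA : cartan_matrix s A)
    (delta : 'I_n -> R) (hdelta : symmetriser s A delta)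
    (rho : mx_representation R [set: gT]%SET n)
    (hrho : reflection_representation s A rho)
    (w0 : gT) (hw0 : longest s w0) :
  let le := weak_le rho in
  let lam := root_label rho in
  let hp := heap s A delta rho in
  [/\ (forall u u', reduced_word s w0 u -> reduced_word s w0 u' ->
        (hp u = hp u' <->
         clos_refl_sym_trans (seq 'I_n) (commutation_move s) u u')),
      (forall x y c1 c2, polygon le x y c1 c2 ->
        exists Psi, [/\ rank_two_subsystem s rho Psi,
          (forall c, interval_chain le x y c ->
            [set` labels lam c] = Psi `&` pos_roots rho)
          & square le x y <-> commutative_subsystem A delta Psi]),
      (forall u, reduced_word s w0 u ->
        [/\ polygonal le (hp u) lam, forcing_consistent le lam
          & polygon_complete le (hp u) lam]),
      (forall u, reduced_word s w0 u ->
        Relation_Definitions.order (MC le) (MC_le (hp u) lam))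
    & (forall u (th : rel gT), reduced_word s w0 u ->
        lattice_congruence le th ->
        exists f : MC le -> MC (quot_le le th),
          (forall X c, sval X c -> sval (f X) (quot_chain th c)) /\
          contraction (MC_le (hp u) lam)
            (MC_le (hp u) (quot_label le th 0 lam)) f)].
Proof.
move=> le lam hp; split.
- move=> u u' hu hu'; split.
    exact: (heap_eq_commutation hW hA hdelta hrho hw0).
  exact: (commutation_heap_eq hW hA hdelta hrho hw0).
- move=> x y c1 c2 /(weak_polygonP hW hA hdelta hrho)[i [j [nij xi xj -> _]]].
  exists (psi2 rho (act rho x (simple_root R i)) (act rho x (simple_root R j))).
  split; first exact: (dih_rank_two hW hA hdelta hrho).
    move=> c hc; apply/seteqP.
    have lab b := dih_labelsE hW hA hdelta hrho b nij xi xj.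
    have labc b : (b \in labels lam c) =
        (b \in labels lam (dih_chain s x i j)).
      case: (dih_interval_chains hW hA hdelta hrho nij xi xj hc) => -> //.
      by rewrite (dih_labels_rev hW hA hdelta hrho nij xi xj) mem_rev.
    split=> b; rewrite /= labc => h.
      have [hb /vposP vb] := (lab b).1 h.
      by split=> //; split=> //; case: hb.
    by case: h => hb [_ vb]; apply/lab; split=> //; exact/vposP.
  apply: iff_trans (dih_square hW hA hdelta hrho nij xi xj) _.
  exact: iff_sym (dih_comm hW hA hdelta hrho nij xi xj).
- move=> u hu; split.
  + exact: (weak_polygonal hW hA hdelta hrho hw0 hu).
  + exact: (weak_forcing_consistent hW hA hdelta hrho hw0).
  + exact: (weak_polygon_complete hW hA hdelta hrho hw0 hu).
- by move=> u hu; exact: (weak_MC_order hW hA hdelta hrho hw0 hu).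
move=> u th hu hth.
have ord := weak_order hW hA hdelta hrho.
have bot := weak_bot hW hA hdelta hrho.
have up := weak_up_polygonal hW hA hdelta hrho.
exists (quot_MC ord bot up hth); split; first exact: quot_MCE.
apply: (quot_MC_contraction _ _ (weak_top hW hA hdelta hrho hw0)).
- exact: heap_trans.
- exact: (heap_anti hW hA hdelta hrho hw0 hu).
- exact: (weak_polygonal hW hA hdelta hrho hw0 hu).
- exact: (weak_forcing_consistent hW hA hdelta hrho hw0).
- exact: (weak_polygon_complete hW hA hdelta hrho hw0 hu).
Qed.
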